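(* Let $p=p(n)$, let $\{x_{jk}\}_{j,k\ge 1}$ be a double array of complex random variables, for each $n$ and $1\le k\le n$ let $m_k=m_k(n)$ be a positive integer, $\mathbf B_k=\mathbf B_k(n)$ a non-random complex $p\times m_k$ matrix, $\boldsymbol\Sigma_k=\mathbf B_k\mathbf B_k^*$, and for each $n$ let $\mathbf A_n$ be a non-random $p\times p$ matrix. Assume: (a) the $x_{jk}$, $j,k=1,2,\dots$, are independent and identically distributed with $\mathrm E\,x_{11}=0$, $\mathrm E|x_{11}|^2=1$ and $\mathrm E|x_{11}|^4=\mu<\infty$; (b) $\mathbf Y_n=(\mathbf y_1,\dots,\mathbf y_n)$ is the $p\times n$ matrix with columns $\mathbf y_k=\mathbf B_k\mathbf x_k$, where $\mathbf x_k=(x_{1k},\dots,x_{m_kk})^{T}$, $k=1,\dots,n$; (c) the spectral norms are bounded: $\sup_n\max_{1\le k\le n}\|\boldsymbol\Sigma_k\|<\infty$; (d) $\mathbf A_n$ is Hermitian nonnegative definite; (e) as $n\to\infty$, $c_n=p/n\to c\in(0,\infty)$, $c_{nk}=m_k/n\to c_k\in(0,\infty)$ for each $k$, and $\limsup_{n\to\infty}\sup_{1\le k\le n}c_k\le M$ for some constant $M<\infty$. Let $\mathbf S_n=\frac1n\mathbf Y_n\mathbf Y_n^*+\mathbf A_n$, and let $m_{F^{\mathbf S_n}}(z)$ be the Stieltjes transform of its empirical spectral distribution $F^{\mathbf S_n}$. Then for each $n$ the system of equations $$e_{nk}(z)=\frac1n\operatorname{tr}\left[\boldsymbol\Sigma_k\left(\frac1n\sum_{j=1}^n\frac{\boldsymbol\Sigma_j}{1+e_{nj}(z)}+\mathbf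 A_n-z\mathbf I_p\right)^{-1}\right],\qquad k=1,\dots,n,\ z\in\mathbb C^+,$$ has a unique solution $(e_{n1},\dots,e_{nn})$ such that each $e_{nk}$ is the Stieltjes transform of a nonnegative finite measure on $\mathbb R^+$; and, defining with this solution $$m_n^0(z)=\frac1p\operatorname{tr}\left(\frac1n\sum_{k=1}^n\frac{\boldsymbol\Sigma_k}{1+e_{nk}(z)}+\mathbf A_n-z\mathbf I_p\right)^{-1},$$ one has, for any $z\in\mathbb C^+$, $m_{F^{\mathbf S_n}}(z)-m_n^0(z)\to0$ almost surely as $n\to\infty$.
   Context: For a $p\times p$ Hermitian matrix $\mathbf A$ with eigenvalues $\lambda_1(\mathbf A),\dots,\lambda_p(\mathbf A)$, the empirical spectral distribution is $F^{\mathbf A}(x)=\frac1p\sum_{j=1}^p I(\lambda_j(\mathbf A)\le x)$, where $I(\cdot)$ is the indicator function. Its Stieltjes transform is $m_{F^{\mathbf A}}(z)=\int\frac1{x-z}\,dF^{\mathbf A}(x)=\frac1p\operatorname{tr}(\mathbf A-z\mathbf I_p)^{-1}$ for $z\in\mathbb C^+=\{z\in\mathbb C:\Im z>0\}$. The Stieltjes transform of a finite nonnegative measure $\nu$ on $\mathbb R^+=[0,\infty)$ is $z\mapsto\int\frac1{x-z}\,d\nu(x)$. $\|\cdot\|$ is the spectral norm, ${}^*$ is conjugate transpose, and $\mathbf I_p$ is the $p\times p$ identity. *)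

(* Defs.v *)
From HB Require Import structures.
From mathcomp Require Import all_boot all_order all_algebra finmap.
From mathcomp Require Import complex.
From mathcomp Require Import all_classical all_reals all_analysis.

Set Implicit Arguments.
Unset Strict Implicit.
Unset Printing Implicit Defensive.

Import Order.TTheory GRing.Theory Num.Theory.
Import numFieldNormedType.Exports.
Export numFieldNormedType.Exports.

Local Open Scope classical_set_scope.
Local Open Scope ring_scope.
Local Open Scope complex_scope.
Local Open Scope sesquilinear_scope.

Notation cRe := complex.Re.
Notation cIm := complex.Im.
(* The modulus, as an element of R; the norm `|z| of the library lives in R[i]. *)
Notation cabs := ComplexField.Normc.normc.

Definition cintegral d (T : measurableType d) (R : realType)
    (mu : {measure set T -> \bar R}) (f : T -> R[i]) : R[i] :=
  (\int[mu]_t cRe (f t))%R +i* (\int[mu]_t cIm (f t))%R.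

Definition stieltjes (R : realType)
    (nu : {measure set (measurableTypeR R) -> \bar R}) (z : R[i]) : R[i] :=
  cintegral nu (fun t : measurableTypeR R => ((t : R)%:C - z)^-1).

(* f agrees on the upper half-plane with the Stieltjes transform of a finite
   measure carried by [0, +oo[. *)
Definition is_stieltjes_Rplus (R : realType) (f : R[i] -> R[i]) : Prop :=
  exists2 nu : {finite_measure set (measurableTypeR R) -> \bar R},
    nu (`]-oo, (0 : R)[%classic : set R) = 0%E &
    forall z : R[i], 0 < cIm z -> f z = stieltjes nu z.

(* Empirical spectral distribution of a Hermitian matrix.  For a Hermitian (more
   generally normal) A, spectral_diag A lists the eigenvalues with multiplicity:
   see orthomx_spectralP, and hermitian_spectral_diag_real for realness. *)
Definition eigval (R : realType) p (A : 'M[R[i]]_p) (j : 'I_p) : R :=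
  cRe (spectral_diag A 0 j).

Definition esd (R : realType) p (A : 'M[R[i]]_p) (x : R) : R :=
  p%:R^-1 * \sum_(j < p) (eigval A j <= x)%R%:R.

Section esd_cumulative.
Variables (R : realType) (p : nat) (A : 'M[R[i]]_p).

Let esd_nd : nondecreasing (esd A).
Proof.
move=> x y xy; apply: ler_wpM2l; first by rewrite invr_ge0.
apply: ler_sum => j _; rewrite ler_nat.
by case: (boolP (eigval A j <= x)) => // /le_trans/(_ xy) ->.
Qed.

Let esd_rc : right_continuous (esd A).
Proof.
move=> x; apply: cvgMl_tmp; apply: cvg_big => [|j _].
  exact: add_continuous.
apply: cvg_near_cst; have [lex|ltx] := leP (eigval A j) x.
  near=> y; have -> // : eigval A j <= y.
  by apply: (le_trans lex); apply: ltW; near: y; exact: nbhs_right_gt.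
near=> y; have -> // : (eigval A j <= y) = false.
by apply/negbTE; rewrite -ltNge; near: y; exact: nbhs_right_lt.
Unshelve. all: by end_near. Qed.

HB.instance Definition _ := isCumulative.Build R _ R (esd A) esd_nd esd_rc.

End esd_cumulative.

(* Stieltjes transform of F^A, i.e. the integral of 1/(x - z) dF^A(x). *)
Definition stieltjes_esd (R : realType) p (A : 'M[R[i]]_p) (z : R[i]) : R[i] :=
  stieltjes (lebesgue_stieltjes_measure (esd A)) z.

Definition nonneg_def (R : realType) p (A : 'M[R[i]]_p) : Prop :=
  forall v : 'cV[R[i]]_p, 0 <= (v ^t* *m A *m v) 0 0.

Definition l2norm (R : realType) p (v : 'cV[R[i]]_p) : R :=
  Num.sqrt (\sum_(i < p) cabs (v i 0) ^+ 2).

Definition spectral_norm (R : realType) p q (A : 'M[R[i]]_(p, q)) : R :=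
  sup [set l2norm (A *m v) | v in [set v : 'cV[R[i]]_q | l2norm v <= 1]].

(* Complex random variables.  R[i] is identified with R * R, whose product
   sigma-algebra is the Borel one. *)
Definition cpair (R : realType) (z : R[i]) : R * R := (cRe z, cIm z).

Section complex_random_variables.
Variables (d : measure_display) (T : measurableType d) (R : realType).
Variable P : probability T R.

Definition complex_rv (X : T -> R[i]) : Prop :=
  measurable_fun setT (@cpair R \o X).

Definition identically_distributed (I : Type) (X : I -> T -> R[i]) : Prop :=
  forall (i j : I) (D : set (R * R)), measurable D ->
    P ((@cpair R \o X i) @^-1` D) = P ((@cpair R \o X j) @^-1` D).

Definition independent (I : choiceType) (X : I -> T -> R[i]) : Prop :=
  forall (J : {fset I}) (D : I -> set (R * R)),
    (forall i, i \in J -> measurable (D i)) ->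
    P (\bigcap_(i in [set` J]) (@cpair R \o X i) @^-1` D i) =
    (\prod_(i <- J) P ((@cpair R \o X i) @^-1` D i))%E.

End complex_random_variables.

(* Columns y_k = B_k x_k, where x_k = (x_(j,k))_(j < m_k).  Indices start at 0. *)
Definition data_matrix (R : realType) (n p : nat) (m : nat -> nat)
    (B : forall k, 'M[R[i]]_(p, m k)) (x : nat -> nat -> R[i]) :
    'M[R[i]]_(p, n) :=
  \matrix_(i < p, k < n) (B k *m \col_(j < m k) x j k) i 0.

Definition pop_cov (R : realType) (p m : nat) (B : 'M[R[i]]_(p, m)) :
  'M[R[i]]_p := B *m B ^t*.

Definition sample_mx (R : realType) (n p : nat) (Y : 'M[R[i]]_(p, n))
    (A : 'M[R[i]]_p) : 'M[R[i]]_p :=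
  n%:R^-1 *: (Y *m Y ^t*) + A.

Section deterministic_equivalent.
Variables (R : realType) (n p : nat).
Variables (Sigma : 'I_n -> 'M[R[i]]_p) (A : 'M[R[i]]_p).

(* The matrix inverse and the scalar inverses are the total ones of the library
   but are only met where they are genuine: for e_j(z) the Stieltjes transform
   of a measure on [0, +oo[ and 0 < Im z, one has 1 + e_j(z) != 0 and the
   imaginary part of the inverted matrix is <= - Im z. *)
Definition det_resolvent (e : 'I_n -> R[i] -> R[i]) (z : R[i]) :
    'M[R[i]]_p :=
  invmx (n%:R^-1 *: (\sum_(j < n) (1 + e j z)^-1 *: Sigma j) + A - z%:M).

Definition det_solution (e : 'I_n -> R[i] -> R[i]) : Prop :=
  (forall k, is_stieltjes_Rplus (e k)) /\
  (forall k (z : R[i]), 0 < cIm z ->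
    e k z = n%:R^-1 * \tr (Sigma k *m det_resolvent e z)).

Definition det_stieltjes (e : 'I_n -> R[i] -> R[i]) (z : R[i]) : R[i] :=
  p%:R^-1 * \tr (det_resolvent e z).

End deterministic_equivalent.

(* Main.v *)
Require Import Defs.
From mathcomp Require Import all_boot all_order all_algebra finmap.
From mathcomp Require Import complex.
From mathcomp Require Import all_classical all_reals all_analysis.
From mathcomp Require Import measurable_realfun.
From mathcomp Require Import ring lra.

Set Implicit Arguments.
Unset Strict Implicit.
Unset Printing Implicit Defensive.

Import Order.TTheory GRing.Theory Num.Theory.

Local Open Scope classical_set_scope.
Local Open Scope ring_scope.
Local Open Scope complex_scope.
Local Open Scope sesquilinear_scope.

(** The two transforms are compared first at points far above the real axis,
   where everything is a contraction, and the comparison then descends to the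
   whole upper half-plane.

   The descent is [stieltjes_vanish].  The Taylor expansion at x + iV of the
   Stieltjes transform of a measure carried by the real axis converges on the
   disc of radius V, at a rate that depends only on the mass.  If differences of
   such transforms, with bounded masses, tend to 0 at points x + i(V + h) with h
   arbitrarily small, their Taylor coefficients tend to 0 one after the other,
   so that the differences tend to 0 at all x + iy with 0 < y < 2V.

   The deterministic system.  At z, the Stieltjes transform e of a measure on
   [0, +oo[ satisfies Im e >= 0 and Im (z e) >= 0 ([good]), whence
   |1 + e| >= Im z / |z|, and the matrix to be inverted has an imaginary part
   bounded above by - Im z.  The right-hand side of the system is therefore
   Lipschitz for the mean distance n^-1 sum_k |e_k - f_k|, with a factor at most
   1/2 when Im z is large ([det_map_contract]).  This gives uniqueness far from
   the axis, and the descent gives it everywhere.  For existence one iterates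
   from 0.  The iterates are Stieltjes transforms of finitely supported measures
   of controlled mass: with e(z) a quadratic form in a resolvent, a summand
   b b^* / (1 + e) is a Schur complement in a larger nonnegative Hermitian pencil
   ([realizedD]), so the inverted matrix is a corner of a genuine resolvent.
   Such families are compact ([discr_ultralimit]), and a limit along an
   ultrafilter is a solution because consecutive iterates get close.

   The random matrix.  Let R be the resolvent of S_n at z.  Adding the column
   y_k changes a trace n^-1 tr Q R by a ratio of quadratic forms in y_k with
   matrices independent of y_k; the fourth moment makes such a normalized form
   deviate from its mean by O(n^-1/2) in mean square ([mean2_quadratic_column],
   [form_mean_deviation]).  The Efron-Stein inequality then bounds the mean
   square fluctuation of n^-1 tr Q R by O(n^-2) ([res_trace_variance]).  Rather
   than computing expectations, one fixes a realization close to all others in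
   mean square ([exists_center]); its traces f_k = n^-1 tr Sigma_k R satisfy the
   system up to O(n^-1/2) ([mean2_det_map]), so far from the axis the contraction
   brings them, and n^-1 tr R, within O(n^-1/2) of the exact solution
   ([det_equivalent]).

   Since n^-2 is summable, n^-1 tr R minus its deterministic equivalent tends to
   0 almost surely at each far point ([ae_vanish_far]), hence simultaneously at
   countably many points of a vertical line, and the descent, applied
   realization by realization, reaches every z ([ae_vanish_tr]).  The factor n/p
   between the two normalizations of the trace tends to 1/c. *)

(** * Complex numbers, Euclidean vectors and operator bounds *)

Section ComplexBasics.
Variable R : realType.
Local Notation C := R[i].
Implicit Types (x y z : C).

Lemma ReD x y : cRe (x + y) = cRe x + cRe y.
Proof. by case: x; case: y. Qed.

Lemma ImD x y : cIm (x + y) = cIm x + cIm y.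
Proof. by case: x; case: y. Qed.

Lemma ReN x : cRe (- x) = - cRe x. Proof. by case: x. Qed.

Lemma ImN x : cIm (- x) = - cIm x. Proof. by case: x. Qed.

Lemma ReB x y : cRe (x - y) = cRe x - cRe y.
Proof. by rewrite ReD ReN. Qed.

Lemma ImB x y : cIm (x - y) = cIm x - cIm y.
Proof. by rewrite ImD ImN. Qed.

Lemma ReM x y : cRe (x * y) = cRe x * cRe y - cIm x * cIm y.
Proof. by case: x; case: y. Qed.

Lemma ImM x y : cIm (x * y) = cRe x * cIm y + cIm x * cRe y.
Proof. by case: x => a b; case: y => c d /=; rewrite addrC mulrC addrC mulrC. Qed.

Lemma ReZ (a : R) y : cRe (a%:C * y) = a * cRe y.
Proof. by rewrite ReM /= mul0r subr0. Qed.

Lemma ImZ (a : R) y : cIm (a%:C * y) = a * cIm y.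
Proof. by rewrite ImM /= mul0r addr0. Qed.

Lemma Re_conj x : cRe (x^*)%C = cRe x. Proof. by case: x. Qed.

Lemma Im_conj x : cIm (x^*)%C = - cIm x. Proof. by case: x. Qed.

Lemma Re_sum I (r : seq I) (P : pred I) (F : I -> C) :
  cRe (\sum_(i <- r | P i) F i) = \sum_(i <- r | P i) cRe (F i).
Proof. by apply: (big_morph _ ReD). Qed.

Lemma Im_sum I (r : seq I) (P : pred I) (F : I -> C) :
  cIm (\sum_(i <- r | P i) F i) = \sum_(i <- r | P i) cIm (F i).
Proof. by apply: (big_morph _ ImD). Qed.

Lemma eqC x y : cRe x = cRe y -> cIm x = cIm y -> x = y.
Proof. by case: x => a b; case: y => c d /= -> ->. Qed.

Lemma natVC n : n%:R^-1 = (n%:R^-1 : R)%:C :> C.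
Proof. by rewrite fmorphV rmorph_nat. Qed.

Lemma cabs_ge0 x : 0 <= cabs x.
Proof. by case: x => a b /=; exact: sqrtr_ge0. Qed.

Lemma cabs_sqr x : cabs x ^+ 2 = cRe x ^+ 2 + cIm x ^+ 2.
Proof. by case: x => a b /=; rewrite sqr_sqrtr // addr_ge0 // sqr_ge0. Qed.

Lemma cabsM x y : cabs (x * y) = cabs x * cabs y.
Proof. exact: ComplexField.Normc.normcM. Qed.

Lemma cabsV x : cabs x^-1 = (cabs x)^-1.
Proof. exact: ComplexField.Normc.normcV. Qed.

Lemma cabsD x y : cabs (x + y) <= cabs x + cabs y.
Proof. exact: complex.le_normcD. Qed.

Lemma cabsN x : cabs (- x) = cabs x.
Proof. exact: complex.normcN. Qed.

Lemma cabsB x y : cabs (x - y) <= cabs x + cabs y.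
Proof. by rewrite -(cabsN y); exact: cabsD. Qed.

Lemma cabs_conj x : cabs (x^*)%C = cabs x.
Proof. by case: x => a b /=; rewrite sqrrN. Qed.

Lemma cabsR (a : R) : cabs a%:C = `|a|.
Proof. by rewrite /= expr0n /= addr0 sqrtr_sqr. Qed.

Lemma cabs0 : cabs (0 : C) = 0.
Proof. by rewrite (cabsR 0) normr0. Qed.

Lemma cabs1 : cabs (1 : C) = 1.
Proof. by rewrite (cabsR 1) normr1. Qed.

Lemma cabsX x n : cabs (x ^+ n) = cabs x ^+ n.
Proof.
by elim: n => [|n IH]; rewrite ?expr0 ?cabs1 // !exprS cabsM IH.
Qed.

Lemma cabs_eq0 x : cabs x = 0 -> x = 0.
Proof. exact: ComplexField.Normc.eq0_normc. Qed.

Lemma cabs_gt0 x : x != 0 -> 0 < cabs x.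
Proof.
move=> x0; rewrite lt_def cabs_ge0 andbT; apply: contra x0 => /eqP/cabs_eq0 ->.
by [].
Qed.

Lemma Re_le_cabs x : `|cRe x| <= cabs x.
Proof.
rewrite -(ler_pXn2r (n := 2)) ?nnegrE ?cabs_ge0 //.
by rewrite cabs_sqr real_normK ?num_real // lerDl sqr_ge0.
Qed.

Lemma Im_le_cabs x : `|cIm x| <= cabs x.
Proof.
rewrite -(ler_pXn2r (n := 2)) ?nnegrE ?cabs_ge0 //.
by rewrite cabs_sqr real_normK ?num_real // lerDr sqr_ge0.
Qed.

Lemma cabs_le_ReIm x : cabs x <= `|cRe x| + `|cIm x|.
Proof.
rewrite -(ler_pXn2r (n := 2)) ?nnegrE ?cabs_ge0 ?addr_ge0 //.
rewrite cabs_sqr sqrrD !real_normK ?num_real //.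
have := mulr_ge0 (normr_ge0 (cRe x)) (normr_ge0 (cIm x)); lra.
Qed.

Lemma cabs_sum I (r : seq I) (P : pred I) (F : I -> C) :
  cabs (\sum_(i <- r | P i) F i) <= \sum_(i <- r | P i) cabs (F i).
Proof.
elim/big_rec2: _ => [|i a b _ h]; first by rewrite cabs0.
by apply: (le_trans (cabsD _ _)); rewrite lerD2l.
Qed.

Lemma mulC_conj x : (x^*)%C * x = (cabs x ^+ 2)%:C.
Proof.
by rewrite cabs_sqr; case: x => a b; apply: eqC; rewrite ?ReM ?ImM /=; ring.
Qed.

Lemma Im_inv x : cIm x^-1 = - cIm x / cabs x ^+ 2.
Proof. by rewrite cabs_sqr; case: x => a b /=; rewrite mulNr. Qed.

Lemma Re_inv x : cRe x^-1 = cRe x / cabs x ^+ 2.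
Proof. by rewrite cabs_sqr; case: x. Qed.

End ComplexBasics.

Section Euclidean.
Variable R : realType.
Local Notation C := R[i].

Local Notation nrm := (@l2norm R _).

Definition dot n (u v : 'cV[C]_n) : C := (u ^t* *m v) 0 0.

Lemma dotE n (u v : 'cV[C]_n) : dot u v = \sum_i ((u i 0)^*)%C * v i 0.
Proof. by rewrite /dot !mxE; apply: eq_bigr => i _; rewrite !mxE. Qed.

Lemma nrm_ge0 n (v : 'cV[C]_n) : 0 <= nrm v.
Proof. exact: sqrtr_ge0. Qed.

Lemma nrm_sqr n (v : 'cV[C]_n) : nrm v ^+ 2 = \sum_i cabs (v i 0) ^+ 2.
Proof. by rewrite sqr_sqrtr // sumr_ge0 // => i _; rewrite sqr_ge0. Qed.

Lemma dotvv n (v : 'cV[C]_n) : dot v v = (nrm v ^+ 2)%:C.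
Proof.
rewrite dotE nrm_sqr rmorph_sum /=; apply: eq_bigr => i _.
exact: mulC_conj.
Qed.

Lemma nrm_eq0 n (v : 'cV[C]_n) : nrm v = 0 -> v = 0.
Proof.
move=> h; have := nrm_sqr v; rewrite h expr0n /= => /esym/eqP.
rewrite psumr_eq0; last by move=> i _; rewrite sqr_ge0.
move/allP => h2; apply/matrixP => i j; rewrite ord1 mxE.
have /h2 : i \in index_enum _ by rewrite mem_index_enum.
by rewrite /= sqrf_eq0 => /eqP /cabs_eq0.
Qed.

Lemma nrm0 n : nrm (0 : 'cV[C]_n) = 0.
Proof.
rewrite /l2norm big1 ?sqrtr0 // => i _.
by rewrite mxE cabs0 expr0n.
Qed.

Lemma dotDr n (u v w : 'cV[C]_n) : dot u (v + w) = dot u v + dot u w.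
Proof. by rewrite /dot mulmxDr mxE. Qed.

Lemma dotNr n (u v : 'cV[C]_n) : dot u (- v) = - dot u v.
Proof. by rewrite /dot mulmxN mxE. Qed.

Lemma dotBr n (u v w : 'cV[C]_n) : dot u (v - w) = dot u v - dot u w.
Proof. by rewrite dotDr dotNr. Qed.

Lemma dotZr n a (u v : 'cV[C]_n) : dot u (a *: v) = a * dot u v.
Proof. by rewrite /dot -scalemxAr mxE. Qed.

Lemma dot0r n (u : 'cV[C]_n) : dot u 0 = 0.
Proof. by rewrite /dot mulmx0 mxE. Qed.

Lemma dot_sumr n (I : Type) (r : seq I) (P : pred I) (u : 'cV[C]_n) F :
  dot u (\sum_(i <- r | P i) F i) = \sum_(i <- r | P i) dot u (F i).
Proof.
apply: (big_morph (dot u)) => [x y|]; [exact: dotDr|exact: dot0r].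
Qed.

Lemma dot_conj n (u v : 'cV[C]_n) : ((dot u v)^*)%C = dot v u.
Proof.
rewrite !dotE rmorph_sum; apply: eq_bigr => i _.
by rewrite rmorphM /= conjcK mulrC.
Qed.

Lemma adjM m n p (A : 'M[C]_(m, n)) (B : 'M[C]_(n, p)) :
  (A *m B) ^t* = B ^t* *m A ^t*.
Proof. by rewrite trmx_mul map_mxM. Qed.

Lemma adjK m n (A : 'M[C]_(m, n)) : (A ^t*) ^t* = A.
Proof. exact: trmxCK. Qed.

Lemma dot_adj m n (M : 'M[C]_(m, n)) u v : dot u (M *m v) = dot (M ^t* *m u) v.
Proof. by rewrite /dot adjM adjK mulmxA. Qed.

Lemma dot_CS n (u v : 'cV[C]_n) : cabs (dot u v) <= nrm u * nrm v.
Proof.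
have [u0|u0] := eqVneq (nrm u) 0.
  have -> : dot u v = ((dot v u)^*)%C by rewrite dot_conj.
  by rewrite (nrm_eq0 u0) dot0r conjc0 cabs0 nrm0 mul0r.
have [v0|v0] := eqVneq (nrm v) 0.
  by rewrite (nrm_eq0 v0) dot0r cabs0 nrm0 mulr0.
have up : 0 < nrm u by rewrite lt_def u0 nrm_ge0.
have vp : 0 < nrm v by rewrite lt_def v0 nrm_ge0.
rewrite dotE; apply: (le_trans (cabs_sum _ _ _)).
have h : \sum_i cabs (((u i 0)^*)%C * v i 0) <=
   \sum_i (nrm v / nrm u / 2 * cabs (u i 0) ^+ 2
           + nrm u / nrm v / 2 * cabs (v i 0) ^+ 2).
  apply: ler_sum => i _; rewrite cabsM cabs_conj.
  set a := cabs (u i 0); set b := cabs (v i 0).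
  rewrite -subr_ge0.
  have -> : nrm v / nrm u / 2 * a ^+ 2 + nrm u / nrm v / 2 * b ^+ 2 - a * b
     = (nrm v * a - nrm u * b) ^+ 2 / (2 * nrm u * nrm v).
    by field; rewrite u0 v0.
  by rewrite divr_ge0 ?sqr_ge0 // !mulr_ge0 // ltW.
apply: (le_trans h).
rewrite big_split /= -!mulr_sumr -!nrm_sqr.
suff -> : nrm v / nrm u / 2 * nrm u ^+ 2 + nrm u / nrm v / 2 * nrm v ^+ 2 =
  nrm u * nrm v by [].
by field; rewrite u0 v0.
Qed.

Lemma nrmZ n a (v : 'cV[C]_n) : nrm (a *: v) = cabs a * nrm v.
Proof.
apply/eqP; rewrite -(eqrXn2 (n := 2)) ?mulr_ge0 ?nrm_ge0 ?cabs_ge0 //.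
rewrite exprMn !nrm_sqr mulr_sumr; apply/eqP/eq_bigr => i _.
by rewrite !mxE cabsM exprMn.
Qed.

(** ** Operator bounds *)

(** An upper bound for the operator norm; a relation composes more easily than
   the norm itself, which is a supremum. *)
Definition opb m n (c : R) (M : 'M[C]_(m, n)) :=
  forall v, nrm (M *m v) <= c * nrm v.

Lemma opbM m n p c d (M : 'M[C]_(m, n)) (N : 'M[C]_(n, p)) :
  0 <= c -> opb c M -> opb d N -> opb (c * d) (M *m N).
Proof.
move=> c0 hM hN v; rewrite -mulmxA; apply: (le_trans (hM _)).
by rewrite -mulrA ler_wpM2l.
Qed.

Lemma opb1 n : opb 1 (1%:M : 'M[C]_n).
Proof. by move=> v; rewrite mul1mx mul1r. Qed.

(** Duality: |M^* w|^2 is the inner product of w with M (M^* w). *)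
Lemma opb_adj m n c (M : 'M[C]_(m, n)) : 0 <= c -> opb c M -> opb c (M ^t*).
Proof.
move=> c0 hM w; have [w0|w0] := eqVneq (nrm (M ^t* *m w)) 0.
  by rewrite w0 mulr_ge0 ?nrm_ge0.
have wp : 0 < nrm (M ^t* *m w) by rewrite lt_def w0 nrm_ge0.
rewrite -(ler_pM2r wp) -mulrA -expr2.
have -> : nrm (M ^t* *m w) ^+ 2 = cabs (dot w (M *m (M ^t* *m w))).
  by rewrite dot_adj dotvv cabsR ger0_norm // sqr_ge0.
apply: (le_trans (dot_CS _ _)); rewrite mulrCA.
by rewrite ler_wpM2l ?nrm_ge0.
Qed.

Lemma opb_exists m n (M : 'M[C]_(m, n)) : exists2 c, 0 <= c & opb c M.
Proof.
exists (Num.sqrt (\sum_i nrm ((row i M) ^t*) ^+ 2)); first exact: sqrtr_ge0.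
move=> v; have s0 : 0 <= \sum_i nrm ((row i M) ^t*) ^+ 2.
  by apply: sumr_ge0 => i _; exact: sqr_ge0.
rewrite -(ler_pXn2r (n := 2)) ?nnegrE ?mulr_ge0 ?nrm_ge0 ?sqrtr_ge0 //.
rewrite exprMn (sqr_sqrtr s0) nrm_sqr mulr_suml; apply: ler_sum => i _.
rewrite -exprMn; apply: lerXn2r; rewrite ?nnegrE ?mulr_ge0 ?nrm_ge0 ?cabs_ge0 //.
have -> : (M *m v) i 0 = dot ((row i M) ^t*) v; last exact: dot_CS.
by rewrite /dot adjK -row_mul [RHS]mxE.
Qed.

Lemma dot_opb m n c (M : 'M[C]_(m, n)) u v : opb c M ->
  cabs (dot u (M *m v)) <= c * nrm u * nrm v.
Proof.
move=> hM; apply: (le_trans (dot_CS _ _)).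
by rewrite (mulrC c) -mulrA ler_wpM2l ?nrm_ge0.
Qed.

Lemma mxtrace_gram p m (M : 'M[C]_p) (B : 'M[C]_(p, m)) :
  \tr (M *m (B *m B ^t*)) = \sum_j dot (col j B) (M *m col j B).
Proof.
rewrite mulmxA mxtrace_mulC; apply: eq_bigr => j _.
rewrite dotE mxE; apply: eq_bigr => i _; rewrite !mxE; congr (_ * _).
by apply: eq_bigr => l _; rewrite !mxE.
Qed.

(** The trace of a Gram matrix, as a real number. *)
Definition gram_tr p m (B : 'M[C]_(p, m)) : R := \sum_j nrm (col j B) ^+ 2.

Lemma gram_tr_ge0 p m (B : 'M[C]_(p, m)) : 0 <= gram_tr B.
Proof. by apply: sumr_ge0 => j _; rewrite sqr_ge0. Qed.

Lemma mxtrace_gram_le p m c (M : 'M[C]_p) (B : 'M[C]_(p, m)) : opb c M ->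
  cabs (\tr (M *m (B *m B ^t*))) <= c * gram_tr B.
Proof.
move=> hM; rewrite mxtrace_gram; apply: (le_trans (cabs_sum _ _ _)).
rewrite /gram_tr mulr_sumr; apply: ler_sum => j _.
by apply: (le_trans (dot_opb _ _ hM)); rewrite expr2 mulrA.
Qed.

(** Positive lower bound on the negative imaginary part of the numerical range:
   the property that makes resolvents exist and be bounded. *)
Definition coercive n (a : R) (D : 'M[C]_n) :=
  forall u, a * nrm u ^+ 2 <= - cIm (dot u (D *m u)).

Lemma coercive_unit n a (D : 'M[C]_n) : 0 < a -> coercive a D -> D \in unitmx.
Proof.
move=> a0 hD; rewrite unitmxE unitfE; apply/negP => d0.
have /det0P[w w0 wD] : \det D^T == 0 by rewrite det_tr.
have DW : D *m w^T = 0 by rewrite -[D]trmxK -trmx_mul wD trmx0.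
have := hD w^T; rewrite DW dot0r /= oppr0 pmulr_rle0 // => h.
have /nrm_eq0 h2 : nrm w^T = 0.
  by apply/eqP; rewrite -sqrf_eq0 eq_le h sqr_ge0.
by move/eqP: w0; apply; rewrite -[w]trmxK h2 trmx0.
Qed.

(** With u the image of w under the inverse, a |u|^2 is at most |(u, w)|. *)
Lemma coercive_opb n a (D : 'M[C]_n) : 0 < a -> coercive a D ->
  opb a^-1 (invmx D).
Proof.
move=> a0 hD w; have uD := coercive_unit a0 hD.
set u := invmx D *m w; have Du : D *m u = w by rewrite mulKVmx.
rewrite ler_pdivlMl //; have [u0|u0] := eqVneq (nrm u) 0.
  by rewrite u0 mulr0 nrm_ge0.
have up : 0 < nrm u by rewrite lt_def u0 nrm_ge0.
rewrite -(ler_pM2r up) -mulrA -expr2; apply: (le_trans (hD u)).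
rewrite Du -ImN -dotNr; apply: (le_trans (ler_norm _)).
apply: (le_trans (Im_le_cabs _)); apply: (le_trans (dot_CS _ _)).
by rewrite -scaleN1r nrmZ cabsN cabs1 mul1r mulrC.
Qed.

Lemma dot_gram p m (B : 'M[C]_(p, m)) u :
  dot u (B *m B ^t* *m u) = (nrm (B ^t* *m u) ^+ 2)%:C.
Proof. by rewrite -mulmxA dot_adj dotvv. Qed.

(** A Gram matrix bounded by K, that is, a factor bounded by the square root of
   K. *)
Definition gramb p m (K : R) (B : 'M[C]_(p, m)) :=
  forall u, nrm (B ^t* *m u) ^+ 2 <= K * nrm u ^+ 2.

Lemma gramb_opb p m K (B : 'M[C]_(p, m)) : 0 <= K -> gramb K B ->
  opb K (B *m B ^t*).
Proof.
move=> K0 hB; have hB' : opb (Num.sqrt K) (B ^t*).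
  move=> u; rewrite -(ler_pXn2r (n := 2)) ?nnegrE ?mulr_ge0 ?nrm_ge0 ?sqrtr_ge0 //.
  by rewrite exprMn (sqr_sqrtr K0); exact: hB.
have := opbM (sqrtr_ge0 K) (opb_adj (sqrtr_ge0 K) hB') hB'.
by rewrite adjK -expr2 sqr_sqrtr.
Qed.

Lemma gram_tr_le p m K (B : 'M[C]_(p, m)) : gramb K B -> gram_tr B <= K * p%:R.
Proof.
move=> hB.
have -> : gram_tr B = \sum_(i < p) nrm (B ^t* *m delta_mx i 0) ^+ 2.
  rewrite /gram_tr; under eq_bigr => j _ do rewrite nrm_sqr.
  rewrite exchange_big; apply: eq_bigr => i _; rewrite nrm_sqr.
  by apply: eq_bigr => j _; rewrite -colE !mxE cabs_conj.
apply: (@le_trans _ _ (\sum_(i < p) K)); last first.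
  by rewrite sumr_const card_ord mulr_natr.
apply: ler_sum => i _; apply: (le_trans (hB _)).
rewrite nrm_sqr (bigD1 i) //= big1 => [|j ji].
  by rewrite !mxE !eqxx cabs1 addr0 expr1n mulr1.
by rewrite !mxE (negbTE ji) cabs0 expr0n.
Qed.

End Euclidean.

(** * Resolvents *)

Section Resolvents.
Variable R : realType.
Local Notation C := R[i].
Local Notation nrm := (@l2norm R _).

(** The values at z of Stieltjes transforms of measures on [0, +oo[ have both
   properties; together they keep 1 + e away from 0. *)
Definition good (z e : C) := 0 <= cIm e /\ 0 <= cIm (z * e).

Lemma good0 z : good z 0.
Proof. by split; rewrite ?mulr0. Qed.

Lemma goodD z e f : good z e -> good z f -> good z (e + f).
Proof. by move=> [a b] [c d]; split; rewrite ?mulrDr ImD addr_ge0. Qed.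

Lemma goodZ z (a : R) e : 0 <= a -> good z e -> good z (a%:C * e).
Proof.
by move=> a0 [h k]; split; rewrite ?(mulrCA z) ImZ mulr_ge0.
Qed.

Lemma good_sum z (I : Type) (r : seq I) (P : pred I) F :
  (forall i, P i -> good z (F i)) -> good z (\sum_(i <- r | P i) F i).
Proof.
move=> h; elim/big_rec: _ => [|i x Pi gx]; first exact: good0.
by apply: goodD => //; exact: h.
Qed.

(** Im z = Im (z (1 + e)) - Im (z e) is at most Im (z (1 + e)). *)
Lemma good_lb z e : 0 < cIm z -> good z e -> cIm z <= cabs z * cabs (1 + e).
Proof.
move=> z0 [_ ze]; rewrite -cabsM; apply: le_trans (Im_le_cabs _).
by apply: le_trans (ler_norm _); rewrite mulrDr mulr1 ImD lerDl.
Qed.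

Lemma good_neq0 z e : 0 < cIm z -> good z e -> 1 + e != 0.
Proof.
move=> z0 ge; apply/eqP => h; have := good_lb z0 ge.
by rewrite h cabs0 mulr0 leNgt z0.
Qed.

Lemma good_inv z e : 0 < cIm z -> good z e ->
  cabs (1 + e)^-1 <= cabs z / cIm z.
Proof.
move=> z0 ge; have ep := cabs_gt0 (good_neq0 z0 ge).
by rewrite cabsV ler_pdivlMr // ler_pdivrMl // mulrC; exact: good_lb.
Qed.

(** Coercivity makes the inverse exist with operator norm at most 1 / Im z; the
   second property makes its quadratic forms good. *)
Definition resolvent_like n z (D : 'M[C]_n) :=
  coercive (cIm z) D /\ forall u, cIm ((z^*)%C * dot u (D *m u)) <= 0.

Lemma dot_inv n (D : 'M[C]_n) b : D \in unitmx ->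
  let u := invmx D *m b in dot b (invmx D *m b) = ((dot u (D *m u))^*)%C.
Proof. by move=> uD /=; rewrite dot_conj mulKVmx. Qed.

Lemma dot_inv_adj n (D : 'M[C]_n) b : D \in unitmx ->
  let u := (invmx D) ^t* *m b in
  dot b (invmx D *m b) = ((dot u (D *m u))^*)%C.
Proof.
move=> uD; set u := _ *m b => /=.
have Du : D ^t* *m u = b.
  by rewrite /u mulmxA -adjM mulVmx // trmx1 map_mx1 mul1mx.
by rewrite [LHS]dot_adj -/u [dot u (D *m u)]dot_adj Du dot_conj.
Qed.

(** The form of the inverse of D at b is the conjugate of the form of D at the
   image of b. *)
Lemma good_dot n z (D : 'M[C]_n) b : 0 < cIm z -> resolvent_like z D ->
  good z (dot b (invmx D *m b)).
Proof.
move=> z0 [cD hD]; have uD := coercive_unit z0 cD.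
rewrite dot_inv //; set u := invmx D *m b; split.
  rewrite Im_conj; apply: le_trans (cD u).
  by rewrite mulr_ge0 ?sqr_ge0 // ltW.
by rewrite -[z]conjcK -rmorphM Im_conj oppr_ge0 /=; exact: hD.
Qed.

Lemma Im_dot_inv n a (D : 'M[C]_n) b : 0 < a -> coercive a D ->
  a * nrm (invmx D *m b) ^+ 2 <= cIm (dot b (invmx D *m b)).
Proof.
move=> a0 cD; rewrite dot_inv ?(coercive_unit a0) // Im_conj.
exact: cD.
Qed.

Lemma Im_dot_inv_adj n a (D : 'M[C]_n) b : 0 < a -> coercive a D ->
  a * nrm ((invmx D) ^t* *m b) ^+ 2 <= cIm (dot b (invmx D *m b)).
Proof.
move=> a0 cD; rewrite dot_inv_adj ?(coercive_unit a0) // Im_conj.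
exact: cD.
Qed.

Lemma good_gram n m z (D : 'M[C]_n) (B : 'M[C]_(n, m)) : 0 < cIm z ->
  resolvent_like z D -> good z (\tr (B *m B ^t* *m invmx D)).
Proof.
move=> z0 hD; rewrite mxtrace_mulC mxtrace_gram; apply: good_sum => j _.
exact: good_dot.
Qed.

Lemma nonneg_dot n (A : 'M[C]_n) u : nonneg_def A ->
  0 <= cRe (dot u (A *m u)) /\ cIm (dot u (A *m u)) = 0.
Proof.
move=> hA; have := hA u; rewrite -mulmxA -/(dot u (A *m u)) lecE /=.
by case/andP => /eqP -> ->.
Qed.

Lemma nonneg_defP n (A : 'M[C]_n) :
  (forall u, 0 <= dot u (A *m u)) -> nonneg_def A.
Proof. by move=> h u; rewrite -mulmxA; exact: h. Qed.

Lemma nonneg_defD n (A B : 'M[C]_n) :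
  nonneg_def A -> nonneg_def B -> nonneg_def (A + B).
Proof.
by move=> hA hB v; rewrite mulmxDr mulmxDl mxE addr_ge0 // ?hA ?hB.
Qed.

Lemma nonneg_gram n m (B : 'M[C]_(n, m)) : nonneg_def (B *m B ^t*).
Proof. by apply: nonneg_defP => u; rewrite dot_gram ler0c sqr_ge0. Qed.

Lemma nonneg_defZ n (a : R) (A : 'M[C]_n) : 0 <= a -> nonneg_def A ->
  nonneg_def (a%:C *: A).
Proof.
move=> a0 hA v; by rewrite -scalemxAr -scalemxAl mxE mulr_ge0 ?ler0c.
Qed.

Lemma scalar_mxM n (z : C) (u : 'cV[C]_n) : z%:M *m u = z *: u.
Proof. exact: mul_scalar_mx. Qed.

Lemma resolvent_like_pencil n z (H : 'M[C]_n) : 0 < cIm z -> nonneg_def H ->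
  resolvent_like z (H - z%:M).
Proof.
move=> z0 hH.
have E u : dot u ((H - z%:M) *m u) = dot u (H *m u) - z * (nrm u ^+ 2)%:C.
  by rewrite mulmxBl scalar_mxM dotBr dotZr dotvv.
split=> u; rewrite E; have [h1 h2] := nonneg_dot u hH.
  by rewrite ImB h2 sub0r opprK [z * _]mulrC ImZ mulrC.
rewrite mulrBr ImB mulrA mulC_conj -rmorphM /= subr0 ImM h2 mulr0 add0r Im_conj.
by rewrite mulNr oppr_le0 mulr_ge0 // ltW.
Qed.

(** ** Rank-one perturbations *)

Lemma invmxB n (X Y : 'M[C]_n) : X \in unitmx -> Y \in unitmx ->
  invmx X - invmx Y = invmx X *m (Y - X) *m invmx Y.
Proof.
by move=> uX uY; rewrite mulmxBr mulVmx // mulmxBl mul1mx mulmxK.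
Qed.

(** The formulas of Sherman and Morrison. *)
Section ShermanMorrison.
Variables (n : nat) (X Y : 'M[C]_n) (t : C) (y : 'cV[C]_n).
Hypotheses (uX : X \in unitmx) (uY : Y \in unitmx).
Hypothesis YE : Y = X + t *: (y *m y ^t*).

Let b := t * dot y (invmx X *m y).
Hypothesis b0 : 1 + b != 0.

Lemma invmx_rank1_mulr : invmx Y *m y = (1 + b)^-1 *: (invmx X *m y).
Proof.
have E : Y *m (invmx X *m y) = (1 + b) *: y.
  rewrite YE mulmxDl mulKVmx // -scalemxAl -mulmxA.
  rewrite [y ^t* *m _]mx11_scalar -/(dot y (invmx X *m y)) mul_mx_scalar.
  by rewrite scalerA scalerDl scale1r.
apply: (canRL (scalerK b0)).
by rewrite scalemxAr -E mulKmx.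
Qed.

Lemma invmx_rank1_mull : y ^t* *m invmx Y = (1 + b)^-1 *: (y ^t* *m invmx X).
Proof.
have E : (y ^t* *m invmx X) *m Y = (1 + b) *: y ^t*.
  rewrite YE mulmxDr mulmxKV // -scalemxAr [y ^t* *m invmx X *m _]mulmxA.
  rewrite -[y ^t* *m invmx X *m y]mulmxA [y ^t* *m (_ *m y)]mx11_scalar.
  rewrite -/(dot y (invmx X *m y)) mul_scalar_mx.
  by rewrite scalerA scalerDl scale1r.
apply: (canRL (scalerK b0)).
by rewrite scalemxAl -E mulmxK.
Qed.

Lemma invmx_rank1_trace (Q : 'M[C]_n) :
  \tr (Q *m invmx Y) - \tr (Q *m invmx X) =
  - (t * dot y (invmx X *m Q *m invmx X *m y) / (1 + b)).
Proof.
have E : invmx Y - invmx X = - (t *: (invmx Y *m (y *m y ^t*) *m invmx X)).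
  rewrite invmxB // -opprB mulmxN mulNmx; congr (- _).
  by rewrite {2}YE addrAC subrr add0r -scalemxAr -scalemxAl.
rewrite -raddfB /= -mulmxBr E mulmxN raddfN /=; congr (- _).
rewrite -scalemxAr linearZ /= -[RHS]mulrA; congr (_ * _).
rewrite [invmx Y *m _]mulmxA invmx_rank1_mulr -!scalemxAl -scalemxAr linearZ /= mulrC.
congr (_ * _); rewrite mulmxA mxtrace_mulC !mulmxA /dot -[RHS]trace_mx11.
by rewrite !mulmxA [LHS]mxtrace_mulC !mulmxA.
Qed.

End ShermanMorrison.

Lemma mul_le_of_sqr (v a c i : R) : 0 < v ->
  v * a ^+ 2 <= i -> v * c ^+ 2 <= i -> a * (c * v) <= i.
Proof.
move=> v0 h1 h2; have := mulr_ge0 (ltW v0) (sqr_ge0 (a - c)).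
by rewrite sqrrB mulrDr mulrBr; lra.
Qed.

Section RankOne.
Variables (n : nat) (H : 'M[C]_n) (t : R) (y : 'cV[C]_n) (z : C).
Hypotheses (hH : nonneg_def H) (t0 : 0 <= t) (z0 : 0 < cIm z).

Let H1 := H + t%:C *: (y *m y ^t*).
Let S0 := H - z%:M.
Let S1 := H1 - z%:M.
Let b := t%:C * dot y (invmx S0 *m y).

Let hH1 : nonneg_def H1.
Proof. exact: nonneg_defD hH (nonneg_defZ t0 (nonneg_gram y)). Qed.

Let rl0 : resolvent_like z S0 := resolvent_like_pencil z0 hH.
Let rl1 : resolvent_like z S1 := resolvent_like_pencil z0 hH1.
Let u0 : S0 \in unitmx := coercive_unit z0 rl0.1.
Let u1 : S1 \in unitmx := coercive_unit z0 rl1.1.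

Lemma rank1_good : good z b.
Proof. exact: goodZ t0 (good_dot y z0 rl0). Qed.

Let b0 : 1 + b != 0 := good_neq0 z0 rank1_good.

Let S1E : S1 = S0 + t%:C *: (y *m y ^t*).
Proof. by rewrite /S1 /S0 /H1 addrAC. Qed.

Lemma rank1_mull : y ^t* *m invmx S1 = (1 + b)^-1 *: (y ^t* *m invmx S0).
Proof. exact: invmx_rank1_mull u0 u1 S1E b0. Qed.

Lemma rank1_trace (Q : 'M[C]_n) :
  \tr (Q *m invmx S1) - \tr (Q *m invmx S0) =
  - (t%:C * dot y (invmx S0 *m Q *m invmx S0 *m y) / (1 + b)).
Proof. exact: invmx_rank1_trace u0 u1 S1E b0 Q. Qed.

(** The bound does not depend on y: writing S for H - z, the numerator is at most
   q |S^-1 y| |S^-* y|, where both norms have square at most Im (y^* S^-1 y) / Im z,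
   and this imaginary part is controlled by the denominator. *)
Lemma rank1_trace_le (Q : 'M[C]_n) (q : R) : 0 <= q -> opb q Q ->
  cabs (\tr (Q *m invmx S1) - \tr (Q *m invmx S0)) <= q / cIm z.
Proof.
move=> q0 hQ; rewrite rank1_trace cabsN !cabsM cabsV cabsR ger0_norm //.
have bp := cabs_gt0 b0.
rewrite ler_pdivrMr // mulrAC ler_pdivlMr //.
have h1 : cIm z * nrm (invmx S0 *m y) ^+ 2 <= cIm (dot y (invmx S0 *m y)).
  exact: Im_dot_inv rl0.1.
have h2 : cIm z * nrm ((invmx S0) ^t* *m y) ^+ 2 <= cIm (dot y (invmx S0 *m y)).
  exact: Im_dot_inv_adj rl0.1.
have h3 : cabs (dot y (invmx S0 *m Q *m invmx S0 *m y)) <=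
    q * nrm ((invmx S0) ^t* *m y) * nrm (invmx S0 *m y).
  by rewrite -2!mulmxA dot_adj; exact: dot_opb.
have h4 : t * cIm (dot y (invmx S0 *m y)) <= cabs (1 + b).
  rewrite -ImZ -/b; apply: le_trans (Im_le_cabs _).
  by apply: le_trans (ler_norm _); rewrite ImD /= add0r.
apply: (@le_trans _ _ (q * (t * cIm (dot y (invmx S0 *m y))))); last first.
  by rewrite ler_wpM2l.
rewrite -mulrA [q * _]mulrCA; apply: ler_wpM2l => //.
apply: (@le_trans _ _ (q * nrm ((invmx S0) ^t* *m y) * nrm (invmx S0 *m y) * cIm z)).
  by rewrite ler_wpM2r // ltW.
rewrite -!mulrA; apply: ler_wpM2l => //.
set a := nrm _ in h2 *; set c := nrm _ in h1 *.
exact: mul_le_of_sqr h2 h1.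
Qed.

End RankOne.

(** * The deterministic system at a fixed point of the upper half-plane *)

Section DetSystem.
Variables (n p : nat) (m : 'I_n -> nat) (B : forall k, 'M[C]_(p, m k)).
Variables (A : 'M[C]_p) (z : C).
Hypotheses (hA : nonneg_def A) (z0 : 0 < cIm z).

Definition det_mx (e : 'I_n -> C) : 'M[C]_p :=
  n%:R^-1 *: (\sum_(j < n) (1 + e j)^-1 *: (B j *m (B j) ^t*)) + A - z%:M.

Definition det_map (Q : 'M[C]_p) (e : 'I_n -> C) : C :=
  n%:R^-1 * \tr (Q *m invmx (det_mx e)).

(** Inversion of 1 + e reverses the signs of both imaginary parts in the
   definition of good, so that each summand pushes in the same direction as
   - z. *)
Lemma det_mx_resolvent_like e : (forall k, good z (e k)) ->
  resolvent_like z (det_mx e).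
Proof.
move=> ge.
have E u : dot u (det_mx e *m u) =
    \sum_j ((n%:R^-1 * nrm ((B j) ^t* *m u) ^+ 2)%:C * (1 + e j)^-1)
    + dot u ((A - z%:M) *m u).
  rewrite /det_mx -addrA mulmxDl dotDr; congr (_ + _).
  rewrite -scalemxAl dotZr mulmx_suml dot_sumr mulr_sumr.
  apply: eq_bigr => j _; rewrite -scalemxAl dotZr dot_gram natVC.
  by rewrite [X in X / _]rmorphM -mulrA; congr (_ * _); rewrite mulrC.
have cj u j : 0 <= n%:R^-1 * nrm ((B j) ^t* *m u) ^+ 2.
  by rewrite mulr_ge0 ?invr_ge0 ?ler0n ?sqr_ge0.
have [r1 r2] := resolvent_like_pencil z0 hA.
split=> u; rewrite E.
  rewrite ImD opprD; apply: (le_trans (r1 u)); rewrite lerDr Im_sum oppr_ge0.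
  apply: sumr_le0 => j _; rewrite ImZ mulr_ge0_le0 ?cj // Im_inv ImD /= add0r.
  by rewrite mulNr oppr_le0 divr_ge0 ?sqr_ge0 // (ge j).1.
rewrite mulrDr ImD -[leRHS]addr0; apply: lerD (r2 u).
rewrite mulr_sumr Im_sum; apply: sumr_le0 => j _.
rewrite mulrCA ImZ mulr_ge0_le0 ?cj //.
rewrite ImM Im_inv Re_inv Re_conj Im_conj.
have [g1 g2] := ge j.
have -> : cRe z * (- cIm (1 + e j) / cabs (1 + e j) ^+ 2) +
   - cIm z * (cRe (1 + e j) / cabs (1 + e j) ^+ 2)
   = - (cIm (z * (1 + e j)) / cabs (1 + e j) ^+ 2) by rewrite ImM; ring.
rewrite oppr_le0 divr_ge0 ?sqr_ge0 // mulrDr mulr1 ImD addr_ge0 //.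
exact: ltW.
Qed.

Lemma det_mx_unit e : (forall k, good z (e k)) -> det_mx e \in unitmx.
Proof. by move=> /det_mx_resolvent_like[h _]; exact: coercive_unit h. Qed.

(** The factor in front of the mean of the differences tends to 0 as Im z grows
   with Re z fixed: far from the real axis the system is a contraction. *)
Lemma det_map_lip Q q K e f : 0 <= q -> opb q Q -> (forall k, gramb K (B k)) ->
  (forall k, good z (e k)) -> (forall k, good z (f k)) ->
  cabs (det_map Q e - det_map Q f) <=
  (cabs z / cIm z) ^+ 2 * q * K * (p%:R / n%:R) / cIm z ^+ 2 *
  (n%:R^-1 * \sum_(j < n) cabs (e j - f j)).
Proof.
move=> q0 hQ hB ge gf.
set L := cabs z / cIm z; set v := cIm z.
have re := det_mx_resolvent_like ge; have rf := det_mx_resolvent_like gf.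
have ue := det_mx_unit ge; have uf := det_mx_unit gf.
have E1 := invmxB ue uf.
have E2 : det_mx f - det_mx e = n%:R^-1 *: \sum_(j < n)
    ((e j - f j) * ((1 + e j)^-1 * (1 + f j)^-1)) *: (B j *m (B j) ^t*).
  rewrite /det_mx -[X in X - _]addrA -[X in _ - X]addrA opprD addrACA subrr addr0 -scalerBr -sumrB.
  congr (_ *: _); apply: eq_bigr => j _; rewrite -scalerBl; congr (_ *: _).
  have := good_neq0 z0 (ge j); have := good_neq0 z0 (gf j) => h1 h2.
  by field; rewrite h1 h2.
rewrite /det_map -mulrBr -raddfB /= -mulmxBr E1 E2 natVC cabsM cabsR.
rewrite ger0_norm ?invr_ge0 //.
set a := n%:R^-1; have a0 : 0 <= a :> R by rewrite invr_ge0.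
have -> : L ^+ 2 * q * K * (p%:R / n%:R) / v ^+ 2 *
    (a * \sum_(j < n) cabs (e j - f j)) =
  a * \sum_(j < n) a * (L ^+ 2 * q * K * p%:R / v ^+ 2 * cabs (e j - f j)).
  by rewrite -!mulr_sumr -/a; ring.
apply: ler_wpM2l => //; rewrite -scalemxAr -scalemxAl -scalemxAr.
rewrite mulmx_sumr mulmx_suml mulmx_sumr.
rewrite mxtraceZ raddf_sum mulr_sumr /=.
apply: (le_trans (cabs_sum _ _ _)); apply: ler_sum => j _.
rewrite -scalemxAr -scalemxAl -scalemxAr mxtraceZ cabsM cabsR ger0_norm //.
apply: ler_wpM2l => //; rewrite !cabsM.
have h1 := good_inv z0 (ge j); have h2 := good_inv z0 (gf j).
have h3 : cabs (\tr (Q *m (invmx (det_mx e) *m (B j *m (B j) ^t*) *m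
   invmx (det_mx f)))) <= v^-1 * (q * v^-1) * (K * p%:R).
  have -> : \tr (Q *m (invmx (det_mx e) *m (B j *m (B j) ^t*) *m
      invmx (det_mx f))) = \tr ((invmx (det_mx f) *m (Q *m invmx (det_mx e))) *m
      (B j *m (B j) ^t*)).
    by rewrite !mulmxA [LHS]mxtrace_mulC !mulmxA.
  apply: (@le_trans _ _ (v^-1 * (q * v^-1) * gram_tr (B j))).
    apply: mxtrace_gram_le; apply: opbM; first by rewrite invr_ge0 ltW.
      exact: coercive_opb rf.1.
    by apply: opbM => //; exact: coercive_opb re.1.
  apply: ler_wpM2l; last exact: gram_tr_le.
  by rewrite !mulr_ge0 // invr_ge0 ltW.
have L0 : 0 <= L by rewrite divr_ge0 ?cabs_ge0 // ltW.
have -> : L ^+ 2 * q * K * p%:R / v ^+ 2 * cabs (e j - f j) =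
  cabs (e j - f j) * (L * L) * (v^-1 * (q * v^-1) * (K * p%:R)).
  by rewrite /v; field; rewrite gt_eqF.
apply: ler_pM; rewrite ?mulr_ge0 ?cabs_ge0 //.
by apply: ler_wpM2l; rewrite ?cabs_ge0 // ler_pM ?cabs_ge0.
Qed.

End DetSystem.

End Resolvents.

(** * Complex-valued measurable functions and their integrals *)

Section ComplexMeasurable.
Context d (T : measurableType d) (R : realType).
Local Notation C := R[i].
Implicit Types f g : T -> C.

(** The Borel structure of the complex numbers is described by coordinates. *)
Definition cmeas f :=
  measurable_fun setT (fun t => cRe (f t)) /\
  measurable_fun setT (fun t => cIm (f t)).

Lemma cmeas_cst (c : C) : cmeas (fun=> c).
Proof. by split; exact: measurable_cst. Qed.

Lemma cmeas_real (f : T -> R) : measurable_fun setT f -> cmeas (fun t => (f t)%:C).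
Proof. by move=> mf; split => //=; exact: measurable_cst. Qed.

Lemma eq_cmeas f g : (forall t, f t = g t) -> cmeas f -> cmeas g.
Proof. by move=> /funext ->. Qed.

Lemma cmeasD f g : cmeas f -> cmeas g -> cmeas (fun t => f t + g t).
Proof.
move=> [f1 f2] [g1 g2]; split.
  by under eq_fun do rewrite ReD; exact: measurable_funD.
by under eq_fun do rewrite ImD; exact: measurable_funD.
Qed.

Lemma cmeasM f g : cmeas f -> cmeas g -> cmeas (fun t => f t * g t).
Proof.
move=> [f1 f2] [g1 g2]; split.
  under eq_fun do rewrite ReM.
  by apply: measurable_funB; exact: measurable_funM.
under eq_fun do rewrite ImM.
by apply: measurable_funD; exact: measurable_funM.
Qed.

Lemma cmeasN f : cmeas f -> cmeas (fun t => - f t).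
Proof.
move=> hf; apply: (@eq_cmeas (fun t => (-1) * f t)).
  by move=> t; rewrite mulN1r.
by apply: cmeasM => //; exact: cmeas_cst.
Qed.

Lemma cmeasB f g : cmeas f -> cmeas g -> cmeas (fun t => f t - g t).
Proof. by move=> hf hg; apply: cmeasD => //; exact: cmeasN. Qed.

Lemma cmeas_conj f : cmeas f -> cmeas (fun t => ((f t)^*)%C).
Proof.
move=> [f1 f2]; split; first by under eq_fun do rewrite Re_conj.
under eq_fun do rewrite Im_conj.
exact: measurableT_comp.
Qed.

Lemma measurable_cabs2 f : cmeas f -> measurable_fun setT (fun t => cabs (f t) ^+ 2).
Proof.
move=> [f1 f2]; under eq_fun do rewrite cabs_sqr.
by apply: measurable_funD; exact: measurable_funX.
Qed.

Lemma measurable_cabs f : cmeas f -> measurable_fun setT (fun t => cabs (f t)).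
Proof.
move=> [f1 f2].
have -> : (fun t => cabs (f t)) = (fun t => Num.sqrt (cRe (f t) ^+ 2 + cIm (f t) ^+ 2)).
  by apply/funext => t; case: (f t).
have ms : measurable_fun [set: R] (Num.sqrt : R -> R).
  by apply: nondecreasing_measurable => //; exact: ler_wsqrtr.
apply: (measurableT_comp ms (g := fun t => cRe (f t) ^+ 2 + cIm (f t) ^+ 2)).
by apply: measurable_funD; exact: measurable_funX.
Qed.

Lemma cmeasV f : cmeas f -> cmeas (fun t => (f t)^-1).
Proof.
move=> hf; have m2 := measurable_cabs2 hf.
have mV : measurable_fun setT (fun t => (cabs (f t) ^+ 2)^-1).
  under eq_fun do rewrite -powR_inv1 ?sqr_ge0 //.
  exact: (measurableT_comp (measurable_powR (-1)) (g := fun t => cabs (f t) ^+ 2)).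
case: hf => [f1 f2]; split.
  by under eq_fun do rewrite Re_inv; exact: measurable_funM.
under eq_fun do rewrite Im_inv.
by apply: measurable_funM => //; exact: measurableT_comp.
Qed.

Lemma cmeasX f n : cmeas f -> cmeas (fun t => f t ^+ n).
Proof.
move=> hf; elim: n => [|n IH]; first exact: cmeas_cst.
by apply: (@eq_cmeas (fun t => f t * f t ^+ n));
  [move=> t; rewrite exprS|exact: cmeasM].
Qed.

Lemma cmeas_sum (I : Type) (r : seq I) (P : pred I) (F : I -> T -> C) :
  (forall i, P i -> cmeas (F i)) -> cmeas (fun t => \sum_(i <- r | P i) F i t).
Proof.
move=> h; elim: r => [|i r IH].
  by apply: (@eq_cmeas (fun=> 0)); [move=> t; rewrite big_nil|exact: cmeas_cst].
case Pi : (P i); last first.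
  by apply: eq_cmeas IH => t; rewrite big_cons Pi.
apply: (@eq_cmeas (fun t => F i t + \sum_(i <- r | P i) F i t)).
  by move=> t; rewrite big_cons Pi.
by apply: cmeasD => //; exact: h.
Qed.

Lemma cmeas_prod (I : Type) (r : seq I) (P : pred I) (F : I -> T -> C) :
  (forall i, P i -> cmeas (F i)) -> cmeas (fun t => \prod_(i <- r | P i) F i t).
Proof.
move=> h; elim: r => [|i r IH].
  by apply: (@eq_cmeas (fun=> 1)); [move=> t; rewrite big_nil|exact: cmeas_cst].
case Pi : (P i); last first.
  by apply: eq_cmeas IH => t; rewrite big_cons Pi.
apply: (@eq_cmeas (fun t => F i t * \prod_(i <- r | P i) F i t)).
  by move=> t; rewrite big_cons Pi.
by apply: cmeasM => //; exact: h.
Qed.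

Section Integral.
Variables (mu : {measure set T -> \bar R}) (c : R).
Hypothesis hmu : (mu setT <= c%:E)%E.

Let c0 : 0 <= c.
Proof. by rewrite -lee_fin; apply: le_trans hmu. Qed.

Lemma bounded_integrable (f : T -> R) M : measurable_fun setT f ->
  (forall t, `|f t| <= M) -> mu.-integrable setT (EFin \o f).
Proof.
move=> mf hM; apply/integrableP; split; first exact/measurable_EFinP.
apply: (@le_lt_trans _ _ (\int[mu]_t (M%:E))%E).
  apply: ge0_le_integral => //.
  - by apply/measurable_EFinP; exact: measurableT_comp.
  - by move=> t _; rewrite lee_fin; exact: hM.
rewrite integral_cst //; apply: lte_mul_pinfty => //; last first.
  exact: le_lt_trans hmu (ltry _).
by rewrite lee_fin; apply: (le_trans _ (hM point)).
Qed.

Lemma bounded_Rintegral_le (f : T -> R) M : measurable_fun setT f ->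
  (forall t, `|f t| <= M) -> `|\int[mu]_t f t| <= M * c.
Proof.
move=> mf hM; have If := bounded_integrable mf hM.
have M0 : 0 <= M by apply: (le_trans _ (hM point)).
have muf : (mu setT \is a fin_num)%E.
  by rewrite ge0_fin_numE //; exact: le_lt_trans hmu (ltry _).
apply: (le_trans (le_normr_Rintegral measurableT If)).
apply: (@le_trans _ _ (\int[mu]_t (fun=> M) t)).
  apply: le_Rintegral; first exact: measurableT.
  - apply: (bounded_integrable (M := M)); first exact: measurableT_comp.
    by move=> t; rewrite normr_id.
  - by apply: (bounded_integrable (M := M)) => // t; rewrite ger0_norm.
  - by move=> t _; exact: hM.
rewrite Rintegral_cst // ler_wpM2l // -lee_fin fineK //.
Qed.

Definition cbounded (f : T -> C) := cmeas f /\ exists M, forall t, cabs (f t) <= M.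

Lemma cbounded_Re f : cbounded f -> mu.-integrable setT (EFin \o (fun t => cRe (f t))).
Proof.
move=> [[f1 f2] [M hM]]; apply: (bounded_integrable (M := M)) => // t.
by apply: le_trans (hM t); exact: Re_le_cabs.
Qed.

Lemma cbounded_Im f : cbounded f -> mu.-integrable setT (EFin \o (fun t => cIm (f t))).
Proof.
move=> [[f1 f2] [M hM]]; apply: (bounded_integrable (M := M)) => // t.
by apply: le_trans (hM t); exact: Im_le_cabs.
Qed.

Lemma cboundedZ (a : C) f : cbounded f -> cbounded (fun t => a * f t).
Proof.
move=> [hf [M hM]]; split; first by apply: cmeasM => //; exact: cmeas_cst.
by exists (cabs a * M) => t; rewrite cabsM ler_wpM2l ?cabs_ge0.
Qed.

Lemma cboundedD f g : cbounded f -> cbounded g -> cbounded (fun t => f t + g t).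
Proof.
move=> [hf [M hM]] [hg [N hN]]; split; first exact: cmeasD.
by exists (M + N) => t; apply: (le_trans (cabsD _ _)); exact: lerD.
Qed.

Lemma cbounded0 : cbounded (fun=> 0).
Proof. by split; [exact: cmeas_cst|exists 0 => t; rewrite cabs0]. Qed.

Lemma cintegral0 : cintegral mu (fun=> 0) = 0.
Proof.
rewrite /cintegral /=; have -> : (\int[mu]_t (0 : R))%R = 0.
  by rewrite Rintegral_cst // mul0r.
by [].
Qed.

Lemma cintegralD f g : cbounded f -> cbounded g ->
  cintegral mu (fun t => f t + g t) = cintegral mu f + cintegral mu g.
Proof.
move=> bf bg; apply: eqC; rewrite ?ReD ?ImD /=.
  under [LHS]eq_Rintegral do rewrite ReD.
  by rewrite RintegralD //; exact: cbounded_Re.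
under [LHS]eq_Rintegral do rewrite ImD.
by rewrite RintegralD //; exact: cbounded_Im.
Qed.

Lemma cintegralZ (a : C) f : cbounded f ->
  cintegral mu (fun t => a * f t) = a * cintegral mu f.
Proof.
move=> bf; have iR := cbounded_Re bf; have iI := cbounded_Im bf.
have iZ (b : R) (h : T -> R) : mu.-integrable setT (EFin \o h) ->
    mu.-integrable setT (EFin \o (fun t => b * h t)).
  by move=> ih; have := integrableZl measurableT b ih.
apply: eqC; rewrite ?ReM ?ImM /=.
  under [LHS]eq_Rintegral do rewrite ReM.
  by rewrite RintegralB //; [rewrite !RintegralZl|exact: iZ|exact: iZ].
under [LHS]eq_Rintegral do rewrite ImM.
by rewrite RintegralD //; [rewrite !RintegralZl|exact: iZ|exact: iZ].
Qed.

Lemma cintegral_sum (I : Type) (r : seq I) (F : I -> T -> C) :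
  (forall i, cbounded (F i)) ->
  cintegral mu (fun t => \sum_(i <- r) F i t) = \sum_(i <- r) cintegral mu (F i)
  /\ cbounded (fun t => \sum_(i <- r) F i t).
Proof.
move=> h; elim: r => [|i r [IH1 IH2]].
  rewrite big_nil; have -> : (fun t => \sum_(i <- [::]) F i t) = (fun=> 0).
    by apply/funext => t; rewrite big_nil.
  by split; [exact: cintegral0|exact: cbounded0].
have -> : (fun t => \sum_(j <- i :: r) F j t) =
    (fun t => F i t + \sum_(j <- r) F j t).
  by apply/funext => t; rewrite big_cons.
by split; [rewrite cintegralD // big_cons IH1|exact: cboundedD].
Qed.

(** The constant 2, which comes from bounding the two coordinates separately, is
   harmless. *)
Lemma cabs_cintegral f M : cmeas f -> (forall t, cabs (f t) <= M) ->
  cabs (cintegral mu f) <= 2 * M * c.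
Proof.
move=> [f1 f2] hM; apply: (le_trans (cabs_le_ReIm _)) => /=.
rewrite -mulrA mulr_natl mulr2n; apply: lerD; apply: bounded_Rintegral_le => // t.
  by apply: le_trans (hM t); exact: Re_le_cabs.
by apply: le_trans (hM t); exact: Im_le_cabs.
Qed.

End Integral.

End ComplexMeasurable.

(** * Extending convergence of Stieltjes transforms towards the real axis *)

Section Vanish.
Context (R : realType) (I : Type) (F : set_system I) {FF : Filter F}.
Local Notation C := R[i].

(** Convergence to 0 along a filter, with the real-valued modulus. *)
Definition vanish (u : I -> C) :=
  forall e : R, 0 < e -> F [set t | cabs (u t) <= e].

Lemma vanish_le (u v : I -> C) (M : R) :
  (forall t, cabs (u t) <= M * cabs (v t)) -> vanish v -> vanish u.
Proof.
move=> huv hv e e0; have M0 : 0 < `|M| + 1 by rewrite ltr_wpDl.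
apply: filterS (hv (e / (`|M| + 1)) (divr_gt0 e0 M0)) => t /= ht.
apply: (le_trans (huv t)); apply: (@le_trans _ _ ((`|M| + 1) * cabs (v t))).
  by apply: ler_wpM2r; rewrite ?cabs_ge0 // (le_trans (ler_norm M)) // lerDl.
by move: ht; rewrite ler_pdivlMr // mulrC.
Qed.

Lemma vanish0 : vanish (fun=> 0).
Proof. by move=> e e0; apply: filterS filterT => t _; rewrite /mkset cabs0 ltW. Qed.

Lemma vanishD u v : vanish u -> vanish v -> vanish (fun t => u t + v t).
Proof.
move=> hu hv e e0; have e2 : 0 < e / 2 by rewrite divr_gt0.
apply: filterS2 (hu _ e2) (hv _ e2) => t /= h1 h2.
by apply: (le_trans (cabsD _ _)); rewrite (splitr e) lerD.
Qed.

Lemma vanishZ a u : vanish u -> vanish (fun t => a * u t).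
Proof. by apply: (vanish_le (M := cabs a)) => t; rewrite cabsM. Qed.

Lemma vanish_sum (J : Type) (r : seq J) (P : pred J) (u : J -> I -> C) :
  (forall j, P j -> vanish (u j)) -> vanish (fun t => \sum_(j <- r | P j) u j t).
Proof.
move=> h; elim: r => [|j r IH].
  by apply: (vanish_le (M := 1)) vanish0 => t; rewrite big_nil mul1r.
have [Pj|Pj] := boolP (P j).
  have := vanishD (h _ Pj) IH; apply: (vanish_le (M := 1)) => t.
  by rewrite big_cons Pj mul1r.
by apply: (vanish_le (M := 1)) IH => t; rewrite big_cons (negbTE Pj) mul1r.
Qed.

(** Convergence to 0 on a sequence of points decreasing to the base point kills
   the coefficients one after the other; the uniform geometric bound on the
   remainders then gives convergence to 0 on the whole disc. *)
Lemma vanish_taylor (g : I -> R -> C) (a : I -> nat -> C) (V c : R) :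
  0 < V -> 0 <= c ->
  (forall t N h, - V < h ->
    cabs (g t h - \sum_(k < N) (h *i) ^+ k * a t k)
      <= c / (V + h) * (`|h| / V) ^+ N) ->
  (forall h0, 0 < h0 -> exists h, [/\ 0 < h, h <= h0 & vanish (g ^~ h)]) ->
  forall h, - V < h -> h < V -> vanish (g ^~ h).
Proof.
move=> V0 c0 hT hg.
have cabsi (h : R) k : cabs ((h *i) ^+ k) = `|h| ^+ k.
  by rewrite cabsX; congr (_ ^+ _); rewrite /= expr0n add0r sqrtr_sqr.
have ha k : vanish (a ^~ k).
  elim/ltn_ind: k => k IH e e0.
  set D := c / V / V ^+ k.+1; have D0 : 0 <= D.
    by rewrite !divr_ge0 ?exprn_ge0 // ltW.
  have D1 : 0 < 2 * (D + 1) by rewrite mulr_gt0 // ltr_wpDl.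
  have [h [hp hle hv]] := hg (e / (2 * (D + 1))) (divr_gt0 e0 D1).
  have hk : 0 < h ^+ k by rewrite exprn_gt0.
  have hVh : - V < h by apply: lt_trans hp; rewrite oppr_lt0.
  have vs : vanish (fun t => g t h - \sum_(l < k) (h *i) ^+ l * a t l).
    apply: vanishD => //.
    apply: (vanish_le (M := 1) (v := fun t => \sum_(l < k) (h *i) ^+ l * a t l)).
      by move=> t; rewrite cabsN mul1r.
    by apply: vanish_sum => l _; apply: vanishZ; exact: IH.
  have ep : 0 < e / 2 * h ^+ k by rewrite mulr_gt0 ?divr_gt0.
  apply: filterS (vs _ ep) => t /= ht.
  rewrite -(ler_pM2l hk).
  have := hT t k.+1 h hVh; rewrite big_ord_recr /= opprD addrA => h1.
  have h2 : h ^+ k * cabs (a t k) <= e / 2 * h ^+ k + c / (V + h) * (`|h| / V) ^+ k.+1.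
    have -> : h ^+ k * cabs (a t k) = cabs ((h *i) ^+ k * a t k).
      by rewrite cabsM cabsi gtr0_norm.
    set w := _ * a t k in h1 *; set s := g t h - _ in h1 ht.
    have -> : w = s - (s - w) by rewrite opprB addrC subrK.
    by apply: (le_trans (cabsB _ _)); apply: lerD.
  apply: (le_trans h2).
  have -> : h ^+ k * e = e / 2 * h ^+ k + h ^+ k * (e / 2) by field.
  rewrite lerD2l gtr0_norm // expr_div_n exprS.
  have -> : c / (V + h) * (h * h ^+ k / V ^+ k.+1) =
      h ^+ k * (c / (V + h) / V ^+ k.+1 * h) by ring.
  rewrite ler_pM2l //.
  apply: (@le_trans _ _ (D * h)).
    apply: ler_wpM2r; first exact: ltW.
    apply: ler_wpM2r; first by rewrite invr_ge0 exprn_ge0 // ltW.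
    apply: ler_wpM2l => //; rewrite lef_pV2 ?posrE ?addr_gt0 //.
    by rewrite lerDl ltW.
  apply: (@le_trans _ _ ((D + 1) * h)).
    by apply: ler_wpM2r; rewrite ?lerDl // ltW.
  move: hle; rewrite ler_pdivlMr //; lra.
move=> h h1 h2 e e0.
have Vh : 0 < V + h by rewrite -(ltrBlDl) sub0r.
have rho : Num.norm (`|h| / V) < 1.
  rewrite ger0_norm ?divr_ge0 // ?(ltW V0) // ltr_pdivrMr // mul1r ltr_norml h1 //.
have := cvg_geometric (c / (V + h)) rho => /cvgrPdist_le /(_ (e / 2)).
rewrite divr_gt0 // => /(_ isT)[N _ /(_ N (leqnn N))].
rewrite sub0r normrN /geometric /= => hN.
have vs : vanish (fun t => \sum_(l < N) (h *i) ^+ l * a t l).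
  by apply: vanish_sum => l _; apply: vanishZ; exact: ha.
have e2 : 0 < e / 2 by rewrite divr_gt0.
apply: filterS (vs _ e2) => t /= ht.
set s := \sum_(l < N) _ in ht; rewrite -[g t h](subrK s).
apply: (le_trans (cabsD _ _)); rewrite (splitr e) lerD //.
apply: (le_trans (hT t N h h1)); apply: le_trans hN; exact: ler_norm.
Qed.

End Vanish.

Section StieltjesTaylor.
Variable R : realType.
Local Notation C := R[i].
Local Notation mR := (measurableTypeR R).

Lemma kernel_cmeas (z : C) : cmeas (fun t : mR => ((t : R)%:C - z)^-1).
Proof.
apply: cmeasV; apply: cmeasB; last exact: cmeas_cst.
by apply: cmeas_real; exact: measurable_id.
Qed.

Lemma kernel_Im (z : C) (t : R) : cIm z <= cabs (t%:C - z).
Proof.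
apply: le_trans (Im_le_cabs _); rewrite ImB /= sub0r normrN; exact: ler_norm.
Qed.

Lemma kernel_neq0 (z : C) (t : R) : 0 < cIm z -> t%:C - z != 0.
Proof.
move=> z0; apply/eqP => h; have := kernel_Im z t.
by rewrite h cabs0 leNgt z0.
Qed.

Lemma kernel_le (z : C) (t : R) : 0 < cIm z -> cabs (t%:C - z)^-1 <= (cIm z)^-1.
Proof.
move=> z0; rewrite cabsV lef_pV2 ?posrE ?(cabs_gt0 (kernel_neq0 t z0)) //.
exact: kernel_Im.
Qed.

Lemma kernel_cbounded (z : C) k : 0 < cIm z ->
  cbounded (fun t : mR => ((t : R)%:C - z)^-1 ^+ k).
Proof.
move=> z0; split; first by apply: cmeasX; exact: kernel_cmeas.
exists ((cIm z)^-1 ^+ k) => t; rewrite cabsX lerXn2r ?nnegrE ?cabs_ge0 //.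
  by rewrite invr_ge0 ltW.
exact: kernel_le.
Qed.

Lemma kernel_expansion (z z0 : C) (t : R) N : 0 < cIm z -> 0 < cIm z0 ->
  (t%:C - z)^-1 = \sum_(k < N) (z - z0) ^+ k * (t%:C - z0)^-1 ^+ k.+1
    + (z - z0) ^+ N * ((t%:C - z0)^-1 ^+ N * (t%:C - z)^-1).
Proof.
move=> hz hz0; elim: N => [|N IH].
  by rewrite big_ord0 add0r !expr0 !mul1r.
rewrite big_ord_recr /= [LHS]IH -addrA; congr (_ + _).
rewrite !exprS; set a := (z - z0) ^+ N; set b := _ ^+ N.
by field; rewrite !kernel_neq0.
Qed.

Definition stieltjes_coef (nu : {measure set mR -> \bar R}) (z0 : C) (k : nat) : C :=
  cintegral nu (fun t : mR => ((t : R)%:C - z0)^-1 ^+ k.+1).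

(** Integrated geometric expansion of the kernel around z0; on the vertical line
   through z0 it converges for |z - z0| < Im z0, uniformly in the measure. *)
Lemma stieltjes_taylor (nu : {measure set mR -> \bar R}) (c : R) (z z0 : C) N :
  (nu setT <= c%:E)%E -> 0 < cIm z -> 0 < cIm z0 ->
  cabs (stieltjes nu z - \sum_(k < N) (z - z0) ^+ k * stieltjes_coef nu z0 k)
   <= 2 * c / cIm z * (cabs (z - z0) / cIm z0) ^+ N.
Proof.
move=> hnu hz hz0.
have E : stieltjes nu z = \sum_(k < N) (z - z0) ^+ k * stieltjes_coef nu z0 k
   + cintegral nu (fun t : mR =>
       (z - z0) ^+ N * (((t : R)%:C - z0)^-1 ^+ N * ((t : R)%:C - z)^-1)).
  rewrite /stieltjes.
  under eq_fun => t do rewrite (kernel_expansion _ N hz hz0).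
  have [E1 b1] := @cintegral_sum _ _ _ nu c hnu _ (index_enum 'I_N)
     (fun (k : 'I_N) (t : mR) => (z - z0) ^+ k * ((t : R)%:C - z0)^-1 ^+ k.+1)
     (fun k => cboundedZ _ (kernel_cbounded _ hz0)).
  rewrite (cintegralD hnu) //.
    rewrite E1; congr (_ + _); apply: eq_bigr => k _.
    by rewrite (cintegralZ hnu) //; exact: kernel_cbounded.
  apply: cboundedZ; split.
    by apply: cmeasM; [apply: cmeasX|]; exact: kernel_cmeas.
  have [_ [M hM]] := kernel_cbounded N hz0.
  exists (M * (cIm z)^-1) => t; rewrite cabsM ler_pM ?cabs_ge0 //.
  exact: kernel_le.
rewrite E addrC addKr.
have -> : 2 * c / cIm z * (cabs (z - z0) / cIm z0) ^+ N =
  2 * (cabs (z - z0) ^+ N * ((cIm z0)^-1 ^+ N * (cIm z)^-1)) * c.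
  by rewrite expr_div_n -exprVn; ring.
apply: cabs_cintegral => //.
  apply: cmeasM; first exact: cmeas_cst.
  by apply: cmeasM; [apply: cmeasX|]; exact: kernel_cmeas.
move=> t; rewrite !cabsM !cabsX ler_wpM2l ?exprn_ge0 ?cabs_ge0 //.
rewrite ler_pM ?exprn_ge0 ?cabs_ge0 ?kernel_le //.
by rewrite lerXn2r ?nnegrE ?cabs_ge0 ?invr_ge0 ?(ltW hz0) ?kernel_le.
Qed.

(** The expansions are taken at x + iV; on the vertical line through this point
   the remainder of order N at height y is of order (|y - V| / V)^N. *)
Lemma stieltjes_vanish (I : Type) (F : set_system I) (FF : Filter F)
    (nu nu' : I -> {measure set mR -> \bar R}) (c x V : R) :
  0 < V ->
  (forall t, (nu t setT <= c%:E)%E) -> (forall t, (nu' t setT <= c%:E)%E) ->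
  (forall h0, 0 < h0 -> exists h, [/\ 0 < h, h <= h0 &
    vanish F (fun t => stieltjes (nu t) (x +i* (V + h))
                       - stieltjes (nu' t) (x +i* (V + h)))]) ->
  forall y, 0 < y -> y < 2 * V ->
    vanish F (fun t => stieltjes (nu t) (x +i* y) - stieltjes (nu' t) (x +i* y)).
Proof.
move=> V0 hnu hnu' hv y y0 y2.
pose g t (h : R) := stieltjes (nu t) (x +i* (V + h)) - stieltjes (nu' t) (x +i* (V + h)).
pose z0 : C := x +i* V.
pose a t k := stieltjes_coef (nu t) z0 k - stieltjes_coef (nu' t) z0 k.
have [t0|noI] := pselect (exists t : I, True); last first.
  by move=> e e0; apply: filterS filterT => t; exfalso; apply: noI; exists t.
have c0 : 0 <= c.
  by case: t0 => t _; rewrite -lee_fin; apply: le_trans (hnu t).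
have := @vanish_taylor R I F FF g a V (4 * c) V0 _ _ hv (y - V).
rewrite /g (addrC V) subrK; apply; first by rewrite mulr_ge0.
- move=> t N h hV; have hz : 0 < V + h by rewrite -(ltrBlDl) sub0r.
  have := @stieltjes_taylor (nu t) c (x +i* (V + h)) z0 N (hnu t) hz V0.
  have := @stieltjes_taylor (nu' t) c (x +i* (V + h)) z0 N (hnu' t) hz V0.
  have -> : x +i* (V + h) - z0 = h *i.
    by apply: eqC; rewrite ?ReB ?ImB /=; ring.
  have -> : cabs (h *i) = `|h| by rewrite /= expr0n add0r sqrtr_sqr.
  rewrite /g /a /=; set s := stieltjes _ _; set s' := stieltjes _ _.
  set A := \sum_(k < N) _; set A' := \sum_(k < N) _ => h1 h2.
  have -> : s' - s - \sum_(k < N) (h *i) ^+ k *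
      (stieltjes_coef (nu t) z0 k - stieltjes_coef (nu' t) z0 k) =
      (s' - A') - (s - A).
    under eq_bigr do rewrite mulrBr.
    by rewrite sumrB -/A -/A'; ring.
  apply: (le_trans (cabsB _ _)).
  have -> : 4 * c / (V + h) * (`|h| / V) ^+ N =
    2 * c / (V + h) * (`|h| / V) ^+ N + 2 * c / (V + h) * (`|h| / V) ^+ N by ring.
  exact: lerD.
- by rewrite ltrBrDl subrr.
- by rewrite ltrBlDl; move: y2; rewrite mulr_natl mulr2n.
Qed.

End StieltjesTaylor.

(** * Discrete Stieltjes transforms and matrix realizations *)

Section Spectral.
Variable R : realType.
Local Notation C := R[i].
Local Notation nrm := (@l2norm R _).

Lemma nonneg_def_herm n (H : 'M[C]_n) : nonneg_def H -> H ^t* = H.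
Proof.
move=> hH; have I0 u : cIm (dot u (H *m u)) = 0 := (nonneg_dot u hH).2.
have dd i j : dot (delta_mx i 0) (H *m delta_mx j 0) = H i j.
  rewrite -colE dotE (bigD1 i) //= big1 => [|k ki].
    by rewrite !mxE !eqxx conjc1 mul1r addr0.
  by rewrite mxE (negbTE ki) conjc0 mul0r.
have key i j (a : C) : cIm (a * H i j + (a^*)%C * H j i) = 0.
  have := I0 (delta_mx i 0 + a *: delta_mx j 0).
  have dl w : dot (delta_mx i 0 + a *: delta_mx j 0) w =
      dot (delta_mx i 0) w + (a^*)%C * dot (delta_mx j 0) w.
    by rewrite -dot_conj dotDr dotZr rmorphD rmorphM /= !dot_conj.
  rewrite mulmxDr -scalemxAr dotDr dotZr !dl !dd.
  have h k : cIm (H k k) = 0 by rewrite -dd I0.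
  rewrite mulrDr mulrA [a * (a^*)%C]mulrC mulC_conj !ImD ImZ !h mulr0 add0r addr0.
  by rewrite addrC.
apply/matrixP => i j; rewrite !mxE.
have h1 := key i j 1; have h2 := key i j ('i)%C.
move: h1 h2; rewrite conjc1 !mul1r; move: (H i j) (H j i) => [a b] [c e] /=.
rewrite !mul0r !mul1r ?add0r ?sub0r => h1 h2; apply: eqC => /=; lra.
Qed.

Lemma nonneg_def_normal n (H : 'M[C]_n) : nonneg_def H -> H \is normalmx.
Proof. by move=> /nonneg_def_herm h; apply/normalmxP; rewrite h. Qed.

Lemma spectralP_adj n (H : 'M[C]_n) : nonneg_def H ->
  H = (spectralmx H) ^t* *m diag_mx (spectral_diag H) *m spectralmx H.
Proof.
move=> /nonneg_def_normal/orthomx_spectralP {1}->.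
by rewrite invmx_unitary // spectral_unitarymx.
Qed.

Lemma spectralK n (H : 'M[C]_n) : (spectralmx H) ^t* *m spectralmx H = 1%:M.
Proof.
rewrite -invmx_unitary ?spectral_unitarymx // mulVmx //.
exact: unitarymx_unit (spectral_unitarymx H).
Qed.

Lemma spectralKV n (H : 'M[C]_n) : spectralmx H *m (spectralmx H) ^t* = 1%:M.
Proof. by apply/unitarymxP; exact: spectral_unitarymx. Qed.

Lemma spectral_ge0 n (H : 'M[C]_n) j : nonneg_def H ->
  spectral_diag H 0 j = (eigval H j)%:C /\ 0 <= eigval H j.
Proof.
move=> hH; set U := spectralmx H; set u : 'cV[C]_n := U ^t* *m delta_mx j 0.
have E : dot u (H *m u) = spectral_diag H 0 j.
  rewrite {1}(spectralP_adj hH) -!mulmxA [U *m u]mulmxA spectralKV mul1mx.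
  rewrite dot_adj adjK mulmxA spectralKV mul1mx dotE (bigD1 j) //= big1.
    by rewrite !mxE !eqxx conjc1 mul1r addr0 (bigD1 j) //= big1 ?addr0
      => [|k kj]; rewrite !mxE ?eqxx ?mulr1n ?mulr1 // (negbTE kj) mulr0.
  by move=> k kj; rewrite mxE (negbTE kj) conjc0 mul0r.
have := nonneg_dot u hH; rewrite E /eigval => -[h1 h2]; split => //.
by apply: eqC.
Qed.

Lemma eigval_shift_neq0 n (H : 'M[C]_n) z j : 0 < cIm z ->
  (eigval H j)%:C - z != 0.
Proof. exact: kernel_neq0. Qed.

Lemma spectral_resolvent n (H : 'M[C]_n) z : nonneg_def H -> 0 < cIm z ->
  invmx (H - z%:M) = (spectralmx H) ^t* *m
    diag_mx (\row_j ((eigval H j)%:C - z)^-1) *m spectralmx H.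
Proof.
move=> hH z0; set U := spectralmx H; set D := diag_mx _.
have uH := coercive_unit z0 (resolvent_like_pencil z0 hH).1.
have E : (H - z%:M) *m (U ^t* *m D *m U) = 1%:M.
  have -> : H - z%:M = U ^t* *m (diag_mx (spectral_diag H) - z%:M) *m U.
    rewrite mulmxBr mulmxBl -spectralP_adj // mul_mx_scalar -scalemxAl.
    by rewrite spectralK scalemx1.
  rewrite -!mulmxA [U *m (_ *m _)]mulmxA spectralKV mul1mx.
  rewrite [_ *m (D *m U)]mulmxA.
  have -> : (diag_mx (spectral_diag H) - z%:M) *m D = 1%:M.
    apply/matrixP => i j; rewrite mul_mx_diag !mxE.
    have [->|_] := eqVneq i j; last by rewrite mulr0n subrr mul0r.
    by rewrite !mulr1n (spectral_ge0 j hH).1 mulfV // eigval_shift_neq0.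
  by rewrite mul1mx spectralK.
by rewrite -[LHS]mulmx1 -E mulKmx.
Qed.

End Spectral.

Section Discrete.
Variable R : realType.
Local Notation C := R[i].
Local Notation nrm := (@l2norm R _).

(** Entries are pairs (weight, location). *)
Definition discr (s : seq (R * R)) (z : C) : C :=
  \sum_(q <- s) q.1%:C * (q.2%:C - z)^-1.

Definition discr_ok (s : seq (R * R)) := all (fun q => (0 <= q.1) && (0 <= q.2)) s.

Definition discr_mass (s : seq (R * R)) : R := \sum_(q <- s) q.1.

(** f is on the upper half-plane the Stieltjes transform of a measure of mass c
   with finite support in [0, +oo[. *)
Definition is_discr (c : R) (f : C -> C) := exists s,
  [/\ discr_ok s, discr_mass s = c & forall z, 0 < cIm z -> f z = discr s z].

Lemma is_discr_eq c f g : (forall z, 0 < cIm z -> g z = f z) ->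
  is_discr c f -> is_discr c g.
Proof. by move=> h [s [h1 h2 h3]]; exists s; split=> // z z0; rewrite h ?h3. Qed.

Lemma is_discr0 : is_discr 0 (fun=> 0).
Proof. by exists [::]; split=> //; rewrite ?/discr_mass ?big_nil // => z _; rewrite /discr big_nil. Qed.

Lemma is_discrD c1 c2 f1 f2 : is_discr c1 f1 -> is_discr c2 f2 ->
  is_discr (c1 + c2) (fun z => f1 z + f2 z).
Proof.
move=> [s1 [a1 b1 e1]] [s2 [a2 b2 e2]]; exists (s1 ++ s2).
split; first by rewrite /discr_ok all_cat; apply/andP.
  by rewrite /discr_mass big_cat /= -b1 -b2.
by move=> z z0; rewrite /discr big_cat /= e1 // e2.
Qed.

Lemma is_discrZ c a f : 0 <= a -> is_discr c f ->
  is_discr (a * c) (fun z => a%:C * f z).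
Proof.
move=> a0 [s [a1 b1 e1]]; exists [seq (a * q.1, q.2) | q <- s]; split.
- rewrite /discr_ok all_map; apply: sub_all a1 => q /= /andP[q1 ->].
  by rewrite mulr_ge0.
- by rewrite /discr_mass big_map -mulr_sumr -b1.
- move=> z z0; rewrite /discr big_map e1 // mulr_sumr; apply: eq_bigr => q _.
  by rewrite mulrA -rmorphM.
Qed.

Lemma is_discr_sum (I : Type) (r : seq I) (c : I -> R) (f : I -> C -> C) :
  (forall i, is_discr (c i) (f i)) ->
  is_discr (\sum_(i <- r) c i) (fun z => \sum_(i <- r) f i z).
Proof.
move=> h; elim: r => [|i r IH].
  by rewrite big_nil; apply: is_discr_eq is_discr0 => z _; rewrite big_nil.
rewrite big_cons; apply: is_discr_eq (is_discrD (h i) IH) => z _.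
by rewrite big_cons.
Qed.

Lemma discr_good s z : 0 < cIm z -> discr_ok s -> good z (discr s z).
Proof.
move=> z0 /allP hs; rewrite /discr big_seq_cond; apply: good_sum => q.
rewrite andbT => /hs /andP[q1 q2]; apply: goodZ => //.
have kp : 0 < cabs (q.2%:C - z) ^+ 2.
  by rewrite exprn_gt0 // cabs_gt0 // kernel_neq0.
split.
  by rewrite Im_inv ImB /= sub0r opprK divr_ge0 ?(ltW z0) ?(ltW kp).
have -> : cIm (z * (q.2%:C - z)^-1) = q.2 * cIm z / cabs (q.2%:C - z) ^+ 2.
  by rewrite ImM Re_inv Im_inv ReB ImB /= sub0r opprK; ring.
apply: divr_ge0 (ltW kp); apply: mulr_ge0 (ltW z0); exact: q2.
Qed.

Lemma is_discr_good c f z : 0 < cIm z -> is_discr c f -> good z (f z).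
Proof. by move=> z0 [s [h _ E]]; rewrite E //; exact: discr_good. Qed.

(** The spectral theorem: the atoms are the eigenvalues, weighted by the squared
   moduli of the coordinates of b. *)
Lemma spectral_is_discr n (H : 'M[C]_n) (b : 'cV[C]_n) : nonneg_def H ->
  is_discr (nrm b ^+ 2) (fun z => dot b (invmx (H - z%:M) *m b)).
Proof.
move=> hH; set U := spectralmx H; set c := U *m b.
exists [seq (cabs (c j 0) ^+ 2, eigval H j) | j <- index_enum 'I_n]; split.
- by rewrite /discr_ok all_map; apply/allP => j _ /=; rewrite sqr_ge0 (spectral_ge0 j hH).2.
- rewrite /discr_mass big_map -nrm_sqr; apply/complexI.
  rewrite -!dotvv dot_adj /c mulmxA spectralK mul1mx //.
- move=> z z0; rewrite spectral_resolvent // -!mulmxA dot_adj adjK -/U -/c.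
  rewrite dotE /discr big_map; apply: eq_bigr => j _.
  by rewrite mul_diag_mx !mxE /= -mulC_conj; ring.
Qed.

Lemma mxtrace_resolvent n (H : 'M[C]_n) z : nonneg_def H -> 0 < cIm z ->
  \tr (invmx (H - z%:M)) = \sum_j ((eigval H j)%:C - z)^-1.
Proof.
move=> hH z0; rewrite spectral_resolvent // mxtrace_mulC mulmxA spectralKV mul1mx.
by apply: eq_bigr => j _; rewrite !mxE eqxx mulr1n.
Qed.

(** A matrix function with such a realization is the Schur complement of a block
   of a pencil H - z whose H is nonnegative, so that its inverse is a corner of
   the resolvent of H. *)
Definition realized p (D : C -> 'M[C]_p) :=
  exists q (H0 : 'M[C]_p) (E : 'M[C]_(p, q)) (H1 : 'M[C]_q),
    nonneg_def (block_mx H0 E (E ^t*) H1) /\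
    forall z, 0 < cIm z -> forall a : 'cV[C]_p, exists h : 'cV[C]_q,
      H0 *m a + E *m h - z *: a = D z *m a /\
      (E ^t*) *m a + H1 *m h - z *: h = 0.

Lemma realized_pencil p (H : 'M[C]_p) : nonneg_def H ->
  realized (fun z => H - z%:M).
Proof.
move=> hH; exists 0%N, H, 0, 0; split.
  apply: nonneg_defP => u; rewrite -[u]vsubmxK mul_block_col.
  rewrite trmx0 map_mx0 !mul0mx !addr0.
  by have := hH (usubmx u); rewrite /dot -mulmxA tr_col_mx map_row_mx mul_row_col
    mulmx0 addr0.
move=> z z0 a; exists 0; split; last by apply/matrixP => -[].
by rewrite mulmx0 addr0 mulmxBl scalar_mxM.
Qed.

Lemma dot_col_mx p q (a x : 'cV[C]_p) (h y : 'cV[C]_q) :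
  dot (col_mx a h) (col_mx x y) = dot a x + dot h y.
Proof. by rewrite /dot tr_col_mx map_row_mx mul_row_col mxE. Qed.

Lemma mul_dot p (b u : 'cV[C]_p) q (v : 'cV[C]_q) :
  v *m (b ^t* *m u) = dot b u *: v.
Proof. by rewrite [b ^t* *m u]mx11_scalar -/(dot b u) mul_mx_scalar. Qed.

(** With e(z) = u^* (L - z)^-1 u and L diagonal, 1 / (1 + e) equals
   1 - u^* (L + u u^* - z)^-1 u; hence the summand b b^* / (1 + e) is absorbed
   by a larger pencil, obtained by coupling L + u u^* to the first block through
   b u^*, and the quadratic form grows by the square |b^* a + u^* g|^2. *)
Lemma realizedD p (D : C -> 'M[C]_p) (b : 'cV[C]_p) c e : realized D ->
  is_discr c e -> realized (fun z => D z + (1 + e z)^-1 *: (b *m b ^t*)).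
Proof.
move=> [q [H0 [E [H1 [hN hD]]]]] he; have [s [/allP hs _ es]] := he.
pose r := size s; pose w (i : 'I_r) := (nth (0, 0) s i).1.
pose l (i : 'I_r) := (nth (0, 0) s i).2.
have w0 i : 0 <= w i by have /andP[] := hs _ (mem_nth (0, 0) (ltn_ord i)).
have l0 i : 0 <= l i by have /andP[] := hs _ (mem_nth (0, 0) (ltn_ord i)).
pose u : 'cV[C]_r := \col_i (Num.sqrt (w i))%:C.
pose L : 'M[C]_r := diag_mx (\row_i (l i)%:C).
exists (q + r)%N, (H0 + b *m b ^t*), (row_mx E (b *m u ^t*)),
  (block_mx H1 0 0 (L + u *m u ^t*)); split.
- apply: nonneg_defP => v; rewrite -[v]vsubmxK; set a := usubmx v.
  rewrite -[dsubmx v]vsubmxK; set h := usubmx (dsubmx v); set g := dsubmx (dsubmx v).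
  rewrite mul_block_col mul_row_col tr_row_mx map_col_mx mul_col_mx mul_block_col.
  rewrite !mul0mx addr0 add0r add_col_mx !dot_col_mx adjM adjK.
  rewrite !mulmxDl -!mulmxA !mul_dot !dotDr !dotZr.
  have := hN (col_mx a h); rewrite -mulmxA -/(dot _ _) mul_block_col dot_col_mx !dotDr.
  have LG : dot g (L *m g) = (\sum_i l i * cabs (g i 0) ^+ 2)%:C.
    rewrite dotE rmorph_sum; apply: eq_bigr => i _.
    by rewrite mul_diag_mx !mxE mulrCA mulC_conj -rmorphM.
  have LG0 : 0 <= dot g (L *m g).
    by rewrite LG ler0c sumr_ge0 // => i _; rewrite mulr_ge0 ?sqr_ge0.
  rewrite LG in LG0 *.
  rewrite -[dot a b]dot_conj -[dot g u]dot_conj.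
  have := mulcJ_ge0 (dot b a + dot u g); rewrite rmorphD /=.
  set A1 := dot a _; set A2 := dot a _; set A3 := dot h _; set A4 := dot h _.
  set k := dot b a; set t := dot u g; set G := _%:C => X0 Y0.
  have -> : A1 + k * (k^*)%C + (A2 + t * (k^*)%C) +
     (A3 + A4 + (k * (t^*)%C + (G + t * (t^*)%C))) =
     (A1 + A2 + (A3 + A4)) + G + (k + t) * ((k^*)%C + (t^*)%C) by ring.
  by rewrite addr_ge0 // addr_ge0.
move=> z z0 a; have [h [h1 h2]] := hD z z0 a.
have ge : good z (e z) := is_discr_good z0 he.
have ne := good_neq0 z0 ge.
set k := dot b a.
pose g : 'cV[C]_r := \col_i (- (u i 0 * k / ((l i)%:C - z) / (1 + e z))).
have ug : dot u g = - (k * e z / (1 + e z)).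
  have {1}-> : e z = \sum_i (w i)%:C * ((l i)%:C - z)^-1.
    by rewrite es // /discr (big_nth (0, 0)) big_mkord.
  rewrite mulr_sumr mulr_suml -sumrN dotE; apply: eq_bigr => i _.
  have -> : (w i)%:C = ((u i 0)^*)%C * u i 0.
    by rewrite mulC_conj mxE cabsR real_normK ?num_real // sqr_sqrtr.
  by rewrite [g i 0]mxE; ring.
exists (col_mx h g); split.
  rewrite mul_row_col !mulmxDl -!mulmxA !mul_dot -h1 -scalemxAl -mulmxA mul_dot.
  rewrite ug -/k scalerA -[LHS]addrA.
  rewrite -!addrA; congr (_ + _).
  rewrite [LHS]addrC -!addrA; congr (_ + _); rewrite addrC -addrA; congr (_ + _).
  rewrite -scalerDl; congr (_ *: _).
  by field.
rewrite tr_row_mx map_col_mx mul_col_mx mul_block_col !mul0mx addr0 add0r.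
rewrite add_col_mx scale_col_mx opp_col_mx add_col_mx h2.
rewrite adjM adjK mulmxDl -!mulmxA !mul_dot ug -/k.
rewrite -[RHS]vsubmxK; congr col_mx; first by apply/matrixP => i j; rewrite !mxE.
have -> : L *m g = \col_i ((l i)%:C * g i 0).
  by apply/matrixP => i j; rewrite mul_diag_mx !mxE.
apply/matrixP => i j; rewrite !mxE.
have := kernel_neq0 (l i) z0 => nl.
by field; rewrite ne nl.
Qed.

Lemma realized_eq p (D D' : C -> 'M[C]_p) :
  (forall z, 0 < cIm z -> D' z = D z) -> realized D -> realized D'.
Proof.
move=> h [q [H0 [E [H1 [h1 h2]]]]]; exists q, H0, E, H1; split=> // z z0 a.
by rewrite h //; exact: h2.
Qed.

Lemma realized_sum (I : Type) (r : seq I) p (F : I -> C -> 'M[C]_p) D :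
  (forall i D, realized D -> realized (fun z => D z + F i z)) ->
  realized D -> realized (fun z => D z + \sum_(i <- r) F i z).
Proof.
move=> hF hD; elim: r => [|i r IH].
  by apply: realized_eq hD => z _; rewrite big_nil addr0.
apply: realized_eq (hF i _ IH) => z _; rewrite big_cons.
by rewrite [F i z + _]addrC addrA.
Qed.

(** A quadratic form of the inverse of D is one of the resolvent of the larger
   Hermitian matrix, at the vector b extended by 0. *)
Lemma realized_discr p (D : C -> 'M[C]_p) (b : 'cV[C]_p) : realized D ->
  (forall z, 0 < cIm z -> D z \in unitmx) ->
  is_discr (nrm b ^+ 2) (fun z => dot b (invmx (D z) *m b)).
Proof.
move=> [q [H0 [E [H1 [hN hD]]]]] uD.
have nb : nrm (col_mx b (0 : 'cV[C]_q)) ^+ 2 = nrm b ^+ 2.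
  by apply: complexI; rewrite -!dotvv dot_col_mx dot0r addr0.
rewrite -nb; apply: is_discr_eq (spectral_is_discr _ hN) => z z0.
have [h [h1 h2]] := hD z z0 (invmx (D z) *m b).
set a := invmx (D z) *m b in h1 h2 *.
have Da : D z *m a = b by rewrite mulKVmx // uD.
suff <- : col_mx a h = invmx (block_mx H0 E (E ^t*) H1 - z%:M) *m col_mx b 0.
  by rewrite dot_col_mx -[dot 0 h]dot_conj dot0r conjc0 addr0.
have uH := coercive_unit z0 (resolvent_like_pencil z0 hN).1.
rewrite -[LHS](mulKmx uH) mulmxBl mul_block_col scalar_mxM scale_col_mx.
by rewrite opp_col_mx add_col_mx h1 h2 Da.
Qed.

Lemma gram_sum p m (B : 'M[C]_(p, m)) : B *m B ^t* =
  \sum_j col j B *m (col j B) ^t*.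
Proof.
apply/matrixP => i k; rewrite !mxE summxE; apply: eq_bigr => j _.
by rewrite !mxE big_ord1 !mxE.
Qed.

Lemma gram_sqrt p (a : R) (b : 'cV[C]_p) : 0 <= a ->
  ((Num.sqrt a)%:C *: b) *m ((Num.sqrt a)%:C *: b) ^t* = a%:C *: (b *m b ^t*).
Proof.
move=> a0; rewrite linearZ /= map_mxZ -scalemxAl -scalemxAr scalerA.
by rewrite [X in _ * X]conjc_real -rmorphM -expr2 sqr_sqrtr.
Qed.

(** The Gram matrices are sums of squares of columns, absorbed one at a time. *)
Lemma det_map_discr n p (m : 'I_n -> nat) (B : forall k, 'M[C]_(p, m k))
    (A : 'M[C]_p) m' (B' : 'M[C]_(p, m')) (c : 'I_n -> R) (e : 'I_n -> C -> C) :
  nonneg_def A -> (forall k, is_discr (c k) (e k)) ->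
  is_discr (n%:R^-1 * gram_tr B')
    (fun z => det_map B A z (B' *m B' ^t*) (fun k => e k z)).
Proof.
move=> hA he.
have rD : realized (fun z => det_mx B A z (fun k => e k z)).
  pose F (j : 'I_n) z := n%:R^-1 *: ((1 + e j z)^-1 *: (B j *m (B j) ^t*)).
  have hF j D : realized D -> realized (fun z => D z + F j z).
    move=> hD; pose c' l := (Num.sqrt n%:R^-1)%:C *: col l (B j).
    pose G l z := (1 + e j z)^-1 *: (c' l *m (c' l) ^t*).
    have hG l D' : realized D' -> realized (fun z => D' z + G l z).
      by move=> hD'; exact: realizedD hD' (he j).
    apply: realized_eq (realized_sum (index_enum _) hG hD) => z z0.
    rewrite /F /G gram_sum -scaler_sumr scalerA mulrC -scalerA natVC.
    congr (_ + _ *: _); rewrite scaler_sumr; apply: eq_bigr => l _.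
    by rewrite gram_sqrt // invr_ge0.
  apply: realized_eq (realized_sum (index_enum _) hF (realized_pencil hA)) => z z0.
  by rewrite /det_mx /F -scaler_sumr -addrA [RHS]addrC.
have gz z : 0 < cIm z -> forall k, good z (e k z).
  by move=> z0 k; exact: is_discr_good (he k).
have n0 : 0 <= n%:R^-1 :> R by rewrite invr_ge0.
have hd j := realized_discr (col j B') rD (fun z z0 => det_mx_unit B hA z0 (gz z z0)).
apply: is_discr_eq (is_discrZ n0 (is_discr_sum (index_enum _) hd)) => z z0.
by rewrite /det_map mxtrace_mulC mxtrace_gram natVC.
Qed.

End Discrete.

(** * Compactness of families of Stieltjes transforms *)

Section Profiles.
Variable R : realType.
Local Notation C := R[i].
Local Notation mR := (measurableTypeR R).
Local Notation leb := (@lebesgue_measure R).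

(** The kernel 1 / (l - z) in the bounded coordinate y = 1 / (1 + l). *)
Definition kern (z : C) (y : R) : C := y%:C * (1 - y%:C * (1 + z))^-1.

Definition kern_lb (z : C) : R := cIm z / (2 * (1 + cabs z)).

Lemma kern_lb_gt0 z : 0 < cIm z -> 0 < kern_lb z.
Proof. by move=> z0; rewrite divr_gt0 // mulr_gt0 // ltr_wpDr // cabs_ge0. Qed.

(** For small y the product is small, for the other values the imaginary part
   has modulus y Im z, which is not small. *)
Lemma kern_den (z : C) y : 0 < cIm z -> 0 <= y -> y <= 1 ->
  kern_lb z <= cabs (1 - y%:C * (1 + z)).
Proof.
move=> z0 y0 y1; rewrite /kern_lb; set a := 1 + cabs z.
have a0 : 0 < a by rewrite ltr_wpDr // cabs_ge0.
have za : cIm z <= a.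
  apply: (@le_trans _ _ (cabs z)); last by rewrite lerDr.
  by apply: le_trans (Im_le_cabs _); exact: ler_norm.
have [h|h] := leP (y * a) (1 / 2).
  apply: (@le_trans _ _ (1 / 2)).
    by rewrite ler_pdivrMr ?mulr_gt0 //; lra.
  have h1 : cabs (y%:C * (1 + z)) <= 1 / 2.
    apply: le_trans h; rewrite cabsM cabsR ger0_norm // ler_wpM2l //.
    by apply: (le_trans (cabsD _ _)); rewrite cabs1.
  have : cabs (1 : C) <= cabs (1 - y%:C * (1 + z)) + cabs (y%:C * (1 + z)).
    by rewrite -[X in cabs X <= _](subrK (y%:C * (1 + z))); exact: cabsD.
  rewrite cabs1; lra.
apply: le_trans (Im_le_cabs _).
rewrite ImB ImZ ImD /= !add0r normrN ger0_norm ?mulr_ge0 // ?(ltW z0) //.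
rewrite ler_pdivrMr ?mulr_gt0 //.
have -> : y * cIm z * (2 * a) = cIm z * (2 * (y * a)) by ring.
by rewrite ler_pMr //; lra.
Qed.

Lemma kern_den_neq0 (z : C) y : 0 < cIm z -> 0 <= y -> y <= 1 ->
  1 - y%:C * (1 + z) != 0.
Proof.
move=> z0 y0 y1; apply/eqP => h; have := kern_den z0 y0 y1.
by rewrite h cabs0 leNgt kern_lb_gt0.
Qed.

Lemma kern_den_inv (z : C) y : 0 < cIm z -> 0 <= y -> y <= 1 ->
  cabs (1 - y%:C * (1 + z))^-1 <= (kern_lb z)^-1.
Proof.
move=> z0 y0 y1; rewrite cabsV lef_pV2 ?posrE ?kern_lb_gt0 //.
  exact: kern_den.
by rewrite cabs_gt0 // kern_den_neq0.
Qed.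

Lemma kern_le (z : C) y : 0 < cIm z -> 0 <= y -> y <= 1 ->
  cabs (kern z y) <= (kern_lb z)^-1.
Proof.
move=> z0 y0 y1; rewrite cabsM cabsR ger0_norm //.
rewrite -[leRHS]mul1r; apply: ler_pM => //; first exact: cabs_ge0.
exact: kern_den_inv.
Qed.

Lemma kern_lip (z : C) y y' : 0 < cIm z -> 0 <= y -> y <= 1 -> 0 <= y' -> y' <= 1 ->
  cabs (kern z y - kern z y') <= (kern_lb z)^-1 ^+ 2 * `|y - y'|.
Proof.
move=> z0 y0 y1 y0' y1'.
have -> : kern z y - kern z y' = (y - y')%:C *
   ((1 - y%:C * (1 + z))^-1 * (1 - y'%:C * (1 + z))^-1).
  have h := kern_den_neq0 z0 y0 y1; have h' := kern_den_neq0 z0 y0' y1'.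
  by rewrite /kern rmorphB; field; rewrite h h'.
rewrite cabsM cabsR mulrC; apply: ler_wpM2r => //.
by rewrite cabsM expr2 ler_pM ?cabs_ge0 ?kern_den_inv.
Qed.

Lemma kern0 z : kern z 0 = 0.
Proof. by rewrite /kern mul0r. Qed.

Lemma kernE (z : C) y : 0 < cIm z -> 0 < y -> y <= 1 ->
  kern z y = ((y^-1 - 1)%:C - z)^-1.
Proof.
move=> z0 y0 y1; rewrite /kern; set w := 1 - _.
have y0' : y%:C != 0 :> C by rewrite fmorph_eq0 gt_eqF.
have -> : (y^-1 - 1)%:C - z = y%:C^-1 * w.
  by rewrite /w rmorphB fmorphV rmorph1; field.
by rewrite invfM invrK.
Qed.

(** A nonincreasing function from [0, c[ to [0, 1] stands for the image of
   Lebesgue measure by 1 / psi - 1; where psi vanishes the mass is at infinity. *)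
Definition profile (psi : R -> R) :=
  (forall u v, u <= v -> psi v <= psi u) /\ (forall u, 0 <= psi u <= 1).

Lemma profile_measurable psi : profile psi -> measurable_fun [set: mR] (psi : mR -> R).
Proof. by move=> [h _]; apply: nonincreasing_measurable => // u v; exact: h. Qed.

Lemma profile_cmeas psi z : profile psi ->
  cmeas (fun u : mR => kern z (psi u)).
Proof.
move=> hp; have mp := cmeas_real (profile_measurable hp).
apply: cmeasM => //; apply: cmeasV; apply: cmeasB; first exact: cmeas_cst.
by apply: cmeasM => //; exact: cmeas_cst.
Qed.

Lemma profile_kern_le psi z u : 0 < cIm z -> profile psi ->
  cabs (kern z (psi u)) <= (kern_lb z)^-1.
Proof. by move=> z0 [_ h]; have /andP[h1 h2] := h u; exact: kern_le. Qed.

Lemma itv_integrable (g : mR -> R) a b M : measurable_fun [set: mR] g ->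
  (forall u, `|g u| <= M) -> leb.-integrable `[a, b[%classic (EFin \o g).
Proof.
move=> mg hM; apply: measurable_bounded_integrable.
- exact: measurable_itv.
- by rewrite /= lebesgue_measure_itv; case: ifP => // _; rewrite -EFinB ltry.
- exact: measurable_funS mg.
- by exists M; split; [exact: num_real|move=> N MN u _ /=; rewrite (le_trans (hM u)) // ltW].
Qed.

Arguments itv_integrable {g a b M}.

Lemma fine_leb_itv a b : a <= b -> fine (leb `[a, b[%classic) = b - a.
Proof.
move=> ab; rewrite lebesgue_measure_itv /= lte_fin.
by move: ab; rewrite le_eqVlt => /orP[/eqP ->|->] //=; rewrite ltxx subrr.
Qed.

Lemma Rintegral_itv_split (g : mR -> R) a b c M : measurable_fun [set: mR] g ->
  (forall u, `|g u| <= M) -> a <= b -> b <= c ->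
  \int[leb]_(u in `[a, c[%classic) g u =
  \int[leb]_(u in `[a, b[%classic) g u + \int[leb]_(u in `[b, c[%classic) g u.
Proof.
move=> mg hM ab bc.
have E : (`[a, c[%classic = `[a, b[%classic `|` `[b, c[%classic :> set R).
  apply/seteqP; split => u /=; rewrite !in_itv /=.
    move=> /andP[h1 h2]; have [ub|ub] := ltP u b; [left|right].
      by rewrite h1.
    by rewrite h2.
  move=> [|] /andP[h1 h2]; apply/andP; split => //.
    exact: lt_le_trans bc.
  exact: le_trans h1.
rewrite E Rintegral_setU //; first by rewrite -E; exact: itv_integrable hM.
rewrite disj_set2E; apply/eqP/seteqP; split => // u /=; rewrite !in_itv /=.
by move=> [/andP[_ h1] /andP[h2 _]]; move: (lt_le_trans h1 h2); rewrite ltxx.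
Qed.

Lemma Rintegral_itv_near (g : mR -> R) a b c M e : measurable_fun [set: mR] g ->
  (forall u, `|g u| <= M) -> a <= b ->
  (forall u, a <= u -> u < b -> `|g u - c| <= e) ->
  `|\int[leb]_(u in `[a, b[%classic) g u - (b - a) * c| <= (b - a) * e.
Proof.
move=> mg hM ab he.
have mI : measurable (`[a, b[%classic : set mR) by exact: measurable_itv.
have Ic (k : R) : leb.-integrable `[a, b[%classic (EFin \o (fun=> k)).
  by apply: (itv_integrable (M := `|k|)).
have Ig := itv_integrable (a := a) (b := b) mg hM.
have -> : (b - a) * c = \int[leb]_(u in `[a, b[%classic) c.
  by rewrite Rintegral_cst // [X in c * X]fine_leb_itv // mulrC.
rewrite -RintegralB //.
have mgc : measurable_fun [set: mR] (fun u => g u - c) by exact: measurable_funB.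
have hgc u : `|g u - c| <= M + `|c|.
  by apply: (le_trans (ler_normB _ _)); rewrite lerD2r.
have Igc := itv_integrable (a := a) (b := b) mgc hgc.
apply: (le_trans (le_normr_Rintegral mI Igc)).
apply: (@le_trans _ _ (\int[leb]_(u in `[a, b[%classic) e)); last first.
  by rewrite Rintegral_cst // [X in e * X]fine_leb_itv // mulrC.
apply: le_Rintegral => //.
  apply: (itv_integrable (M := M + `|c|)); first exact: measurableT_comp.
  by move=> u; rewrite normr_id.
by move=> u /=; rewrite in_itv /= => /andP[]; exact: he.
Qed.

(** Monotonicity makes the errors of the Riemann sums telescope, so that the
   bound does not depend on the profile. *)
Lemma Riemann_profile psi (g : mR -> R) L M N d : profile psi ->
  measurable_fun [set: mR] g -> (forall u, `|g u| <= M) -> 0 <= L -> 0 <= d ->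
  (forall u v, u <= v -> `|g v - g u| <= L * (psi u - psi v)) ->
  `|\int[leb]_(u in `[0, N%:R * d[%classic) g u - d * \sum_(l < N) g (l%:R * d)|
    <= d * L.
Proof.
move=> [pd p01] mg hM L0 d0 hg.
suff : `|\int[leb]_(u in `[0, N%:R * d[%classic) g u - d * \sum_(l < N) g (l%:R * d)|
    <= d * L * (psi 0 - psi (N%:R * d)).
  move=> /le_trans; apply; rewrite -[leRHS]mulr1; apply: ler_wpM2l.
    exact: mulr_ge0.
  have /andP[_ h1] := p01 0; have /andP[h2 _] := p01 (N%:R * d); lra.
elim: N => [|N IH].
  rewrite mul0r big_ord0 mulr0 subr0 subrr mulr0 set_itvco0 ?Rintegral_set0 ?normr0 //.
have NS : N%:R * d <= N.+1%:R * d by apply: ler_wpM2r => //; rewrite ler_nat.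
rewrite (Rintegral_itv_split mg hM _ NS) ?mulr_ge0 // big_ord_recr /= mulrDr.
set I1 := Rintegral _ _ _; set I2 := Rintegral _ _ _; set s := \sum_(l < N) _.
have -> : I1 + I2 - (d * s + d * g (N%:R * d)) = (I1 - d * s) + (I2 - d * g (N%:R * d)).
  by ring.
apply: (le_trans (ler_normD _ _)).
have -> : d * L * (psi 0 - psi (N.+1%:R * d)) =
   d * L * (psi 0 - psi (N%:R * d)) + d * (L * (psi (N%:R * d) - psi (N.+1%:R * d))).
  by ring.
apply: lerD => //.
have dE : d = N.+1%:R * d - N%:R * d by rewrite -natr1; ring.
have := @Rintegral_itv_near g _ _ (g (N%:R * d)) M
  (L * (psi (N%:R * d) - psi (N.+1%:R * d))) mg hM NS.
rewrite -dE; apply => u h1 h2.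
apply: (le_trans (hg _ _ h1)); apply: ler_wpM2l => //.
by rewrite lerD2l lerN2 pd // ltW.
Qed.

(** The Stieltjes transform, in the coordinate y, of the image of Lebesgue measure
   on [0, c[ under the profile. *)
Definition profile_int (c : R) (psi : R -> R) (z : C) : C :=
  (\int[leb]_(u in `[0, c[%classic) cRe (kern z (psi u))) +i*
  (\int[leb]_(u in `[0, c[%classic) cIm (kern z (psi u))).

Lemma Riemann_profile_int psi z N d : profile psi -> 0 < cIm z -> 0 <= d ->
  cabs (profile_int (N%:R * d) psi z - d%:C * \sum_(l < N) kern z (psi (l%:R * d)))
  <= 2 * (d * (kern_lb z)^-1 ^+ 2).
Proof.
move=> hp z0 d0; have [m1 m2] := profile_cmeas z hp.
have hL u v : u <= v ->
    cabs (kern z (psi v) - kern z (psi u)) <= (kern_lb z)^-1 ^+ 2 * (psi u - psi v).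
  move=> uv; have [pd p01] := hp.
  have /andP[a1 a2] := p01 u; have /andP[b1 b2] := p01 v.
  apply: (le_trans (kern_lip z0 b1 b2 a1 a2)).
  by rewrite distrC ger0_norm // subr_ge0 pd.
apply: (le_trans (cabs_le_ReIm _)); rewrite [2 * _]mulr_natl mulr2n.
rewrite ReB ImB ReZ ImZ Re_sum Im_sum /=; apply: lerD.
  apply: (Riemann_profile (psi := psi) (M := (kern_lb z)^-1)) => //.
  - by move=> u; apply: (le_trans (Re_le_cabs _)); exact: profile_kern_le.
  - by rewrite exprn_ge0 // invr_ge0 ltW // kern_lb_gt0.
  - by move=> u v uv; rewrite -ReB; apply: (le_trans (Re_le_cabs _)); exact: hL.
apply: (Riemann_profile (psi := psi) (M := (kern_lb z)^-1)) => //.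
- by move=> u; apply: (le_trans (Im_le_cabs _)); exact: profile_kern_le.
- by rewrite exprn_ge0 // invr_ge0 ltW // kern_lb_gt0.
- by move=> u v uv; rewrite -ImB; apply: (le_trans (Im_le_cabs _)); exact: hL.
Qed.

(** The profile of a discrete measure whose atoms are listed by increasing
   location, the first atom occupying an interval that starts at a. *)
Fixpoint step (a : R) (s : seq (R * R)) (u : R) : R :=
  if s is q :: s' then if u < a + q.1 then (1 + q.2)^-1 else step (a + q.1) s' u
  else 0.

Lemma step_le a s l u : 0 <= l -> discr_ok s -> all (fun q => l <= q.2) s ->
  0 <= step a s u <= (1 + l)^-1.
Proof.
move=> l0; elim: s a => [|q s IH] a /=.
  by rewrite lexx invr_ge0 addr_ge0.
move=> /andP[/andP[q1 q2] hs] /andP[lq ls]; case: ifP => _; last exact: IH.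
by rewrite invr_ge0 addr_ge0 //= lef_pV2 ?posrE ?ltr_wpDr // lerD2l.
Qed.

Lemma step_mono a s u v : discr_ok s ->
  sorted (fun q q' : R * R => q.2 <= q'.2) s -> u <= v -> step a s v <= step a s u.
Proof.
elim: s a => [//|q s IH] a /= /andP[/andP[q1 q2] hs] hp uv.
have tr : transitive (fun q q' : R * R => q.2 <= q'.2).
  by move=> x y w; exact: le_trans.
have [ua|ua] := ltP u (a + q.1); last first.
  by rewrite ltNge (le_trans ua uv) /=; apply: IH => //; exact: path_sorted hp.
case: ifP => // _; have := order_path_min tr hp.
by move=> /(step_le (a + q.1) v q2 hs)/andP[].
Qed.

Lemma step_profile a s : discr_ok s -> sorted (fun q q' : R * R => q.2 <= q'.2) s ->
  profile (step a s).
Proof.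
move=> h1 h2; split; first by move=> u v; exact: step_mono.
move=> u; have h3 : all (fun q => 0 <= q.2) s.
  by apply: sub_all h1 => q /andP[].
by have := step_le a u (lexx _) h1 h3; rewrite addr0 invr1.
Qed.

Lemma step_int (phi : R -> R) (M a c : R) (s : seq (R * R)) : phi 0 = 0 ->
  discr_ok s -> sorted (fun q q' : R * R => q.2 <= q'.2) s ->
  (forall psi, profile psi -> measurable_fun [set: mR] (fun u : mR => phi (psi u))) ->
  (forall y, 0 <= y <= 1 -> `|phi y| <= M) -> a + discr_mass s <= c ->
  \int[leb]_(u in `[a, c[%classic) phi (step a s u) =
  \sum_(q <- s) q.1 * phi ((1 + q.2)^-1).
Proof.
move=> phi0 + + mphi hM.
have cst (g : R -> R) a' b k : a' <= b -> (forall u, a' <= u -> u < b -> g u = k) ->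
    \int[leb]_(u in `[a', b[%classic) g u = (b - a') * k.
  move=> ab hg; rewrite (@eq_Rintegral _ _ _ _ _ (fun=> k)); last first.
    by move=> u; rewrite inE /= in_itv /= => /andP[]; exact: hg.
  by rewrite Rintegral_cst ?[X in k * X]fine_leb_itv 1?mulrC //; exact: measurable_itv.
elim: s a => [|q s IH] a hs hp.
  rewrite /discr_mass big_nil addr0 => ac.
  by rewrite (cst _ _ _ 0) // mulr0 big_nil.
rewrite /discr_mass big_cons => hc.
have pr := step_profile a hs hp.
have mg := mphi _ pr; have hg u := hM _ (pr.2 u).
move: hs hp => /= /andP[/andP[q1 q2] hs] hp.
have m0 : 0 <= discr_mass s.
  rewrite /discr_mass big_seq sumr_ge0 // => r rs.
  by have /andP[] := allP hs _ rs.
have aq : a <= a + q.1 by rewrite lerDl.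
have qc : a + q.1 <= c by apply: le_trans hc; rewrite addrA lerDl.
rewrite (Rintegral_itv_split mg hg aq qc) big_cons; congr (_ + _).
  rewrite (cst _ _ _ (phi (1 + q.2)^-1)) //=; first by rewrite addrAC subrr add0r.
  by move=> u _ ->.
transitivity (\int[leb]_(u in `[a + q.1, c[%classic) phi (step (a + q.1) s u)).
  apply: eq_Rintegral => u.
  by rewrite inE /= in_itv /= => /andP[h _]; rewrite ltNge h.
apply: IH => //; first exact: path_sorted hp.
by rewrite -addrA.
Qed.

Lemma profile_int_step z c s : 0 < cIm z -> discr_ok s ->
  sorted (fun q q' : R * R => q.2 <= q'.2) s -> discr_mass s <= c ->
  profile_int c (step 0 s) z = discr s z.
Proof.
move=> z0 hs hp hc.
have E q : q \in s -> kern z (1 + q.2)^-1 = (q.2%:C - z)^-1.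
  move=> /(allP hs)/andP[_ q2].
  have p : 0 < 1 + q.2 by rewrite ltr_wpDr.
  rewrite kernE ?invr_gt0 // ?invf_le1 ?lerDl // invrK.
  by rewrite [1 + _]addrC addrK.
rewrite /discr big_seq_cond.
under eq_bigr => q do rewrite andbT => /E <-.
rewrite -big_seq_cond; apply: eqC => /=.
  rewrite Re_sum; under eq_bigr do rewrite ReZ.
  apply: (step_int (phi := fun y => cRe (kern z y)) (M := (kern_lb z)^-1)) => //.
  - by rewrite kern0.
  - by move=> psi hpsi; exact: (profile_cmeas z hpsi).1.
  - by move=> y /andP[y0 y1]; apply: le_trans (kern_le z0 y0 y1); exact: Re_le_cabs.
  - by rewrite add0r.
rewrite Im_sum; under eq_bigr do rewrite ImZ.
apply: (step_int (phi := fun y => cIm (kern z y)) (M := (kern_lb z)^-1)) => //.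
- by rewrite kern0.
- by move=> psi hpsi; exact: (profile_cmeas z hpsi).2.
- by move=> y /andP[y0 y1]; apply: le_trans (kern_le z0 y0 y1); exact: Im_le_cabs.
- by rewrite add0r.
Qed.

Lemma is_discr_profile c f : is_discr c f -> exists psi, profile psi /\
  forall z, 0 < cIm z -> f z = profile_int c psi z.
Proof.
move=> [s [h1 h2 h3]].
pose le2 (q q' : R * R) := q.2 <= q'.2.
have p : perm_eq (sort le2 s) s by rewrite perm_sort.
have s1 : discr_ok (sort le2 s) by rewrite /discr_ok (perm_all _ p).
have s2 : sorted le2 (sort le2 s) by apply: sort_sorted => x y; exact: le_total.
exists (step 0 (sort le2 s)); split; first exact: step_profile.
move=> z z0; rewrite h3 // profile_int_step //.
  by rewrite /discr (perm_big _ p).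
by rewrite -h2 /discr_mass (perm_big _ p).
Qed.

End Profiles.

Section ProfileMeasure.
Variable R : realType.
Local Notation C := R[i].
Local Notation mR := (measurableTypeR R).
Local Notation leb := (@lebesgue_measure R).

Lemma finite_pushforward (Q : mR -> mR) (mQ : measurable_fun [set: mR] Q)
    (D : set mR) (mD : measurable D) : (leb D < +oo)%E ->
  exists nu : {finite_measure set mR -> \bar R},
    (nu : set mR -> \bar R) = pushforward (mrestr leb mD) Q.
Proof.
move=> hD.
have [mm E] : exists mm : {measure set mR -> \bar R},
    (mm : set mR -> \bar R) = pushforward (mrestr leb mD) Q.
  by unshelve refine
    (ex_intro _ (pushforward (mrestr leb mD) Q : {measure set mR -> \bar R}) _).
have m1 : (mm setT < +oo)%E.
  rewrite E /pushforward; apply: le_lt_trans hD; rewrite /mrestr.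
  by apply: le_measure; rewrite ?inE //; rewrite preimage_setT setTI.
exists (mfrestr (@measurableT _ mR) m1).
by apply/funext => A; rewrite -E; change (mm (A `&` setT) = mm A); rewrite setIT.
Qed.

Lemma integral_mrestr (D : set mR) (mD : measurable D) (f : mR -> \bar R) :
  (mrestr leb mD).-integrable setT f ->
  (\int[mrestr leb mD]_u f u = \int[leb]_(u in D) f u)%E.
Proof.
move=> If; have mDC : measurable (~` D) by exact: measurableC.
rewrite (negligible_integral mDC _ If) //; last by rewrite /= /mrestr setICl measure0.
rewrite setTD setCK; apply: eq_measure_integral => A mA AD.
by rewrite /= /mrestr; congr (leb _); apply: setIidl.
Qed.

(** The value 0 of the profile stands for the location +oo, where the kernel
   vanishes: the image measure is taken on the set where the profile is positive,
   and its mass may be smaller than c. *)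
Lemma profile_stieltjes c psi : 0 <= c -> profile psi ->
  exists nu : {finite_measure set mR -> \bar R},
    [/\ nu (`]-oo, (0 : R)[%classic : set R) = 0%E, (nu setT <= c%:E)%E &
    forall z : C, 0 < cIm z -> stieltjes nu z = profile_int c psi z].
Proof.
move=> c0 hp; have mp := profile_measurable hp.
pose Q : mR -> mR := fun u => (psi u) `^ (-1) - 1.
have QE u : Q u = (psi u)^-1 - 1.
  by rewrite /Q powR_inv1 //; have /andP[] := hp.2 u.
have mQ : measurable_fun [set: mR] Q.
  apply: measurable_funB => //.
  exact: (measurableT_comp (measurable_powR (-1)) mp).
have mP : measurable ([set u | 0 < psi u] : set mR).
  have -> : [set u | 0 < psi u] = setT `&` psi @^-1` `]0, +oo[%classic.
    by apply/seteqP; split => u /=; rewrite in_itv /= andbT => // -[].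
  by apply: mp => //; exact: measurable_itv.
pose D : set mR := `[0, c[%classic `&` [set u | 0 < psi u].
have mI : measurable (`[0, c[%classic : set mR) by exact: measurable_itv.
have mD : measurable D by exact: measurableI.
have lebD : (leb D <= c%:E)%E.
  have h : (leb (`[0%R, c[%classic : set mR) <= c%:E)%E.
    rewrite /= lebesgue_measure_itv /= lte_fin; case: ifP => _.
      by rewrite -EFinB subr0.
    by rewrite lee_fin.
  apply: le_trans h; apply: le_measure; rewrite ?inE //.
  by move=> u [].
have [nu E] := finite_pushforward mQ mD (le_lt_trans lebD (ltry _)).
exists nu; split.
- rewrite E /pushforward /mrestr.
  have -> : Q @^-1` `]-oo, 0[%classic `&` D = set0.
    apply/seteqP; split => // u /= [h [_ pu]]; move: h; rewrite in_itv /= QE.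
    have /andP[_ p1] := hp.2 u.
    by rewrite subr_lt0 invf_lt1 // ltNge p1.
  exact: measure0.
- by rewrite E /pushforward /mrestr preimage_setT setTI.
have key (h : mR -> R) (kk : R -> R) M : measurable_fun [set: mR] h ->
    (forall t, `|h t| <= M) -> (forall u, 0 < psi u -> h (Q u) = kk u) ->
    (forall u, psi u = 0 -> kk u = 0) ->
    \int[nu]_t h t = \int[leb]_(u in `[0, c[%classic) kk u.
  move=> mh hM h1 h2; rewrite /Rintegral; congr fine.
  have Ih : (mrestr leb mD).-integrable setT (EFin \o (fun u => h (Q u))).
    have hc : (mrestr leb mD setT <= c%:E)%E by rewrite /mrestr setTI.
    apply: (bounded_integrable hc _ (fun u => hM (Q u))).
    exact: (measurableT_comp mh mQ).
  have mh' : measurable_fun [set: mR] (EFin \o h) by exact/measurable_EFinP.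
  have E1 := integral_pushforward mQ mh' Ih measurableT.
  refine (etrans _ (etrans E1 _)).
    by apply: eq_measure_integral => A _ _; exact: (congr1 (fun g => g A) E).
  rewrite preimage_setT integral_mrestr // integral_mkcondr.
  apply: eq_integral => u _; rewrite /patch /=; case: ifPn; rewrite ?inE ?notin_setE /=.
    by move=> pu; rewrite h1.
  move=> /negP; rewrite -leNgt => pu; rewrite h2 //.
  by apply/eqP; rewrite eq_le pu; have /andP[] := hp.2 u.
move=> z z0; have [k1 k2] := kernel_cmeas z.
have kb t : cabs ((t : R)%:C - z)^-1 <= (cIm z)^-1 by exact: kernel_le.
apply: eqC => /=.
  apply: (key _ _ (cIm z)^-1) => //.
  - by move=> t; apply: le_trans (kb t); exact: Re_le_cabs.
  - by move=> u pu; rewrite kernE // ?QE //; have /andP[] := hp.2 u.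
  - by move=> u ->; rewrite kern0.
apply: (key _ _ (cIm z)^-1) => //.
- by move=> t; apply: le_trans (kb t); exact: Im_le_cabs.
- by move=> u pu; rewrite kernE // ?QE //; have /andP[] := hp.2 u.
- by move=> u ->; rewrite kern0.
Qed.

Lemma ultra_cvg01 (I : Type) (U : set_system I) (UU : UltraFilter U) (x : I -> R) :
  (forall t, 0 <= x t <= 1) ->
  exists l, 0 <= l <= 1 /\ forall e, 0 < e -> U [set t | `|x t - l| <= e].
Proof.
move=> h; have PF : ProperFilter (x @ U) by exact: fmap_proper_filter.
have xU : (x @ U) `[0, 1]%classic.
  suff : U (x @^-1` `[0, 1]%classic) by [].
  by apply: filterS filterT => t _ /=; rewrite in_itv /=; exact: h.
have [l [l01 hl]] := @segment_compact R 0 1 (x @ U) PF xU.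
exists l; split; first by move: l01; rewrite /= in_itv.
move=> e e0.
have [//|hn] := in_ultra_setVsetC [set t | `|x t - l| <= e] UU.
have hx : (x @ U) (x @` (~` [set t | `|x t - l| <= e])).
  suff : U (x @^-1` (x @` (~` [set t | `|x t - l| <= e]))) by [].
  by apply: filterS hn => t ht /=; exists t.
have [y [/= [t ht ty] h2]] := hl _ _ hx (nbhsx_ballx l e e0).
by exfalso; apply: ht; rewrite /= ty distrC ltW.
Qed.

(** Selection theorem: along an ultrafilter the profiles converge pointwise, and
   Riemann sums carry the convergence over to the integrals. *)
Lemma discr_ultralimit (I : Type) (U : set_system I) (UU : UltraFilter U) c
    (f : I -> C -> C) : 0 <= c -> (forall t, is_discr c (f t)) ->
  exists nu : {finite_measure set mR -> \bar R},
    [/\ nu (`]-oo, (0 : R)[%classic : set R) = 0%E, (nu setT <= c%:E)%E &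
    forall z : C, 0 < cIm z -> vanish U (fun t => f t z - stieltjes nu z)].
Proof.
move=> c0 hf.
have /choice[psi hpsi] : forall t, exists p, profile p /\
    forall z, 0 < cIm z -> f t z = profile_int c p z.
  by move=> t; exact: is_discr_profile.
have /choice[l hl] : forall u, exists l, 0 <= l <= 1 /\
    forall e, 0 < e -> U [set t | `|psi t u - l| <= e].
  by move=> u; apply: ultra_cvg01 => t; exact: (hpsi t).1.2.
have pl : profile l.
  split; last by move=> u; exact: (hl u).1.
  move=> u v uv; apply/ler_addgt0Pr => e e0.
  have e2 : 0 < e / 2 by rewrite divr_gt0.
  have [t [/= h1 h2]] := filter_ex (filterI ((hl u).2 _ e2) ((hl v).2 _ e2)).
  have := (hpsi t).1.1 _ _ uv; move: h1 h2; rewrite !ler_norml.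
  by move=> /andP[a1 a2] /andP[b1 b2]; lra.
have [nu [n1 n2 n3]] := profile_stieltjes c0 pl.
exists nu; split=> // z z0 e e0; rewrite n3 //.
set K := (kern_lb z)^-1 ^+ 2.
have K0 : 0 <= K by rewrite exprn_ge0 // invr_ge0 ltW // kern_lb_gt0.
have b0 : 0 < e / (8 * (c * K + 1)).
  by rewrite divr_gt0 // mulr_gt0 // ltr_wpDl // mulr_ge0.
pose N := (Num.truncn (e / (8 * (c * K + 1)))^-1).+1.
have N0 : 0 < N%:R :> R by rewrite ltr0n.
pose d := c / N%:R.
have d0 : 0 <= d by rewrite divr_ge0.
have Nd : N%:R * d = c by rewrite /d mulrC divfK // gt_eqF.
have dK : 8 * (d * K) <= e.
  have h : (e / (8 * (c * K + 1)))^-1 < N%:R by rewrite truncnS_gt.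
  have : c * K + 1 <= e * N%:R / 8.
    move: h; rewrite invf_div => /ltW; rewrite ler_pdivrMr // => h.
    by rewrite ler_pdivlMr // mulrC [e * _]mulrC.
  move=> h2; rewrite /d.
  have -> : 8 * (c / N%:R * K) = (8 * (c * K)) / N%:R by ring.
  by rewrite ler_pdivrMr //; lra.
have vs : vanish U (fun t => d%:C * \sum_(k < N)
    (kern z (psi t (k%:R * d)) - kern z (l (k%:R * d)))).
  apply: vanishZ; apply: vanish_sum => k _ e' e'0.
  have K1 : 0 < K + 1 by rewrite ltr_wpDl.
  apply: filterS ((hl (k%:R * d)).2 _ (divr_gt0 e'0 K1)) => t /= ht.
  have /andP[p0 p1] := (hpsi t).1.2 (k%:R * d).
  have /andP[q0 q1] := (hl (k%:R * d)).1.
  apply: (le_trans (kern_lip z0 p0 p1 q0 q1)).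
  apply: (@le_trans _ _ ((K + 1) * `|psi t (k%:R * d) - l (k%:R * d)|)).
    by apply: ler_wpM2r => //; rewrite lerDl.
  by move: ht; rewrite ler_pdivlMr // mulrC.
have e2 : 0 < e / 2 by rewrite divr_gt0.
apply: filterS (vs _ e2) => t /= ht; rewrite (hpsi t).2 // -Nd.
have := Riemann_profile_int N (hpsi t).1 z0 d0.
have := Riemann_profile_int N pl z0 d0.
move: ht; rewrite sumrB mulrBr -/K.
set a := d%:C * _; set b := d%:C * _; set F := profile_int _ _ _; set G := profile_int _ _ _.
move=> h1 h2 h3.
have -> : G - F = (G - b) + (b - a) - (F - a) by ring.
apply: (le_trans (cabsB _ _)); have := cabsD (G - b) (b - a); lra.
Qed.

End ProfileMeasure.

(** * Existence and uniqueness for the deterministic system *)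

Section Solution.
Variable R : realType.
Local Notation C := R[i].
Local Notation mR := (measurableTypeR R).

Lemma Im_kernel_ge0 (z : C) (t : R) : 0 < cIm z -> 0 <= cIm (t%:C - z)^-1.
Proof.
by move=> z0; rewrite Im_inv ImB /= sub0r opprK divr_ge0 ?sqr_ge0 // ltW.
Qed.

Lemma Im_mul_kernel_ge0 (z : C) (t : R) : 0 < cIm z -> 0 <= t ->
  0 <= cIm (z * (t%:C - z)^-1).
Proof.
move=> z0 t0; rewrite ImM Re_inv Im_inv ReB ImB /= sub0r opprK.
have -> : cRe z * (cIm z / cabs (t%:C - z) ^+ 2) +
   cIm z * ((t - cRe z) / cabs (t%:C - z) ^+ 2) =
   t * cIm z / cabs (t%:C - z) ^+ 2 by ring.
by rewrite divr_ge0 ?sqr_ge0 // mulr_ge0 // ltW.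
Qed.

Lemma stieltjes_good (nu : {finite_measure set mR -> \bar R}) (z : C) :
  nu (`]-oo, (0 : R)[%classic : set R) = 0%E -> 0 < cIm z ->
  good z (stieltjes nu z).
Proof.
move=> h0 z0; have hnu : (nu setT <= (fine (nu setT))%:E)%E.
  by rewrite fineK // fin_num_measure.
have bk := kernel_cbounded 1 z0; have bz := cboundedZ z bk.
split; first by rewrite /=; apply: Rintegral_ge0 => t _; exact: Im_kernel_ge0.
rewrite /stieltjes -(cintegralZ hnu z bk) /=.
have mN : measurable (`]-oo, (0 : R)[%classic : set mR) by exact: measurable_itv.
rewrite /Rintegral (negligible_integral mN measurableT (cbounded_Im hnu bz) h0).
apply: fine_ge0; apply: integral_ge0 => t [_ /=].
rewrite in_itv /= => /negP; rewrite -leNgt => t0.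
by rewrite lee_fin expr1; exact: Im_mul_kernel_ge0.
Qed.

Lemma is_stieltjes_good f (z : C) : is_stieltjes_Rplus f -> 0 < cIm z -> good z (f z).
Proof. by move=> [nu h0 hf] z0; rewrite hf //; exact: stieltjes_good. Qed.

Lemma vanish_cst (I : Type) (F : set_system I) {FF : ProperFilter F} (u : C) :
  vanish F (fun=> u) -> u = 0.
Proof.
move=> h; apply: cabs_eq0; apply/eqP; rewrite eq_le cabs_ge0 andbT.
by apply/ler_addgt0Pr => e /h/filter_ex[_ /=]; rewrite add0r.
Qed.

Lemma vanish_sub (I : Type) (F G : set_system I) (u : I -> C) :
  F `<=` G -> vanish F u -> vanish G u.
Proof. by move=> FG h e e0; apply: FG; exact: h. Qed.

Variables (n p : nat) (m : 'I_n -> nat) (B : forall k, 'M[C]_(p, m k)).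
Variables (A : 'M[C]_p) (K : R).
Hypotheses (hA : nonneg_def A) (n0 : (0 < n)%N) (K0 : 0 <= K).
Hypothesis hB : forall k, gramb K (B k).

(** Height above which the system is a contraction on the vertical line of
   abscissa x. *)
Definition far (K c x : R) : R := 1 + `|x| + 8 * K ^+ 2 * c.

Lemma far_gt0 c x : 0 <= c -> 0 < far K c x.
Proof.
move=> c0; rewrite /far -addrA ltr_wpDr // addr_ge0 // mulr_ge0 //.
by rewrite mulr_ge0 ?sqr_ge0.
Qed.

Lemma cabs_far c x v : 0 <= c -> far K c x <= v -> cabs (x +i* v) <= 2 * v.
Proof.
move=> c0 h; apply: (le_trans (cabs_le_ReIm _)) => /=.
have k0 : 0 <= 8 * K ^+ 2 * c by rewrite mulr_ge0 // mulr_ge0 ?sqr_ge0.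
have v0 := lt_le_trans (far_gt0 x c0) h.
by rewrite (gtr0_norm v0) mulr_natl mulr2n lerD2r; move: h; rewrite /far; lra.
Qed.

(** On the vertical line |z| / Im z is at most 2, while (Im z)^2 is at least
   8 K^2 c. *)
Lemma det_map_contract c x v k e f : p%:R / n%:R <= c -> far K c x <= v ->
  (forall k, good (x +i* v) (e k)) -> (forall k, good (x +i* v) (f k)) ->
  cabs (det_map B A (x +i* v) (B k *m (B k) ^t*) e -
        det_map B A (x +i* v) (B k *m (B k) ^t*) f) <=
  2^-1 * (n%:R^-1 * \sum_(j < n) cabs (e j - f j)).
Proof.
move=> hc hv ge gf.
have c0 : 0 <= c by apply: le_trans hc; rewrite divr_ge0.
have v0 : 0 < v := lt_le_trans (far_gt0 x c0) hv.
apply: (le_trans (@det_map_lip _ _ _ _ B A (x +i* v) hA v0 _ K K _ _ K0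
  (gramb_opb K0 (hB k)) hB ge gf)).
apply: ler_wpM2r.
  by rewrite mulr_ge0 ?invr_ge0 // sumr_ge0 // => j _; exact: cabs_ge0.
rewrite [cIm _]/=.
have L2 : (cabs (x +i* v) / v) ^+ 2 <= 4.
  have -> : 4 = 2 ^+ 2 :> R by rewrite -natrX.
  rewrite lerXn2r ?nnegrE ?divr_ge0 ?cabs_ge0 ?(ltW v0) //.
  by rewrite ler_pdivrMr //; exact: cabs_far hv.
have v1 : 8 * K ^+ 2 * c <= v ^+ 2.
  apply: (@le_trans _ _ v).
    by apply: le_trans hv; rewrite /far lerDr addr_ge0.
  rewrite expr2 ler_peMl ?(ltW v0) //; apply: le_trans hv.
  by rewrite /far -addrA lerDl addr_ge0 // mulr_ge0 // mulr_ge0 ?sqr_ge0.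
rewrite ler_pdivrMr ?exprn_gt0 //.
apply: (@le_trans _ _ (4 * K * K * c)).
  have L0 : 0 <= (cabs (x +i* v) / v) ^+ 2 by exact: sqr_ge0.
  move: L2 L0; move: ((cabs (x +i* v) / v) ^+ 2) => L2 hL2 L0.
  rewrite -!mulrA; apply: ler_pM; rewrite ?mulr_ge0 ?divr_ge0 //.
  by apply: ler_wpM2l => //; apply: ler_wpM2l.
have -> : 4 * K * K * c = 2^-1 * (8 * K ^+ 2 * c) by field.
by apply: ler_wpM2l.
Qed.

Let Sigma k := pop_cov (B k).

Lemma det_solution_map e : det_solution Sigma A e -> forall k z, 0 < cIm z ->
  e k z = det_map B A z (B k *m (B k) ^t*) (fun j => e j z).
Proof. by move=> [_ h] k z z0; rewrite h. Qed.

Lemma half_sum0 (s : R) : 0 <= s -> s <= 2^-1 * s -> s = 0.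
Proof. by move=> s0 h; apply/eqP; rewrite eq_le s0 andbT; lra. Qed.

Lemma avg_const (a : R) : \sum_(j < n) (n%:R^-1 * a) = a.
Proof.
have n1 : n%:R != 0 :> R by rewrite pnatr_eq0 -lt0n.
by rewrite sumr_const card_ord -[LHS]mulr_natl mulrA mulfV // mul1r.
Qed.

(** The contraction settles the points far from the axis; constant sequences turn
   the descent of convergence into a statement of unique continuation. *)
Lemma det_solution_unique e e' : det_solution Sigma A e -> det_solution Sigma A e' ->
  forall k z, 0 < cIm z -> e' k z = e k z.
Proof.
move=> he he' k z z0.
have ge j w : 0 < cIm w -> good w (e j w) by apply: is_stieltjes_good; exact: he.1.
have ge' j w : 0 < cIm w -> good w (e' j w) by apply: is_stieltjes_good; exact: he'.1.
set c := p%:R / n%:R : R; have c0 : 0 <= c by rewrite divr_ge0.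
pose V := Num.max (far K c (cRe z)) (cIm z).
have eqfar v j : V <= v -> e' j (cRe z +i* v) = e j (cRe z +i* v).
  move=> hv; have fv : far K c (cRe z) <= v.
    by apply: le_trans hv; rewrite le_max lexx.
  have v0 : 0 < v := lt_le_trans (far_gt0 _ c0) fv.
  set w := cRe z +i* v.
  have hd i : cabs (e' i w - e i w) <=
      2^-1 * (n%:R^-1 * \sum_(j < n) cabs (e' j w - e j w)).
    rewrite (det_solution_map he) // (det_solution_map he') //.
    by apply: (det_map_contract (c := c)) => // l; [exact: ge'|exact: ge].
  have s0 : \sum_(j < n) cabs (e' j w - e j w) = 0.
    apply: half_sum0; first by apply: sumr_ge0 => i _; exact: cabs_ge0.
    apply: (le_trans (ler_sum _ (fun i _ => hd i))).
    by rewrite -mulr_sumr avg_const.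
  apply/eqP; rewrite -subr_eq0; apply/eqP/cabs_eq0.
  have /eqP := s0; rewrite psumr_eq0; last by move=> i _; exact: cabs_ge0.
  by move=> /allP/(_ j); rewrite mem_index_enum => /(_ isT)/eqP.
have V0 : 0 < V by rewrite lt_max z0 orbT.
have [nu h0 hf] := he.1 k; have [nu' h0' hf'] := he'.1 k.
set M := Num.max (fine (nu setT)) (fine (nu' setT)).
have hnu : (nu setT <= M%:E)%E.
  by rewrite -[leLHS]fineK ?fin_num_measure // lee_fin le_max lexx.
have hnu' : (nu' setT <= M%:E)%E.
  by rewrite -[leLHS]fineK ?fin_num_measure // lee_fin le_max lexx orbT.
have FF : Filter (\oo : set_system nat) by apply: filter_filter.
have := @stieltjes_vanish R nat \oo FF (fun=> nu' : {measure set mR -> \bar R})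
  (fun=> nu : {measure set mR -> \bar R}) M (cRe z) V V0 (fun=> hnu') (fun=> hnu).
move=> h.
apply/eqP; rewrite -subr_eq0; apply/eqP.
have zE : cRe z +i* cIm z = z by case: (z).
rewrite hf // hf' // -zE; apply: (vanish_cst (F := \oo : set_system nat)); apply: h z0 _.
  move=> d d0; exists d; split=> // e1 e10.
  have vd : 0 < V + d by rewrite addr_gt0.
  apply: filterS filterT => t _; rewrite /mkset.
  have := eqfar (V + d) k; rewrite hf // hf' // lerDl (ltW d0) => /(_ isT) ->.
  by rewrite subrr cabs0 ltW.
apply: (@le_lt_trans _ _ V); first by rewrite le_max lexx orbT.
by rewrite mulr_natl mulr2n ltrDl.
Qed.

Fixpoint iterate (t : nat) (k : 'I_n) (z : C) : C :=
  if t is t'.+1 then det_map B A z (B k *m (B k) ^t*) (fun j => iterate t' j z)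
  else 0.

(** From the first step on, the mass is independent of the number of steps. *)
Lemma iterate_discr t k :
  is_discr (n%:R^-1 * gram_tr (B k)) (iterate t.+1 k).
Proof.
suff [c hc] : exists c, forall j, is_discr (c j) (iterate t j).
  exact: (det_map_discr B (B k) hA hc).
elim: t => [|t [c hc]]; first by exists (fun=> 0) => j; exact: is_discr0.
by exists (fun j => n%:R^-1 * gram_tr (B j)) => j; exact: det_map_discr hA hc.
Qed.

Lemma iterate_good t k z : 0 < cIm z -> good z (iterate t k z).
Proof.
case: t => [|t] z0; first exact: good0.
exact: is_discr_good z0 (iterate_discr t k).
Qed.

Lemma discr_stieltjes c (f : C -> C) : 0 <= c -> is_discr c f ->
  exists nu : {finite_measure set mR -> \bar R}, (nu setT <= c%:E)%E /\
    forall z, 0 < cIm z -> f z = stieltjes nu z.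
Proof.
move=> c0 /is_discr_profile[psi [hp hf]].
have [nu [_ n2 n3]] := profile_stieltjes c0 hp.
by exists nu; split=> // z z0; rewrite n3 // hf.
Qed.

Lemma vanish_halving (u : nat -> C) (D : R) :
  (forall t, cabs (u t) <= 2^-1 ^+ t * D) -> vanish \oo u.
Proof.
move=> hu e e0.
have rho : Num.norm (2^-1 : R) < 1 by rewrite ger0_norm ?invr_ge0 // invf_lt1 // ltr1n.
have := cvg_geometric D rho => /cvgrPdist_le /(_ e e0).
apply: filterS => t; rewrite sub0r normrN /geometric /= => h.
by apply: (le_trans (hu t)); apply: le_trans h; rewrite mulrC; exact: ler_norm.
Qed.

(** Geometric convergence holds far from the axis only; the uniform bound on the
   masses carries the vanishing of the differences down to z. *)
Lemma iterate_vanish k z : 0 < cIm z ->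
  vanish \oo (fun t => iterate t.+2 k z - iterate t.+1 k z).
Proof.
move=> z0; set cm := n%:R^-1 * gram_tr (B k).
have cm0 : 0 <= cm by rewrite mulr_ge0 ?invr_ge0 // gram_tr_ge0.
have /choice[nu hnu] : forall t, exists nu : {finite_measure set mR -> \bar R},
    (nu setT <= cm%:E)%E /\ forall z, 0 < cIm z -> iterate t.+1 k z = stieltjes nu z.
  by move=> t; apply: discr_stieltjes => //; exact: iterate_discr.
set c := p%:R / n%:R : R; have c0 : 0 <= c by rewrite divr_ge0.
pose V := Num.max (far K c (cRe z)) (cIm z).
have V0 : 0 < V by rewrite lt_max z0 orbT.
have farv v : V <= v ->
    vanish \oo (fun t => iterate t.+2 k (cRe z +i* v) - iterate t.+1 k (cRe z +i* v)).
  move=> hv; have fv : far K c (cRe z) <= v.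
    by apply: le_trans hv; rewrite le_max lexx.
  have v0 : 0 < v := lt_le_trans (far_gt0 _ c0) fv.
  set w := cRe z +i* v.
  pose D t := n%:R^-1 * \sum_(j < n) cabs (iterate t.+1 j w - iterate t j w).
  have hD t j : cabs (iterate t.+2 j w - iterate t.+1 j w) <= 2^-1 * D t.
    apply: (@det_map_contract c (cRe z) v j (fun i => iterate t.+1 i w)
      (fun i => iterate t i w)) => // l; exact: iterate_good.
  have DD t : D t <= 2^-1 ^+ t * D 0%N.
    elim: t => [|t IH]; first by rewrite expr0 mul1r.
    rewrite exprS -mulrA; apply: (@le_trans _ _ (2^-1 * D t)).
      rewrite /D -[leRHS]avg_const -mulr_sumr.
      apply: ler_wpM2l; first by rewrite invr_ge0.
      by apply: ler_sum => j _; exact: hD.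
    by apply: ler_wpM2l.
  apply: (vanish_halving (D := 2^-1 * D 0%N)) => t.
  apply: (le_trans (hD t k)); rewrite [leRHS]mulrCA.
  by apply: ler_wpM2l.
have FF : Filter (\oo : set_system nat) by apply: filter_filter.
have := @stieltjes_vanish R nat \oo FF (fun t => nu t.+1 : {measure set mR -> \bar R})
  (fun t => nu t : {measure set mR -> \bar R}) cm (cRe z) V V0
  (fun t => (hnu t.+1).1) (fun t => (hnu t).1).
move=> h.
have zE : cRe z +i* cIm z = z by case: (z).
rewrite -zE; apply: (vanish_le (M := 1)
  (v := fun t => stieltjes (nu t.+1) (cRe z +i* cIm z) - stieltjes (nu t) (cRe z +i* cIm z))).
  by move=> t; rewrite !(hnu _).2 // mul1r.
apply: h z0 _.
  move=> d d0; exists d; split=> //.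
  apply: (vanish_le (M := 1)) (farv (V + d) _); last by rewrite lerDl ltW.
  by move=> t; rewrite !(hnu _).2 ?mul1r //= addr_gt0.
apply: (@le_lt_trans _ _ V); first by rewrite le_max lexx orbT.
by rewrite mulr_natl mulr2n ltrDl.
Qed.

(** The limit along an ultrafilter of the iterates.  The last clause also represents
   the trace functionals of the deterministic resolvent, with a control on the
   mass. *)
Lemma det_solution_exists : exists e, det_solution Sigma A e /\
  forall m' (B' : 'M[C]_(p, m')), exists nu : {finite_measure set mR -> \bar R},
    (nu setT <= (n%:R^-1 * gram_tr B')%:E)%E /\
    forall z, 0 < cIm z ->
      det_map B A z (B' *m B' ^t*) (fun j => e j z) = stieltjes nu z.
Proof.
have [U [UU hU]] := ultraFilterLemma (F := \oo : set_system nat) _.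
have fU : Filter U by apply: filter_filter.
have mass0 m' (B' : 'M[C]_(p, m')) : 0 <= n%:R^-1 * gram_tr B'.
  by rewrite mulr_ge0 ?invr_ge0 // gram_tr_ge0.
have /choice[nu hnu] : forall k, exists nu : {finite_measure set mR -> \bar R},
    [/\ nu (`]-oo, (0 : R)[%classic : set R) = 0%E,
    (nu setT <= (n%:R^-1 * gram_tr (B k))%:E)%E &
    forall z : C, 0 < cIm z -> vanish U (fun t => iterate t.+1 k z - stieltjes nu z)].
  move=> k; apply: (discr_ultralimit UU (f := fun t => iterate t.+1 k)) => // t.
  exact: iterate_discr.
pose e k z := stieltjes (nu k) z.
have ge k z : 0 < cIm z -> good z (e k z).
  by move=> z0; have [h _ _] := hnu k; exact: stieltjes_good.
have lim m' (B' : 'M[C]_(p, m')) z : 0 < cIm z ->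
    vanish U (fun t => det_map B A z (B' *m B' ^t*) (fun j => iterate t.+1 j z) -
                       det_map B A z (B' *m B' ^t*) (fun j => e j z)).
  move=> z0.
  have [q q0 hq] := opb_exists (B' *m B' ^t*).
  have hs : vanish U (fun t =>
      \sum_(j < n) (cabs (iterate t.+1 j z - e j z))%:C).
    apply: vanish_sum => j _; have [_ _ h] := hnu j.
    apply: (vanish_le (M := 1)) (h z z0) => t.
    by rewrite cabsR ger0_norm ?cabs_ge0 // mul1r.
  apply: vanish_le hs => t.
  apply: (le_trans (@det_map_lip _ _ _ _ B A z hA z0 _ q K _ _ q0 hq hB
    (fun k => iterate_good t.+1 k z0) (fun k => ge k z z0))).
  rewrite -rmorph_sum cabsR ger0_norm; last first.
    by apply: sumr_ge0 => j _; exact: cabs_ge0.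
  by rewrite [leLHS]mulrA.
exists e; split; first split.
- by move=> k; have [h _ _] := hnu k; exists (nu k).
- move=> k z z0; have [_ _ h] := hnu k.
  apply/eqP; rewrite -subr_eq0; apply/eqP.
  apply: (vanish_cst (F := U)).
  have := vanishD (vanishZ (-1) (h z z0)) (vanishD
     (vanishZ (-1) (vanish_sub hU (iterate_vanish k z0))) (lim _ (B k) z z0)).
  move=> /(_ fU fU fU fU) hv; apply: (vanish_le (M := 1) _ hv) => t; rewrite mul1r.
  have -> : iterate t.+2 k z = det_map B A z (B k *m (B k) ^t*)
    (fun j => iterate t.+1 j z) by [].
  have -> : det_resolvent Sigma A e z = invmx (det_mx B A z (fun j => e j z)) by [].
  rewrite -/(det_map B A z (Sigma k) (fun j => e j z)).
  set u := det_map _ _ _ _ _; set v := det_map _ _ _ _ _.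
  have -> : e k z - u = -1 * (iterate t.+1 k z - e k z) +
    (-1 * (v - iterate t.+1 k z) + (v - u)) by ring.
  exact: lexx.
move=> m' B'.
have [nu' [_ h2 h3]] := discr_ultralimit UU (mass0 _ B')
  (fun t => det_map_discr B B' hA (iterate_discr t)).
exists nu'; split=> // z z0.
apply/eqP; rewrite -subr_eq0; apply/eqP; apply: (vanish_cst (F := U)).
have := vanishD (h3 z z0) (vanishZ (-1) (lim _ B' z z0)).
move=> /(_ fU fU) hv; apply: (vanish_le (M := 1) _ hv) => t; rewrite mul1r.
have rg (a b v : C) : a - b = v - b + -1 * (v - a) by ring.
by rewrite [X in cabs X <= _](rg _ _ (det_map B A z (B' *m B' ^t*)
  (fun j => iterate t.+1 j z))).
Qed.

End Solution.

(** * The Stieltjes transform of an empirical spectral distribution *)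

Section EmpiricalSpectral.
Variable R : realType.
Local Notation C := R[i].
Local Notation mR := (measurableTypeR R).

Section Esd.
Variables (p : nat) (A : 'M[C]_p).

Let loc (k : nat) : mR := oapp (eigval A) 0 (insub k).

Let locE (k : 'I_p) : loc k = eigval A k.
Proof. by rewrite /loc valK. Qed.

Let pV0 : 0 <= p%:R^-1 :> R.
Proof. by rewrite invr_ge0. Qed.

Let pV : {nonneg R} := NngNum pV0.

Let atoms : {measure set mR -> \bar R} :=
  mscale pV (msum (fun k => dirac (loc k) : {measure set mR -> \bar R}) p).

(** The two measures agree on half-open intervals. *)
Lemma esd_atoms (X : set mR) : measurable X ->
  lebesgue_stieltjes_measure (esd A) X = atoms X.
Proof.
apply: lebesgue_stieltjes_measure_unique => Y hY.
have -> : lebesgue_stieltjes_measure (esd A) Y = wlength (esd A) Y.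
  by rewrite /lebesgue_stieltjes_measure /measure_extension measurable_mu_extE.
case/ocitvP : hY => [->|[[a b] /= ab ->]]; first by rewrite !measure0.
rewrite wlength_itv_bnd ?ltW // /atoms /= /mscale /= /msum.
rewrite /esd -mulrBr -sumrB.
rewrite (eq_bigr (fun k : 'I_p =>
  ((eigval A k <= b)%R%:R - (eigval A k <= a)%R%:R : R)%:E)).
  by rewrite sumEFin -EFinM.
move=> k _; rewrite locE /= diracE; congr (_ %:E).
have -> : (eigval A k \in (`]a, b]%classic : set mR)) = (a < eigval A k) && (eigval A k <= b).
  by apply/idP/idP; rewrite inE /= in_itv.
have [h|h] := leP (eigval A k) a; last by rewrite subr0.
by rewrite (le_trans h (ltW ab)) subrr.
Qed.

Lemma Rintegral_esd (g : mR -> R) : measurable_fun setT g ->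
  \int[lebesgue_stieltjes_measure (esd A)]_t g t = p%:R^-1 * \sum_j g (eigval A j).
Proof.
move=> mg.
have H (h : mR -> R) : measurable_fun setT h -> (forall t, 0 <= h t) ->
    (\int[lebesgue_stieltjes_measure (esd A)]_t (h t)%:E =
      (p%:R^-1 * \sum_j h (eigval A j))%:E)%E.
  move=> mh h0; rewrite (@eq_measure_integral _ _ _ _ atoms); last first.
    by move=> X mX _; exact: esd_atoms.
  have mh' : measurable_fun setT (EFin \o h) by exact/measurable_EFinP.
  rewrite ge0_integral_mscale //; last by move=> t _; rewrite lee_fin.
  rewrite ge0_integral_measure_sum //; last by move=> t _; rewrite lee_fin.
  rewrite (eq_bigr (fun k : 'I_p => (h (eigval A k))%:E)).
    by rewrite sumEFin -EFinM.
  by move=> k _; rewrite integral_dirac //= diracT mul1e -locE.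
rewrite /Rintegral integralE.
rewrite (@eq_integral _ _ _ _ _ (fun t => (Num.max (g t) 0)%:E)); last first.
  by move=> t _; rewrite funeposE /= EFin_max.
rewrite [X in (_ - X)%E](@eq_integral _ _ _ _ _ (fun t => (Num.max (- g t) 0)%:E)); last first.
  by move=> t _; rewrite funenegE /= EFin_max EFinN.
have ge0 (h : mR -> R) t : 0 <= Num.max (h t) 0 by rewrite le_max lexx orbT.
have mP : measurable_fun setT (fun t => Num.max (g t) 0) by exact: measurable_maxr.
have mN : measurable_fun setT (fun t => Num.max (- g t) 0).
  by apply: measurable_maxr => //; exact: measurableT_comp.
rewrite (H _ mP (ge0 g)) (H _ mN (ge0 (fun t => - g t))).
rewrite -EFinB /= -mulrBr -sumrB; congr (_ * _); apply: eq_bigr => j _.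
have [h|h] := leP (g (eigval A j)) 0.
  by rewrite max_l ?oppr_ge0 // sub0r opprK.
by rewrite max_r ?subr0 // oppr_le0 ltW.
Qed.

Lemma stieltjes_esdE (z : C) : nonneg_def A -> 0 < cIm z ->
  stieltjes_esd A z = p%:R^-1 * \tr (invmx (A - z%:M)).
Proof.
move=> hA z0; rewrite mxtrace_resolvent // natVC.
have [k1 k2] := kernel_cmeas z.
apply: eqC; rewrite ?ReZ ?ImZ /stieltjes_esd /stieltjes /cintegral /=.
  by rewrite Rintegral_esd // Re_sum.
by rewrite Rintegral_esd // Im_sum.
Qed.

End Esd.

End EmpiricalSpectral.

(** * Independent families: exchange of copies *)

Section SameLaw.
Context d1 d2 d (T1 : measurableType d1) (T2 : measurableType d2) (U : measurableType d).
Variables (R : realType) (P1 : {measure set T1 -> \bar R}) (P2 : {measure set T2 -> \bar R}).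
Variables (Y1 : T1 -> U) (Y2 : T2 -> U).
Hypotheses (mY1 : measurable_fun setT Y1) (mY2 : measurable_fun setT Y2).
Hypothesis hP : forall D : set U, measurable D -> P1 (Y1 @^-1` D) = P2 (Y2 @^-1` D).

Lemma same_law_ge0_integral (g : U -> \bar R) : measurable_fun setT g ->
  (forall x, 0 <= g x)%E -> (\int[P1]_w g (Y1 w) = \int[P2]_w g (Y2 w))%E.
Proof.
move=> mg g0.
have E1 := @ge0_integral_pushforward _ _ _ _ _ _ mY1 P1 setT g measurableT mg (fun x _ => g0 x).
have E2 := @ge0_integral_pushforward _ _ _ _ _ _ mY2 P2 setT g measurableT mg (fun x _ => g0 x).
rewrite preimage_setT in E1; rewrite preimage_setT in E2.
rewrite -[LHS]E1 -[RHS]E2; apply: eq_measure_integral => D mD _.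
exact: hP.
Qed.

Lemma same_law_Rintegral (h : U -> R) : measurable_fun setT h ->
  \int[P1]_w h (Y1 w) = \int[P2]_w h (Y2 w).
Proof.
move=> mh; rewrite /Rintegral; congr fine.
have mh' : measurable_fun setT (EFin \o h) by exact/measurable_EFinP.
have pos := same_law_ge0_integral (measurable_funepos mh') (funepos_ge0 _).
have neg := same_law_ge0_integral (measurable_funeneg mh') (funeneg_ge0 _).
rewrite integralE [in RHS]integralE; congr (_ - _)%E.
  transitivity (\int[P1]_w ((EFin \o h)^\+ (Y1 w)))%E.
    by apply: eq_integral => w _; rewrite !funeposE.
  by rewrite pos; apply: eq_integral => w _; rewrite !funeposE.
transitivity (\int[P1]_w ((EFin \o h)^\- (Y1 w)))%E.
  by apply: eq_integral => w _; rewrite !funenegE.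
by rewrite neg; apply: eq_integral => w _; rewrite !funenegE.
Qed.

End SameLaw.

Section Families.
Variables (I : choiceType) (R : realType).
Local Notation V := (R * R)%type.

(** Only finitely many coordinates are constrained, as in the definition of an
   independent family. *)
Definition cylinder : set (set (I -> V)) := [set E | exists (J : {fset I}) (D : I -> set V),
  (forall i, measurable (D i)) /\ E = [set x | forall i, i \in J -> D i (x i)]].

Definition famT := g_sigma_algebraType cylinder.

Lemma cylinderI : setI_closed cylinder.
Proof.
move=> E1 E2 [J1 [D1 [m1 ->]]] [J2 [D2 [m2 ->]]].
exists (J1 `|` J2)%fset, (fun i => (if i \in J1 then D1 i else setT) `&`
  (if i \in J2 then D2 i else setT)); split.
  by move=> i; apply: measurableI; case: ifP.
apply/seteqP; split => x /=.
  by move=> [h1 h2] i _; split; case: ifP => // h; [exact: h1|exact: h2].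
move=> h; split => i hi.
  by have := h i; rewrite in_fsetU hi /= => /(_ isT)[].
by have := h i; rewrite in_fsetU hi orbT => /(_ isT)[].
Qed.

Lemma cylinder_setT : cylinder setT.
Proof.
exists fset0, (fun=> setT); split; first by move=> i.
by apply/seteqP; split => x.
Qed.

Lemma proj_measurable i : measurable_fun setT (fun x : famT => x i).
Proof.
move=> _ D mD; rewrite setTI; apply: sub_sigma_algebra.
exists [fset i]%fset, (fun j => if j == i then D else setT); split.
  by move=> j; case: ifP.
apply/seteqP; split => x /=.
  by move=> hx j; rewrite in_fset1 => /eqP ->; rewrite eqxx.
by move=> /(_ i); rewrite in_fset1 eqxx => /(_ isT).
Qed.

Lemma fam_measurable d (W : measurableType d) (X : W -> famT) :
  (forall i, measurable_fun setT (fun w => X w i)) -> measurable_fun setT X.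
Proof.
move=> hX; apply: (@measurability _ _ _ famT setT X cylinder) => // _ [_ [J [D [mD ->]]] <-].
have -> : X @^-1` [set x | forall i, i \in J -> D i (x i)] =
   \bigcap_(i in [set` J]) ((fun w => X w i) @^-1` D i).
  by apply/seteqP; split => w /= h i; exact: h.
rewrite setTI; apply: fin_bigcap_measurable; first exact: finite_fset.
by move=> i _; rewrite -[X in measurable X]setTI; exact: hX.
Qed.

Lemma pushforward_ex d d' (T1 : measurableType d) (T2 : measurableType d')
    (P : {measure set T1 -> \bar R}) (X : T1 -> T2) : measurable_fun setT X ->
  exists m : {measure set T2 -> \bar R}, (m : set T2 -> \bar R) = pushforward P X.
Proof.
move=> mX.
by unshelve refine (ex_intro _ (pushforward P X : {measure set T2 -> \bar R}) _).
Qed.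

(** Cylinders are stable under intersection and generate the sigma-algebra. *)
Lemma same_law d d' (T1 : measurableType d) (T2 : measurableType d')
    (P1 : {measure set T1 -> \bar R}) (P2 : {measure set T2 -> \bar R})
    (X1 : T1 -> famT) (X2 : T2 -> famT) :
  measurable_fun setT X1 -> measurable_fun setT X2 -> (P1 setT < +oo)%E ->
  (forall (J : {fset I}) (D : I -> set V), (forall i, measurable (D i)) ->
    P1 [set w | forall i, i \in J -> D i (X1 w i)] =
    P2 [set w | forall i, i \in J -> D i (X2 w i)]) ->
  forall A : set famT, measurable A -> P1 (X1 @^-1` A) = P2 (X2 @^-1` A).
Proof.
move=> mX1 mX2 fin hP A mA.
have [m1 E1] := pushforward_ex P1 mX1; have [m2 E2] := pushforward_ex P2 mX2.
have -> : P1 (X1 @^-1` A) = m1 A by rewrite E1.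
have -> : P2 (X2 @^-1` A) = m2 A by rewrite E2.
apply: (@measure_unique _ R famT cylinder (fun=> setT)) => //.
- exact: cylinderI.
- by move=> _; exact: cylinder_setT.
- by rewrite bigcup_const.
- by move=> _ [J [D [mD ->]]]; rewrite E1 E2; exact: hP.
- by move=> _; rewrite E1 /pushforward preimage_setT.
Qed.

End Families.

Section Copies.
Context d (T : measurableType d) (R : realType) (P : probability T R).
Variables (I : choiceType) (X : I -> T -> R[i]).
Hypotheses (mX : forall i, complex_rv (X i)) (iX : independent P X).
Local Notation V := (R * R)%type.
Local Notation PP := (P \x P)%E.

(** Two independent copies of the family, the members selected by S being
   exchanged between the copies. *)
Definition copies (S : pred I) (w : T * T) (bi : bool * I) : V :=
  cpair (X bi.2 (if bi.1 == S bi.2 then w.1 else w.2)).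

Lemma copies_measurable S : measurable_fun setT (copies S : T * T -> famT (bool * I)%type R).
Proof.
apply: fam_measurable => -[b i]; rewrite /copies /=.
by case: (b == S i); apply: (measurableT_comp (mX i)).
Qed.

Lemma PP_setT : PP setT = 1%E.
Proof.
rewrite -setXTT; transitivity (P setT * P setT)%E; first exact: product_measure1E.
by rewrite probability_setT mule1.
Qed.

Lemma copies_cylinder S (J : {fset bool * I}) (D : bool * I -> set V) :
  (forall c, measurable (D c)) ->
  PP [set w | forall c, c \in J -> D c (copies S w c)] =
  (\prod_(i <- [fset c.2 | c in J]%fset)
     (P ((@cpair R \o X i) @^-1` (if (true, i) \in J then D (true, i) else setT)) *
      P ((@cpair R \o X i) @^-1` (if (false, i) \in J then D (false, i) else setT))))%E.
Proof.
move=> mD; pose D' c := if c \in J then D c else setT.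
have mD' c : measurable (D' c) by rewrite /D'; case: ifP.
set J2 := [fset c.2 | c in J]%fset.
pose E b := \bigcap_(i in [set` J2]) (@cpair R \o X i) @^-1` D' (b == S i, i).
have -> : [set w | forall c, c \in J -> D c (copies S w c)] = E true `*` E false.
  apply/seteqP; split => -[w w'] /=.
    move=> h; split => i /= hi; rewrite /D' /=.
      case: ifP => // hc; have := h _ hc; rewrite /copies /=.
      by case: (S i).
    case: ifP => // hc; have := h _ hc; rewrite /copies /=.
    by case: (S i).
  move=> [h1 h2] [b i] hc; rewrite /copies /=.
  have hi : i \in J2 by apply/imfsetP; exists (b, i).
  move: (h1 i hi) (h2 i hi); rewrite /D' /=.
  by case: (S i); case: b hc => /= hc; rewrite hc.
have mE b : measurable (E b).
  apply: fin_bigcap_measurable; first exact: finite_fset.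
  by move=> i _; rewrite -[X in measurable X]setTI; apply: mX.
transitivity (P (E true) * P (E false))%E; first exact: product_measure1E.
have PE b : P (E b) = (\prod_(i <- J2) P ((@cpair R \o X i) @^-1` D' (b == S i, i)))%E.
  by apply: (@iX J2 (fun i => D' (b == S i, i))) => i _; exact: mD'.
rewrite !PE -big_split /=; apply: eq_bigr => i _.
by case: (S i) => //=; rewrite muleC.
Qed.

(** Both sides are the same product of marginal laws on cylinders: exchanging two
   independent copies of a variable leaves the joint law unchanged. *)
Lemma copies_law S (A : set (famT (bool * I)%type R)) : measurable A ->
  PP (copies S @^-1` A) = PP (copies xpred0 @^-1` A).
Proof.
apply: same_law; [exact: copies_measurable|exact: copies_measurable| |].
  have /eqP := PP_setT; rewrite eq_le => /andP[h _].
  exact: le_lt_trans h (ltry _).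
move=> J D mD.
exact: etrans (copies_cylinder S J mD) (esym (copies_cylinder xpred0 J mD)).
Qed.

Definition fam (w : T) (i : I) : V := cpair (X i w).

Definition mix (S : pred I) (w : T * T) (i : I) : V :=
  cpair (X i (if S i then w.2 else w.1)).

Lemma fam_measurable_fun : measurable_fun setT (fam : T -> famT I R).
Proof. by apply: fam_measurable => i; exact: mX. Qed.

Lemma mix_measurable S : measurable_fun setT (mix S : T * T -> famT I R).
Proof.
apply: fam_measurable => i; rewrite /mix.
by case: (S i); apply: (measurableT_comp (mX i)).
Qed.

Definition select (S : pred I) (y : famT (bool * I)%type R) : famT I R :=
  fun i => y (S i, i).

Lemma select_measurable S : measurable_fun setT (select S).
Proof. by apply: fam_measurable => i; exact: proj_measurable. Qed.

Lemma select_copies S S' w : select S' (copies S w) = mix (fun i => S' i (+) S i) w.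
Proof.
apply/funext => i; rewrite /select /copies /mix /=.
by case: (S' i); case: (S i).
Qed.

(** Choosing each member from either of the two copies does not change the law of
   the family. *)
Lemma mix_law (S : pred I) (g : famT I R -> \bar R) :
  measurable_fun setT g -> (forall x, 0 <= g x)%E ->
  (\int[PP]_w g (mix S w) = \int[P]_w g (fam w))%E.
Proof.
move=> mg g0.
have mfst := select_measurable xpred0.
have E1 : (\int[PP]_w g (mix S w) = \int[PP]_w g (fam w.1))%E.
  have mg' : measurable_fun setT (g \o select xpred0) by exact: measurableT_comp.
  have := same_law_ge0_integral (copies_measurable S) (copies_measurable xpred0)
    (@copies_law S) mg' (fun x => g0 _).
  under eq_integral do rewrite /= select_copies.
  by under [in RHS]eq_integral do rewrite /= select_copies.
rewrite E1.
have m1 : measurable_fun setT (fun w : T * T => g (fam w.1)).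
  by apply: (measurableT_comp (measurableT_comp mg fam_measurable_fun)).
rewrite (@fubini_tonelli1 _ _ _ _ _ P P _ m1 (fun x => g0 _)) /fubini_F /=.
apply: eq_integral => w _; rewrite integral_cst // [X in (_ * X)%E](_ : _ = 1%E) ?mule1 //.
exact: probability_setT.
Qed.

(** Tonelli on the product space, where the family may be replaced by a mixture
   of two independent copies. *)
Lemma decoupling (S : pred I) (g : famT I R -> \bar R) :
  measurable_fun setT g -> (forall x, 0 <= g x)%E ->
  (\int[P]_w g (fam w) = \int[P]_w \int[P]_w' g (mix S (w, w')))%E.
Proof.
move=> mg g0; rewrite -(mix_law S mg g0).
have mS : measurable_fun setT (g \o mix S) := measurableT_comp mg (mix_measurable S).
by rewrite (@fubini_tonelli1 _ _ _ _ _ P P (g \o mix S) mS (fun x => g0 _)).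
Qed.

End Copies.

(** * The Efron-Stein inequality *)

Lemma sqr_sum2_le (R : realType) (a b : R) : (a + b) ^+ 2 <= 2 * (a ^+ 2 + b ^+ 2).
Proof. by have := sqr_ge0 (a - b); rewrite sqrrB sqrrD; lra. Qed.

Section EfronStein.
Context d (T : measurableType d) (R : realType) (P : probability T R).
Variable X : nat * nat -> T -> R[i].
Hypotheses (mX : forall i, complex_rv (X i)) (iX : independent P X).
Local Notation C := R[i].
Local Notation V := (R * R)%type.
Local Notation PP := (P \x P)%E.
Local Notation I := (nat * nat)%type.
Local Notation W := (famT I R).

Let PP1 : (PP setT <= 1%:E)%E.
Proof. by have /eqP := PP_setT P; rewrite eq_le => /andP[]. Qed.

Let bm (h : T * T -> R) := measurable_fun setT h /\ exists M, forall w, `|h w| <= M.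

Let bmD h1 h2 : bm h1 -> bm h2 -> bm (fun w => h1 w + h2 w).
Proof.
move=> [m1 [M1 b1]] [m2 [M2 b2]]; split; first exact: measurable_funD.
by exists (M1 + M2) => w; apply: (le_trans (ler_normD _ _)); exact: lerD.
Qed.

Let bmM h1 h2 : bm h1 -> bm h2 -> bm (fun w => h1 w * h2 w).
Proof.
move=> [m1 [M1 b1]] [m2 [M2 b2]]; split; first exact: measurable_funM.
by exists (M1 * M2) => w; rewrite normrM ler_pM.
Qed.

Let bmZ a h : bm h -> bm (fun w => a * h w).
Proof.
by apply: bmM; split; [exact: measurable_cst|exists `|a| => w].
Qed.

Let bmB h1 h2 : bm h1 -> bm h2 -> bm (fun w => h1 w - h2 w).
Proof.
move=> b1 b2; have := bmD b1 (bmZ (-1) b2).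
by under eq_fun do rewrite mulN1r.
Qed.

Let bm_int h : bm h -> PP.-integrable setT (EFin \o h).
Proof. by move=> [mh [M hM]]; have := bounded_integrable PP1 mh hM. Qed.

Let Ex (h : T * T -> R) : R := \int[PP]_w h w.

Let ExD h1 h2 : bm h1 -> bm h2 -> Ex (fun w => h1 w + h2 w) = Ex h1 + Ex h2.
Proof. by move=> /bm_int b1 /bm_int b2; exact: RintegralD. Qed.

Let ExB h1 h2 : bm h1 -> bm h2 -> Ex (fun w => h1 w - h2 w) = Ex h1 - Ex h2.
Proof. by move=> /bm_int b1 /bm_int b2; exact: RintegralB. Qed.

Let ExZ a h : bm h -> Ex (fun w => a * h w) = a * Ex h.
Proof. by move=> /bm_int b; exact: RintegralZl. Qed.

Let le_Ex h1 h2 : bm h1 -> bm h2 -> (forall w, h1 w <= h2 w) -> Ex h1 <= Ex h2.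
Proof. by move=> /bm_int b1 /bm_int b2 h; apply: le_Rintegral. Qed.

Let Ex_sum n (h : nat -> T * T -> R) : (forall k, bm (h k)) ->
  Ex (fun w => \sum_(k < n) h k w) = \sum_(k < n) Ex (h k) /\
  bm (fun w => \sum_(k < n) h k w).
Proof.
move=> bh; elim: n => [|n [IH1 IH2]].
  have E : (fun w => \sum_(k < 0) h k w) = (fun=> 0) by apply/funext => w; rewrite big_ord0.
  rewrite E big_ord0; split; first by rewrite /Ex /Rintegral integral0.
  by split; [exact: measurable_cst|exists 0 => w; rewrite normr0].
have E : (fun w => \sum_(k < n.+1) h k w) = (fun w => \sum_(k < n) h k w + h n w).
  by apply/funext => w; rewrite big_ord_recr.
by rewrite E big_ord_recr /= ExD // IH1; split => //; exact: bmD.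
Qed.

Let copies_Ex S (h : famT (bool * I)%type R -> R) M : measurable_fun setT h ->
  (forall y, `|h y| <= M) ->
  Ex (fun w => h (copies X S w)) = Ex (fun w => h (copies X xpred0 w)).
Proof.
move=> mh hM; rewrite /Ex /Rintegral; congr fine.
have mh' : measurable_fun setT (EFin \o h) by exact/measurable_EFinP.
have key S' : (\int[PP]_w (h (copies X S' w))%:E =
    \int[pushforward PP (copies X S' : T * T -> famT (bool * I)%type R)]_y (h y)%:E)%E.
  have mS := copies_measurable mX S'.
  have Ih : PP.-integrable ((copies X S' : T * T -> famT (bool * I)%type R) @^-1` setT)
      ((EFin \o h) \o copies X S').
    rewrite preimage_setT.
    by have := bounded_integrable PP1 (measurableT_comp mh mS) (fun w => hM _).
  by have := integral_pushforward mS mh' Ih measurableT; rewrite preimage_setT => ->.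
rewrite !key; apply: eq_measure_integral.
- exact: copies_measurable.
- exact: copies_measurable.
- by move=> p1 p2 A mA _; exact: (copies_law mX iX S mA).
Qed.

Let sel S (f : W -> R) (w : T * T) := f (mix X S w).

Let sel_bm S (f : W -> R) M : measurable_fun setT f -> (forall x, `|f x| <= M) -> bm (sel S f).
Proof.
move=> mf hM; split; last by exists M => w; exact: hM.
exact: (measurableT_comp mf (mix_measurable mX S)).
Qed.

(** The copies may be exchanged simultaneously in a function of three mixtures
   of them. *)
Let exchange S S1 S2 S3 (f : W -> R) M (q : R -> R -> R -> R) :
  measurable_fun setT f -> (forall x, `|f x| <= M) ->
  (forall d' (U : measurableType d') (g1 g2 g3 : U -> R), measurable_fun setT g1 ->
    measurable_fun setT g2 -> measurable_fun setT g3 ->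
    measurable_fun setT (fun u => q (g1 u) (g2 u) (g3 u))) ->
  (exists N, forall a b c, `|a| <= M -> `|b| <= M -> `|c| <= M -> `|q a b c| <= N) ->
  Ex (fun w => q (sel S1 f w) (sel S2 f w) (sel S3 f w)) =
  Ex (fun w => q (sel (fun i => S1 i (+) S i) f w) (sel (fun i => S2 i (+) S i) f w)
                 (sel (fun i => S3 i (+) S i) f w)).
Proof.
move=> mf hM mq [N hN].
pose h (y : famT (bool * I)%type R) :=
  q (f (select S1 y)) (f (select S2 y)) (f (select S3 y)).
have mh : measurable_fun setT h.
  by apply: mq; apply: (measurableT_comp mf); exact: select_measurable.
have hb y : `|h y| <= N by apply: hN.
have selE S' : (fun w => h (copies X S' w)) = (fun w =>
    q (sel (fun i => S1 i (+) S' i) f w) (sel (fun i => S2 i (+) S' i) f w)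
      (sel (fun i => S3 i (+) S' i) f w)).
  by apply/funext => w; rewrite /h !select_copies.
have x0 (S' : pred I) : (fun i => S' i (+) xpred0 i) = S'.
  by apply/funext => i; rewrite addbF.
by have := copies_Ex S mh hb; rewrite !selE !x0.
Qed.

Definition col (k : nat) : pred I := fun i => i.2 == k.
Definition below (k : nat) : pred I := fun i => (i.2 < k)%N.

Let below0 : below 0 = xpred0.
Proof. by apply/funext => i; rewrite /below ltn0. Qed.

Let below_col k : (fun i => below k i (+) col k i) = below k.+1.
Proof.
apply/funext => i; rewrite /below /col [in RHS]ltnS [in RHS]leq_eqVlt.
by case: (ltngtP i.2 k).
Qed.

Let belowS_col k : (fun i => below k.+1 i (+) col k i) = below k.
Proof. by apply/funext => i; rewrite -below_col addbK. Qed.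

Let col_below k : (fun i => col k i (+) below k i) = below k.+1.
Proof. by apply/funext => i; rewrite -below_col addbC. Qed.

(** The difference between the two copies is the sum of the differences between
   consecutive hybrids; exchanging one column turns the product of a difference
   with the first copy into a product of two differences, bounded by the mean of
   their squares. *)
Lemma efron_stein_real (f : W -> R) M n : measurable_fun setT f ->
  (forall x, `|f x| <= M) ->
  (forall x y : W, (forall i, (i.2 < n)%N -> x i = y i) -> f x = f y) ->
  Ex (fun w => (f (fam X w.1) - f (fam X w.2)) ^+ 2) <=
  \sum_(k < n) Ex (fun w => (f (fam X w.1) - f (mix X (col k) w)) ^+ 2).
Proof.
move=> mf hM hf.
have M0 : 0 <= M by exact: le_trans (hM point).
pose h k := sel (below k) f; pose g k := sel (col k) f.
have bh k : bm (h k) by exact: sel_bm hM.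
have bg k : bm (g k) by exact: sel_bm hM.
have h0E w : f (fam X w.1) = h 0%N w by rewrite /h /sel below0.
have hnE w : f (fam X w.2) = h n w.
  by apply: hf => i hi; rewrite /mix /below hi.
have -> : (fun w => (f (fam X w.1) - f (fam X w.2)) ^+ 2) =
    (fun w => (h 0%N w - h n w) ^+ 2) by apply/funext => w; rewrite h0E hnE.
have e2 k : (fun w => (f (fam X w.1) - f (mix X (col k) w)) ^+ 2) =
    (fun w => (h 0%N w - g k w) ^+ 2) by apply/funext => w; rewrite h0E.
under eq_bigr do rewrite e2.
have bsq u v : bm u -> bm v -> bm (fun w => (u w - v w) ^+ 2).
  by move=> bu bv; under eq_fun do rewrite expr2; apply: bmM; exact: bmB.
have x0 S : (fun i => below 0 i (+) S i) = S.
  by apply/funext => i; rewrite below0.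
have Esq : Ex (fun w => h n w * h n w) = Ex (fun w => h 0%N w * h 0%N w).
  have q1 d' (U : measurableType d') (g1 g2 g3 : U -> R) : measurable_fun setT g1 ->
      measurable_fun setT g2 -> measurable_fun setT g3 ->
      measurable_fun setT (fun u => g1 u * g2 u).
    by move=> m1 m2 m3; exact: measurable_funM.
  have q2 : exists N, forall a b c : R, `|a| <= M -> `|b| <= M -> `|c| <= M ->
      `|a * b| <= N.
    by exists (M * M) => a b c a1 b1 c1; rewrite normrM ler_pM.
  have := @exchange (below n) (below 0) (below 0) (below 0) f M
    (fun a b _ => a * b) mf hM q1 q2.
  by rewrite !x0 => ->.
have hstep k : Ex (fun w => 2 * (h 0%N w * (h k w - h k.+1 w))) <=
    Ex (fun w => (h 0%N w - g k w) ^+ 2).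
  have E1 : Ex (fun w => h 0%N w * (h k w - h k.+1 w)) =
      Ex (fun w => g k w * (h k.+1 w - h k w)).
    have q1 d' (U : measurableType d') (g1 g2 g3 : U -> R) : measurable_fun setT g1 ->
        measurable_fun setT g2 -> measurable_fun setT g3 ->
        measurable_fun setT (fun u => g1 u * (g2 u - g3 u)).
      move=> m1 m2 m3.
      by apply: measurable_funM => //; exact: measurable_funB.
    have q2 : exists N, forall a b c : R, `|a| <= M -> `|b| <= M -> `|c| <= M ->
        `|a * (b - c)| <= N.
      exists (M * (M + M)) => a b c a1 b1 c1; rewrite normrM ler_pM //.
      by apply: (le_trans (ler_normB _ _)); rewrite lerD.
    have := @exchange (col k) (below 0) (below k) (below k.+1) f M
      (fun a b c => a * (b - c)) mf hM q1 q2.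
    by rewrite x0 below_col belowS_col.
  have E2 : Ex (fun w => (h 0%N w - g k w) ^+ 2) = Ex (fun w => (h k w - h k.+1 w) ^+ 2).
    have q1 d' (U : measurableType d') (g1 g2 g3 : U -> R) : measurable_fun setT g1 ->
        measurable_fun setT g2 -> measurable_fun setT g3 ->
        measurable_fun setT (fun u => (g1 u - g2 u) ^+ 2).
      by move=> m1 m2 m3; apply: measurable_funX; exact: measurable_funB.
    have q2 : exists N, forall a b c : R, `|a| <= M -> `|b| <= M -> `|c| <= M ->
        `|(a - b) ^+ 2| <= N.
      exists ((M + M) ^+ 2) => a b c a1 b1 c1.
      rewrite normrX lerXn2r ?nnegrE ?addr_ge0 //.
      by apply: (le_trans (ler_normB _ _)); rewrite lerD.
    have := @exchange (below k) (below 0) (col k) (below 0) f M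
      (fun a b _ => (a - b) ^+ 2) mf hM q1 q2.
    by rewrite x0 col_below.
  have b1 : bm (fun w => h 0%N w * (h k w - h k.+1 w)) by apply: bmM => //; exact: bmB.
  have b2 : bm (fun w => g k w * (h k.+1 w - h k w)) by apply: bmM => //; exact: bmB.
  have b3 := bsq _ _ (bh 0%N) (bg k); have b4 := bsq _ _ (bh k) (bh k.+1).
  rewrite ExZ // mulr_natl mulr2n {2}E1 -ExD //.
  have -> : Ex (fun w => (h 0%N w - g k w) ^+ 2) =
     Ex (fun w => 2^-1 * ((h 0%N w - g k w) ^+ 2 + (h k w - h k.+1 w) ^+ 2)).
    by rewrite ExZ ?ExD -?E2 //; [field|exact: bmD].
  apply: le_Ex; first exact: bmD.
    by apply: bmZ; exact: bmD.
  move=> w; have := sqr_ge0 ((h 0%N w - g k w) - (h k w - h k.+1 w)).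
  by rewrite sqrrB; lra.
apply: (@le_trans _ _ (\sum_(k < n) Ex (fun w => 2 * (h 0%N w * (h k w - h k.+1 w))))).
  have bs k : bm (fun w => 2 * (h 0%N w * (h k w - h k.+1 w))).
    by apply: bmZ; apply: bmM => //; exact: bmB.
  have [E3 b3] := Ex_sum n bs.
  rewrite -[leRHS]E3.
  have -> : (fun w => \sum_(k < n) 2 * (h 0%N w * (h k w - h k.+1 w))) =
      (fun w => 2 * (h 0%N w * h 0%N w - h 0%N w * h n w)).
    apply/funext => w; rewrite -!mulr_sumr -mulrBr; congr (_ * (_ * _)).
    elim: (n) => [|k IH]; first by rewrite big_ord0 subrr.
    by rewrite big_ord_recr /= IH addrA subrK.
  have b00 : bm (fun w => h 0%N w * h 0%N w) by exact: bmM.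
  have b0n : bm (fun w => h 0%N w * h n w) by exact: bmM.
  have bnn : bm (fun w => h n w * h n w) by exact: bmM.
  rewrite ExZ; last exact: bmB.
  rewrite ExB //.
  have -> : Ex (fun w => (h 0%N w - h n w) ^+ 2) =
     Ex (fun w => (h 0%N w * h 0%N w + h n w * h n w) - 2 * (h 0%N w * h n w)).
    by congr (Ex _); apply/funext => w; ring.
  rewrite ExB ?ExD ?ExZ ?Esq //; [lra|exact: bmD|exact: bmZ].
by apply: ler_sum => k _; exact: hstep.
Qed.

Let Ex_ereal h : bm h -> (\int[PP]_w (h w)%:E = (Ex h)%:E)%E.
Proof.
move=> /bm_int Ih; rewrite /Ex /Rintegral fineK //.
exact: (integrable_fin_num measurableT Ih).
Qed.

Lemma efron_stein_mix (f : W -> C) M n : cmeas f -> (forall x, cabs (f x) <= M) ->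
  (forall x y : W, (forall i, (i.2 < n)%N -> x i = y i) -> f x = f y) ->
  (\int[PP]_w (cabs (f (fam X w.1) - f (fam X w.2)) ^+ 2)%:E <=
   \sum_(k < n) \int[PP]_w (cabs (f (fam X w.1) - f (mix X (col k) w)) ^+ 2)%:E)%E.
Proof.
move=> [mr mi] hM hf.
have hr x : `|cRe (f x)| <= M by apply: le_trans (hM x); exact: Re_le_cabs.
have hi x : `|cIm (f x)| <= M by apply: le_trans (hM x); exact: Im_le_cabs.
have b1 (u : W -> R) : measurable_fun setT u -> (forall x, `|u x| <= M) ->
    bm (fun w => u (fam X w.1)).
  move=> mu hu; have := sel_bm xpred0 mu hu.
  by congr (bm _); apply/funext.
have b2 (u : W -> R) S : measurable_fun setT u -> (forall x, `|u x| <= M) ->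
    bm (fun w => u (mix X S w)).
  by move=> mu hu; exact: sel_bm hu.
have sq u v : bm u -> bm v -> bm (fun w => (u w - v w) ^+ 2).
  by move=> bu bv; under eq_fun do rewrite expr2; apply: bmM; exact: bmB.
have split2 S : (\int[PP]_w (cabs (f (fam X w.1) - f (mix X S w)) ^+ 2)%:E =
   (Ex (fun w => (cRe (f (fam X w.1)) - cRe (f (mix X S w))) ^+ 2) +
    Ex (fun w => (cIm (f (fam X w.1)) - cIm (f (mix X S w))) ^+ 2))%:E)%E.
  have br := sq _ _ (b1 _ mr hr) (b2 _ S mr hr).
  have bi := sq _ _ (b1 _ mi hi) (b2 _ S mi hi).
  rewrite -ExD // -Ex_ereal; last exact: bmD.
  by apply: eq_integral => w _; rewrite cabs_sqr ReB ImB.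
have -> : (\int[PP]_w (cabs (f (fam X w.1) - f (fam X w.2)) ^+ 2)%:E =
   \int[PP]_w (cabs (f (fam X w.1) - f (mix X xpredT w)) ^+ 2)%:E)%E by [].
rewrite split2; under eq_bigr do rewrite split2.
rewrite sumEFin lee_fin big_split /=; apply: lerD.
  by apply: (efron_stein_real mr hr) => x y xy; rewrite (hf x y).
by apply: (efron_stein_real mi hi) => x y xy; rewrite (hf x y).
Qed.

(** The function c k takes the same value on the two families, which differ in
   column k only, and may be subtracted from both values of f. *)
Lemma efron_stein (f : W -> C) M n (c : nat -> W -> C) :
  cmeas f -> (forall x, cabs (f x) <= M) ->
  (forall x y : W, (forall i, (i.2 < n)%N -> x i = y i) -> f x = f y) ->
  (forall k, cmeas (c k)) ->
  (forall k (x y : W), (forall i, i.2 != k -> x i = y i) -> c k x = c k y) ->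
  (\int[PP]_w (cabs (f (fam X w.1) - f (fam X w.2)) ^+ 2)%:E <=
   \sum_(k < n) 4%:E * \int[P]_w (cabs (f (fam X w) - c k (fam X w)) ^+ 2)%:E)%E.
Proof.
move=> mf hM hf mc hc; apply: (le_trans (efron_stein_mix mf hM hf)).
apply: lee_sum => k _.
pose g (x : W) : \bar R := (cabs (f x - c k x) ^+ 2)%:E.
have mg : measurable_fun setT g.
  by apply/measurable_EFinP; apply: measurable_cabs2; exact: cmeasB.
have g0 x : (0 <= g x)%E by rewrite lee_fin sqr_ge0.
have m0 := measurableT_comp mg (mix_measurable mX xpred0).
have mk := measurableT_comp mg (mix_measurable mX (col k)).
apply: (@le_trans _ _ (\int[PP]_w (2%:E * (g (mix X xpred0 w) + g (mix X (col k) w))))%E).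
  apply: ge0_le_integral => //.
  - by move=> w _; rewrite lee_fin sqr_ge0.
  - apply/measurable_EFinP; apply: measurable_cabs2; apply: cmeasB.
      have [m1 m2] := mf; split.
        exact: (measurableT_comp m1 (mix_measurable mX xpred0)).
      exact: (measurableT_comp m2 (mix_measurable mX xpred0)).
    have [m1 m2] := mf; split.
      exact: (measurableT_comp m1 (mix_measurable mX (col k))).
    exact: (measurableT_comp m2 (mix_measurable mX (col k))).
  - by apply: emeasurable_funM => //; exact: emeasurable_funD.
  move=> w _; rewrite /g -EFinD -EFinM lee_fin.
  have -> : c k (mix X (col k) w) = c k (mix X xpred0 w).
    by apply: hc => i; rewrite /mix /col => /negbTE ->.
  have -> : f (fam X w.1) = f (mix X xpred0 w) by [].
  set a := f (mix X xpred0 w); set b := f (mix X (col k) w); set e := c k _.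
  have h : cabs (a - b) <= cabs (a - e) + cabs (b - e).
    rewrite -(cabsN (b - e)).
    have -> : a - b = (a - e) + - (b - e) by rewrite opprB addrA subrK.
    exact: cabsD.
  apply: (@le_trans _ _ ((cabs (a - e) + cabs (b - e)) ^+ 2)).
    by rewrite lerXn2r ?nnegrE ?addr_ge0 ?cabs_ge0.
  exact: sqr_sum2_le.
rewrite ge0_integralZl //; last 2 first.
- exact: emeasurable_funD.
- by move=> w _; rewrite adde_ge0.
rewrite ge0_integralD // !(mix_law mX iX _ mg g0).
rewrite -mule2n -[(_ *+ 2)%E]mule_natl muleA -EFinM.
by rewrite -natrM.
Qed.

End EfronStein.

(** * Quadratic forms in independent variables *)

Section OneVariable.
Context d (T : measurableType d) (R : realType) (P : probability T R).
Local Notation C := R[i].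

Definition standardized (mu : R) (Y : T -> C) :=
  [/\ complex_rv Y, cintegral P Y = 0,
      (\int[P]_w (cabs (Y w) ^+ 2)%:E = 1)%E &
      (\int[P]_w (cabs (Y w) ^+ 4)%:E = mu%:E)%E].

Let has_mean (h : T -> R) (r : R) :=
  P.-integrable setT (EFin \o h) /\ \int[P]_w h w = r.

Let meanD h1 r1 h2 r2 : has_mean h1 r1 -> has_mean h2 r2 ->
  has_mean (fun w => h1 w + h2 w) (r1 + r2).
Proof.
move=> [i1 e1] [i2 e2]; split; last by rewrite RintegralD // e1 e2.
have := @integrableD _ _ _ P setT measurableT _ _ i1 i2.
by congr (P.-integrable _ _); apply/funext => w /=; rewrite EFinD.
Qed.

Let meanZ a h r : has_mean h r -> has_mean (fun w => a * h w) (a * r).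
Proof.
move=> [i e]; split; last by rewrite RintegralZl // e.
have := @integrableZl _ _ _ P setT measurableT a _ i.
by congr (P.-integrable _ _); apply/funext => w /=; rewrite EFinM.
Qed.

Let mean_cst a : has_mean (fun=> a) a.
Proof.
split.
  by apply: finite_measure_integrable_cst.
rewrite Rintegral_cst //; have -> : fine (P setT) = 1.
  exact: (congr1 fine (probability_setT P)).
exact: mulr1.
Qed.

Let mean_nonneg (h : T -> R) r : measurable_fun setT h -> (forall w, 0 <= h w) ->
  (\int[P]_w (h w)%:E = r%:E)%E -> has_mean h r.
Proof.
move=> mh h0 e; split; last by rewrite /Rintegral e.
apply/integrableP; split; first exact/measurable_EFinP.
under eq_integral do rewrite gee0_abs ?lee_fin ?h0 //.
by rewrite e ltry.
Qed.

Lemma complex_rv_cmeas (Y : T -> C) : complex_rv Y -> cmeas Y.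
Proof.
move=> mY; split.
  exact: (measurableT_comp (@measurable_fst _ _ R R) mY).
exact: (measurableT_comp (@measurable_snd _ _ R R) mY).
Qed.

Lemma cabs_sum3_sqr (x y z : C) :
  cabs (x + y + z) ^+ 2 <= 3 * (cabs x ^+ 2 + cabs y ^+ 2 + cabs z ^+ 2).
Proof.
apply: (@le_trans _ _ ((cabs x + cabs y + cabs z) ^+ 2)).
  rewrite lerXn2r ?nnegrE ?addr_ge0 ?cabs_ge0 //.
  by apply: (le_trans (cabsD _ _)); rewrite lerD2r cabsD.
have := sqr_ge0 (cabs x - cabs y); have := sqr_ge0 (cabs x - cabs z).
by have := sqr_ge0 (cabs y - cabs z); rewrite !sqrrB !sqrrD; lra.
Qed.

(** A standardized variable and the fluctuation of its squared modulus are
   centred, hence orthogonal to constants. *)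
Lemma second_moment_one_variable mu Y q c a b : standardized mu Y ->
  (\int[P]_w (cabs (q + (c * ((cabs (Y w) ^+ 2)%:C - 1) + a * ((Y w)^*)%C + b * Y w)) ^+ 2)%:E
   <= (cabs q ^+ 2 + 3 * ((mu + 1) * cabs c ^+ 2 + cabs a ^+ 2 + cabs b ^+ 2))%:E)%E.
Proof.
move=> [mY Y0 Y2 Y4]; have hY := complex_rv_cmeas mY; have [hr hi] := hY.
have m2 := measurable_cabs2 hY.
have m4 : measurable_fun setT (fun w => cabs (Y w) ^+ 4).
  by apply: measurable_funX; exact: measurable_cabs.
have i2 : has_mean (fun w => cabs (Y w) ^+ 2) 1.
  by apply: mean_nonneg => // w; rewrite sqr_ge0.
have i4 : has_mean (fun w => cabs (Y w) ^+ 4) mu.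
  by apply: mean_nonneg => // w; rewrite exprn_ge0 // cabs_ge0.
have dom (u : T -> R) r : measurable_fun setT u -> (forall w, `|u w| <= cabs (Y w)) ->
    \int[P]_w u w = r -> has_mean u r.
  move=> mu' hu e; split=> //; have [I2 _] := meanD (mean_cst 1) i2.
  apply: le_integrable I2 => //; first exact/measurable_EFinP.
  move=> w _; rewrite /= !lee_fin; apply: (le_trans (hu w)).
  rewrite (le_trans _ (ler_norm _)) //.
  by have := sqr_ge0 (cabs (Y w) - 1); rewrite sqrrB1; have := sqr_ge0 (cabs (Y w)); lra.
have iR : has_mean (fun w => cRe (Y w)) 0.
  by apply: dom => // [w|]; [exact: Re_le_cabs|have := congr1 (@cRe R) Y0].
have iI : has_mean (fun w => cIm (Y w)) 0.
  by apply: dom => // [w|]; [exact: Im_le_cabs|have := congr1 (@cIm R) Y0].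
set s := cabs q ^+ 2; set c2 := cabs c ^+ 2; set a2 := cabs a ^+ 2; set b2 := cabs b ^+ 2.
pose al := 2 * (cRe q * cRe c + cIm q * cIm c).
pose be := 2 * (cRe q * (cRe a + cRe b) + cIm q * (cIm a + cIm b)).
pose ga := 2 * (cRe q * (cIm a - cIm b) + cIm q * (cRe b - cRe a)).
pose h w := (s - al + 3 * c2) + (al - 6 * c2 + 3 * (a2 + b2)) * cabs (Y w) ^+ 2 +
  be * cRe (Y w) + ga * cIm (Y w) + 3 * c2 * cabs (Y w) ^+ 4.
have [Ih Eh] : has_mean h ((s - al + 3 * c2) + (al - 6 * c2 + 3 * (a2 + b2)) * 1 +
    be * 0 + ga * 0 + 3 * c2 * mu).
  by rewrite /h; do !apply: meanD; try exact: mean_cst; exact: meanZ.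
have hZ w : cabs (q + (c * ((cabs (Y w) ^+ 2)%:C - 1) + a * ((Y w)^*)%C + b * Y w)) ^+ 2 <= h w.
  set Z := c * _ + _ + _.
  have hZ : cabs Z ^+ 2 <= 3 * (c2 * (cabs (Y w) ^+ 2 - 1) ^+ 2 + a2 * cabs (Y w) ^+ 2 +
      b2 * cabs (Y w) ^+ 2).
    apply: (le_trans (cabs_sum3_sqr _ _ _)).
    rewrite !cabsM !exprMn cabs_conj -/a2 -/b2 -/c2.
    have -> : (cabs (Y w) ^+ 2)%:C - 1 = (cabs (Y w) ^+ 2 - 1)%:C by rewrite rmorphB.
    by rewrite cabsR real_normK ?num_real.
  have E : cabs (q + Z) ^+ 2 = s + (al * (cabs (Y w) ^+ 2 - 1) + be * cRe (Y w) + ga * cIm (Y w))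
     + cabs Z ^+ 2.
    have ab (x y : C) : cabs (x + y) ^+ 2 =
        cabs x ^+ 2 + 2 * (cRe x * cRe y + cIm x * cIm y) + cabs y ^+ 2.
      by rewrite !cabs_sqr ReD ImD; ring.
    rewrite ab -/s; congr (_ + _ + _); rewrite /Z /al /be /ga.
    have -> : (cabs (Y w) ^+ 2)%:C - 1 = (cabs (Y w) ^+ 2 - 1)%:C by rewrite rmorphB.
    move: (cabs (Y w) ^+ 2 - 1) => r.
    by rewrite !(ReD, ImD, ReM, ImM) Re_conj Im_conj /=; ring.
  rewrite E /h; apply: (le_trans (lerD (lexx _) hZ)).
  have -> : cabs (Y w) ^+ 4 = (cabs (Y w) ^+ 2) ^+ 2 by rewrite -exprM.
  move: (cabs (Y w) ^+ 2) => r; rewrite le_eqVlt; apply/orP; left; apply/eqP.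
  ring.
have h0 w : 0 <= h w by apply: le_trans (hZ w); exact: sqr_ge0.
have mh : measurable_fun setT (EFin \o h) by case/integrableP: Ih.
apply: (@le_trans _ _ (\int[P]_w (h w)%:E)%E).
  apply: ge0_le_integral => //.
  - by move=> w _; rewrite lee_fin sqr_ge0.
  - apply/measurable_EFinP; apply: measurable_cabs2.
    apply: cmeasD; first exact: cmeas_cst.
    apply: cmeasD; last by apply: cmeasM => //; exact: cmeas_cst.
    apply: cmeasD; apply: cmeasM; try exact: cmeas_cst; last exact: cmeas_conj.
    by apply: cmeasB; [exact: cmeas_real|exact: cmeas_cst].
  - by move=> w _; rewrite lee_fin.
rewrite -[X in (X <= _)%E]fineK; last exact: (integrable_fin_num measurableT Ih).
rewrite -/(Rintegral P setT h) Eh lee_fin.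
have c0 : 0 <= c2 by exact: sqr_ge0.
lra.
Qed.

End OneVariable.

Section QuadraticForms.
Context d (T : measurableType d) (R : realType) (P : probability T R).
Variable X : nat * nat -> T -> R[i].
Variable mu : R.
Hypotheses (mX : forall i, complex_rv (X i)) (iX : independent P X).
Hypothesis sX : forall i, standardized P mu (X i).
Local Notation C := R[i].
Local Notation I := (nat * nat)%type.
Local Notation W := (famT I R).

Definition entry (x : W) (j k : nat) : C := (x (j, k)).1 +i* (x (j, k)).2.

Lemma entry_cmeas j k : cmeas (fun x : W => entry x j k).
Proof.
have h := @proj_measurable I R (j, k); split.
  exact: (measurableT_comp (@measurable_fst _ _ R R) h).
exact: (measurableT_comp (@measurable_snd _ _ R R) h).
Qed.

Definition mean2 (f : W -> C) : \bar R := (\int[P]_w (cabs (f (fam X w)) ^+ 2)%:E)%E.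

Lemma mean2_ge0 (f : W -> C) : (0 <= mean2 f)%E.
Proof. by apply: integral_ge0 => w _; rewrite lee_fin sqr_ge0. Qed.

Lemma mean2_measurable (f : W -> C) : cmeas f ->
  measurable_fun setT (fun w => (cabs (f (fam X w)) ^+ 2)%:E).
Proof.
move=> mf; apply/measurable_EFinP.
exact: (measurableT_comp (measurable_cabs2 mf) (fam_measurable_fun mX)).
Qed.

Lemma mu_ge0 : 0 <= mu.
Proof.
have [_ _ _ h] := sX (0, 0)%N; rewrite -lee_fin -h.
by apply: integral_ge0 => w _; rewrite lee_fin exprn_ge0 // cabs_ge0.
Qed.

(** Only the members exchanged by S are integrated first; the bound may thus
   be obtained with the others frozen. *)
Lemma mean2_frozen (S : pred I) (f : W -> C) (h : W -> \bar R) : cmeas f ->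
  measurable_fun setT h -> (forall x, 0 <= h x)%E ->
  (forall w, \int[P]_w' (cabs (f (mix X S (w, w'))) ^+ 2)%:E <= h (fam X w))%E ->
  (mean2 f <= \int[P]_w h (fam X w))%E.
Proof.
move=> mf mh h0 hf.
pose g (x : W) : \bar R := (cabs (f x) ^+ 2)%:E.
have mg : measurable_fun setT g by apply/measurable_EFinP; exact: measurable_cabs2.
have g0 x : (0 <= g x)%E by rewrite lee_fin sqr_ge0.
rewrite /mean2 (decoupling mX iX S mg g0); apply: ge0_le_integral => //.
- by move=> w _; apply: integral_ge0.
- have mS : measurable_fun setT (g \o mix X S) := measurableT_comp mg (mix_measurable mX S).
  exact: (@measurable_fun_fubini_tonelli_F _ _ _ _ _ P _ mS (fun x => g0 _)).
- exact: (measurableT_comp mh (fam_measurable_fun mX)).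
- by move=> w _; exact: hf.
Qed.

(** The entry is integrated first, the functions q, a and b being constant for
   it. *)
Lemma mean2_one_entry j k (c : C) (q a b : W -> C) :
  cmeas q -> cmeas a -> cmeas b ->
  (forall x y : W, (forall i, i != (j, k) -> x i = y i) -> [/\ q x = q y, a x = a y & b x = b y]) ->
  (mean2 (fun x => q x + (c * ((cabs (entry x j k) ^+ 2)%:C - 1) +
      a x * ((entry x j k)^*)%C + b x * entry x j k))%R
   <= mean2 q + (3%:E * ((mu + 1) * cabs c ^+ 2)%:E + 3%:E * mean2 a + 3%:E * mean2 b))%E.
Proof.
move=> mq ma mb hq.
have mx := entry_cmeas j k.
have cE (u : W -> C) : cmeas u -> measurable_fun setT (fun x => (cabs (u x) ^+ 2)%:E).
  by move=> mu'; apply/measurable_EFinP; exact: measurable_cabs2.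
pose h (x : W) : \bar R := ((cabs (q x) ^+ 2)%:E + (3%:E * ((mu + 1) * cabs c ^+ 2)%:E +
  3%:E * (cabs (a x) ^+ 2)%:E + 3%:E * (cabs (b x) ^+ 2)%:E))%E.
have m0 := mu_ge0.
have k0 : (0 <= 3%:E * ((mu + 1) * cabs c ^+ 2)%:E)%E.
  have p1 : 0 <= mu + 1 by lra.
  by rewrite -EFinM lee_fin; apply: mulr_ge0 => //; apply: mulr_ge0 => //; exact: sqr_ge0.
have p0 (u : W -> C) x : (0 <= (cabs (u x) ^+ 2)%:E)%E by rewrite lee_fin sqr_ge0.
have p3 (u : W -> C) x : (0 <= 3%:E * (cabs (u x) ^+ 2)%:E)%E by rewrite mule_ge0.
have m3 (u : W -> C) : cmeas u -> measurable_fun setT (fun x => 3%:E * (cabs (u x) ^+ 2)%:E)%E.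
  by move=> mu'; apply: emeasurable_funM => //; exact: cE.
have mh : measurable_fun setT h.
  apply: emeasurable_funD; first exact: cE.
  apply: emeasurable_funD; last exact: m3.
  by apply: emeasurable_funD; [exact: measurable_cst|exact: m3].
apply: (le_trans (@mean2_frozen (pred1 (j, k)) _ h _ mh _ _)).
- apply: cmeasD => //; apply: cmeasD; last exact: cmeasM.
  apply: cmeasD; last by apply: cmeasM => //; exact: cmeas_conj.
  apply: cmeasM; first exact: cmeas_cst.
  apply: cmeasB; last exact: cmeas_cst.
  by apply: cmeas_real; exact: measurable_cabs2.
- by move=> x; rewrite /h !adde_ge0.
- move=> w; have := @second_moment_one_variable _ _ _ P mu _ (q (fam X w)) c (a (fam X w))
    (b (fam X w)) (sX (j, k)).
  have E w' : [/\ q (mix X (pred1 (j, k)) (w, w')) = q (fam X w),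
       a (mix X (pred1 (j, k)) (w, w')) = a (fam X w) &
       b (mix X (pred1 (j, k)) (w, w')) = b (fam X w)].
    by apply: hq => i hi; rewrite /mix /= (negbTE hi).
  have E2 w' : entry (mix X (pred1 (j, k)) (w, w')) j k = X (j, k) w'.
    by rewrite /entry /mix /= eqxx /cpair /=; case: (X (j, k) w').
  under [X in _ -> (X <= _)%E]eq_integral => w' _.
    have [-> -> ->] := E w'; rewrite E2; over.
  move=> H; apply: (le_trans H); rewrite /h -!EFinM -!EFinD lee_fin.
  by rewrite !mulrDr !addrA.
have mf (u : W -> \bar R) : measurable_fun setT u -> measurable_fun setT (fun w => u (fam X w)).
  by move=> mu'; exact: (measurableT_comp mu' (fam_measurable_fun mX)).
have i3 (u : W -> C) : cmeas u ->
    (\int[P]_w (3%:E * (cabs (u (fam X w)) ^+ 2)%:E) = 3%:E * mean2 u)%E.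
  move=> mu'; rewrite ge0_integralZl //; first exact: (mf _ (cE _ mu')).
have PT : P setT = 1%E by exact: probability_setT.
have iD (u v : W -> \bar R) : measurable_fun setT u -> measurable_fun setT v ->
    (forall x, 0 <= u x)%E -> (forall x, 0 <= v x)%E ->
    (\int[P]_w (u (fam X w) + v (fam X w)) =
     \int[P]_w u (fam X w) + \int[P]_w v (fam X w))%E.
  move=> mu' mv u0 v0; apply: ge0_integralD => //; exact: mf.
have mc : measurable_fun (setT : set W) (fun=> 3%:E * ((mu + 1) * cabs c ^+ 2)%:E)%E.
  exact: measurable_cst.
have mca := emeasurable_funD mc (m3 _ ma).
have ca0 x : (0 <= 3%:E * ((mu + 1) * cabs c ^+ 2)%:E + 3%:E * (cabs (a x) ^+ 2)%:E)%E.
  by rewrite adde_ge0.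
rewrite (iD _ _ (cE _ mq) (emeasurable_funD mca (m3 _ mb)) (p0 q)); last first.
  by move=> x; rewrite !adde_ge0.
rewrite (iD _ _ mca (m3 _ mb) ca0 (p3 b)) (iD _ _ mc (m3 _ ma) (fun=> k0) (p3 a)).
by rewrite integral_cst //= [X in (_ * X)%E]PT mule1 !i3.
Qed.

Lemma mean2_linear k m (a : nat -> C) :
  (mean2 (fun x => \sum_(j < m) a j * entry x j k)%R <= (3 * \sum_(j < m) cabs (a j) ^+ 2)%:E)%E.
Proof.
elim: m => [|m IH].
  rewrite /mean2 big_ord0 mulr0; under eq_integral do rewrite big_ord0 cabs0 expr0n /=.
  by rewrite integral0.
have E : (fun x : W => \sum_(j < m.+1) a j * entry x j k) =
   (fun x => \sum_(j < m) a j * entry x j k + (0 * ((cabs (entry x m k) ^+ 2)%:C - 1) +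
      0 * ((entry x m k)^*)%C + a m * entry x m k)).
  by apply/funext => x; rewrite big_ord_recr /= !mul0r !add0r.
have z0 : mean2 (fun=> 0) = 0%E.
  by rewrite /mean2; under eq_integral do rewrite cabs0 expr0n /=; rewrite integral0.
have ac : mean2 (fun=> a m) = (cabs (a m) ^+ 2)%:E.
  rewrite /mean2 integral_cst //=; have -> : P setT = 1%E by exact: probability_setT.
  by rewrite mule1.
rewrite E; apply: le_trans (@mean2_one_entry m k 0 _ (fun=> 0) (fun=> a m) _ _ _ _) _.
- by apply: cmeas_sum => j _; apply: cmeasM; [exact: cmeas_cst|exact: entry_cmeas].
- exact: cmeas_cst.
- exact: cmeas_cst.
- move=> x y h; split=> //; apply: eq_bigr => j _; rewrite /entry h //.
  by rewrite xpair_eqE negb_and neq_ltn ltn_ord.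
rewrite z0 ac cabs0 expr0n /= mulr0 !mule0 !add0e big_ord_recr /= mulrDr.
by rewrite [X in (_ <= X)%E]EFinD [X in (_ <= _ + X)%E]EFinM; apply: leeD.
Qed.

Lemma mean2_linear_conj k m (a : nat -> C) :
  (mean2 (fun x => \sum_(j < m) a j * ((entry x j k)^*)%C)%R <=
    (3 * \sum_(j < m) cabs (a j) ^+ 2)%:E)%E.
Proof.
have := mean2_linear k m (fun j => ((a j)^*)%C).
under eq_bigr do rewrite cabs_conj; congr (_ <= _)%E.
apply: eq_integral => w _; rewrite -cabs_conj rmorph_sum /=.
by under eq_bigr do rewrite rmorphM /= conjcK.
Qed.

(** One entry of the vector at a time: the new terms are the diagonal one and
   two linear forms in the earlier entries. *)
Lemma mean2_quadratic k m (N : nat -> nat -> C) :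
  (mean2 (fun x => \sum_(i < m) \sum_(j < m) N i j * (((entry x i k)^*)%C * entry x j k)
      - \sum_(i < m) N i i)%R <=
    (9 * (mu + 1) * \sum_(i < m) \sum_(j < m) cabs (N i j) ^+ 2)%:E)%E.
Proof.
have m0 := mu_ge0.
elim: m => [|m IH].
  rewrite /mean2 !big_ord0 mulr0.
  by under eq_integral do rewrite ?big_ord0 subr0 cabs0 expr0n /=; rewrite integral0.
set Q := (fun x : W => _) in IH.
have mQ : cmeas Q.
  apply: cmeasB; last exact: cmeas_cst.
  do 2!apply: cmeas_sum => ? _; apply: cmeasM; first exact: cmeas_cst.
  by apply: cmeasM; [apply: cmeas_conj|]; exact: entry_cmeas.
pose a (x : W) := \sum_(j < m) N m j * entry x j k.
pose b (x : W) := \sum_(j < m) N j m * ((entry x j k)^*)%C.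
have ma : cmeas a.
  by apply: cmeas_sum => ? _; apply: cmeasM; [exact: cmeas_cst|exact: entry_cmeas].
have mb : cmeas b.
  apply: cmeas_sum => ? _; apply: cmeasM; first exact: cmeas_cst.
  by apply: cmeas_conj; exact: entry_cmeas.
set f := (fun x : W => _).
have -> : f = (fun x => Q x + (N m m * ((cabs (entry x m k) ^+ 2)%:C - 1) +
      a x * ((entry x m k)^*)%C + b x * entry x m k)).
  apply/funext => x; rewrite -mulC_conj /f /Q /a /b !big_ord_recr /=.
  under eq_bigr do rewrite big_ord_recr /=.
  rewrite big_split /= !mulr_suml.
  have -> : \sum_(i < m) N i m * ((entry x i k)^*%C * entry x m k) =
     \sum_(i < m) N i m * (entry x i k)^*%C * entry x m k.
    by apply: eq_bigr => i _; rewrite mulrA.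
  have -> : \sum_(i < m) N m i * ((entry x m k)^*%C * entry x i k) =
     \sum_(i < m) N m i * entry x i k * (entry x m k)^*%C.
    by apply: eq_bigr => i _; ring.
  by ring.
apply: le_trans (@mean2_one_entry m k (N m m) Q a b mQ ma mb _) _.
  have ne (j : 'I_m) : (j : nat, k) != (m, k).
    by rewrite xpair_eqE negb_and neq_ltn ltn_ord.
  have eE x y (j : 'I_m) : (forall i, i != (m, k) -> x i = y i) -> entry x j k = entry y j k.
    by move=> h; rewrite /entry h.
  move=> x y h; rewrite /Q /a /b; split.
  - by congr (_ - _); do 2!apply: eq_bigr => ? _; rewrite !(eE _ _ _ h).
  - by apply: eq_bigr => ? _; rewrite (eE _ _ _ h).
  - by apply: eq_bigr => ? _; rewrite (eE _ _ _ h).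
have ha := mean2_linear k m (N m); have hb := mean2_linear_conj k m (N ^~ m).
have h3 : (0 <= 3%:E :> \bar R)%E by [].
apply: le_trans (leeD IH (leeD (leeD (lexx _) (lee_wpmul2l h3 ha)) (lee_wpmul2l h3 hb))) _.
rewrite -!EFinM -!EFinD lee_fin big_ord_recr /=.
under [in leRHS]eq_bigr do rewrite big_ord_recr /=.
rewrite big_split big_ord_recr /=.
have s0 (F : 'I_m -> C) : 0 <= \sum_i cabs (F i) ^+ 2 by apply: sumr_ge0 => i _; exact: sqr_ge0.
move: (s0 (fun i => N m i)) (s0 (fun i => N i m)) => /=.
move: (\sum_(i < m) cabs (N m i) ^+ 2) (\sum_(i < m) cabs (N i m) ^+ 2) => u v u0 v0.
move: (\sum_(i < m) \sum_(i0 < m) cabs (N i i0) ^+ 2) => s.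
have := sqr_ge0 (cabs (N m m)); move: (cabs (N m m) ^+ 2) => t t0.
have := mulr_ge0 m0 u0; have := mulr_ge0 m0 v0; have := mulr_ge0 m0 t0.
lra.
Qed.

Definition entries (x : W) m k : 'cV[C]_m := \col_j entry x j k.

Definition frob m (N : 'M[C]_m) : R := \sum_i \sum_j cabs (N i j) ^+ 2.

Lemma mean2_quadratic_mx k m (N : 'M[C]_m) :
  (mean2 (fun x => dot (entries x m k) (N *m entries x m k) - \tr N)%R
    <= (9 * (mu + 1) * frob N)%:E)%E.
Proof.
case: m N => [|m] N.
  rewrite /frob big_ord0 mulr0 /mean2 /dot /mxtrace.
  under eq_integral do rewrite mxE !big_ord0 subr0 cabs0 expr0n /=.
  by rewrite integral0.
have := mean2_quadratic k m.+1 (fun i j => N (inord i) (inord j)).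
have -> : \sum_(i < m.+1) \sum_(j < m.+1) cabs (N (inord i) (inord j)) ^+ 2 = frob N.
  by do 2!apply: eq_bigr => ? _; rewrite !inord_val.
congr (_ <= _)%E; apply: eq_integral => w _; congr (_ ^+ 2)%:E; congr (cabs (_ - _)).
  rewrite dotE; apply: eq_bigr => i _; rewrite !mxE mulr_sumr; apply: eq_bigr => j _.
  by rewrite !mxE !inord_val; ring.
by rewrite /mxtrace; apply: eq_bigr => i _; rewrite inord_val.
Qed.

(** The matrix may depend on the other columns, which are frozen while column k
   is integrated. *)
Lemma mean2_quadratic_column k m (N : W -> 'M[C]_m) F :
  (forall i j, cmeas (fun x => N x i j)) ->
  (forall x y : W, (forall i, i.2 != k -> x i = y i) -> N x = N y) ->
  (forall x, frob (N x) <= F) ->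
  (mean2 (fun x => dot (entries x m k) (N x *m entries x m k) - \tr (N x))%R
    <= (9 * (mu + 1) * F)%:E)%E.
Proof.
move=> mN hN hF.
have F0 : 0 <= F.
  apply: le_trans (hF (fun=> (0, 0))); rewrite /frob.
  by apply: sumr_ge0 => i _; apply: sumr_ge0 => j _; exact: sqr_ge0.
have m0 := mu_ge0.
have PT : P setT = 1%E by exact: probability_setT.
have m1 : 0 <= mu + 1 by lra.
have K0 : 0 <= 9 * (mu + 1) * F by apply: mulr_ge0 => //; apply: mulr_ge0.
pose f (x : W) := dot (entries x m k) (N x *m entries x m k) - \tr (N x).
apply: (@le_trans _ _ (\int[P]_w (9 * (mu + 1) * F)%:E)%E); last first.
  by rewrite integral_cst //= [X in (_ * X)%E]PT mule1.
apply: (@mean2_frozen (col k) f (fun=> (9 * (mu + 1) * F)%:E)) => //.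
  apply: cmeasB; last by apply: cmeas_sum => i _; exact: mN.
  have me i : cmeas (fun x => entries x m k i 0).
    by apply: eq_cmeas (entry_cmeas i k) => x; rewrite mxE.
  have := @cmeas_sum _ W R _ (index_enum 'I_m) xpredT (fun i x => ((entries x m k i 0)^*)%C *
      \sum_j N x i j * entries x m k j 0).
  move=> /(_ _)/wrap[i _|].
    apply: cmeasM; first exact: cmeas_conj.
    by apply: cmeas_sum => j _; exact: cmeasM.
  by apply: eq_cmeas => x; rewrite dotE; apply: eq_bigr => i _; congr (_ * _); rewrite [in RHS]mxE.
move=> w; have := @mean2_quadratic_mx k m (N (fam X w)).
have e0 : (9 * (mu + 1) * frob (N (fam X w)) <= 9 * (mu + 1) * F).
  by rewrite ler_wpM2l //; apply: mulr_ge0.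
move=> H; have {}H := le_trans H (_ : _ <= (9 * (mu + 1) * F)%:E)%E.
apply: le_trans (H _); last by rewrite lee_fin.
rewrite le_eqVlt; apply/orP; left; apply/eqP; apply: eq_integral => w' _.
have EN : N (mix X (col k) (w, w')) = N (fam X w).
  by apply: hN => i hi; rewrite /mix /col (negbTE hi).
have Ee : entries (mix X (col k) (w, w')) m k = entries (fam X w') m k.
  by apply/matrixP => i j; rewrite !mxE /entry /mix /col /= eqxx.
by rewrite /f EN Ee.
Qed.

End QuadraticForms.

(** * Fluctuations of the resolvent *)

Section MatrixMeasurable.
Context d (T : measurableType d) (R : realType).
Local Notation C := R[i].

Definition mx_cmeas p q (M : T -> 'M[C]_(p, q)) := forall i j, cmeas (fun t => M t i j).

Lemma mx_cmeas_cst p q (M : 'M[C]_(p, q)) : mx_cmeas (fun=> M).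
Proof. by move=> i j; exact: cmeas_cst. Qed.

Lemma mx_cmeasD p q (M N : T -> 'M[C]_(p, q)) : mx_cmeas M -> mx_cmeas N ->
  mx_cmeas (fun t => M t + N t).
Proof.
by move=> hM hN i j; apply: eq_cmeas (cmeasD (hM i j) (hN i j)) => t; rewrite mxE.
Qed.

Lemma mx_cmeasZ p q a (M : T -> 'M[C]_(p, q)) : mx_cmeas M -> mx_cmeas (fun t => a *: M t).
Proof.
move=> hM i j; have h : cmeas (fun t => a * M t i j).
  by apply: cmeasM; [exact: cmeas_cst|exact: hM].
by apply: eq_cmeas h => t; rewrite mxE.
Qed.

Lemma mx_cmeasM p q r (M : T -> 'M[C]_(p, q)) (N : T -> 'M[C]_(q, r)) :
  mx_cmeas M -> mx_cmeas N -> mx_cmeas (fun t => M t *m N t).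
Proof.
move=> hM hN i j.
have h : cmeas (fun t => \sum_k M t i k * N t k j).
  by apply: cmeas_sum => k _; apply: cmeasM; [exact: hM|exact: hN].
by apply: eq_cmeas h => t; rewrite mxE.
Qed.

Lemma mx_cmeas_adj p q (M : T -> 'M[C]_(p, q)) : mx_cmeas M -> mx_cmeas (fun t => M t ^t*).
Proof. by move=> hM i j; apply: eq_cmeas (cmeas_conj (hM j i)) => t; rewrite !mxE. Qed.

Lemma mx_cmeas_sum p q (I : Type) (r : seq I) (P : pred I) (M : I -> T -> 'M[C]_(p, q)) :
  (forall k, P k -> mx_cmeas (M k)) -> mx_cmeas (fun t => \sum_(k <- r | P k) M k t).
Proof.
move=> hM i j; have h : cmeas (fun t => \sum_(k <- r | P k) M k t i j).
  by apply: cmeas_sum => k Pk; exact: hM.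
by apply: eq_cmeas h => t; rewrite summxE.
Qed.

Lemma cmeas_trace p (M : T -> 'M[C]_p) : mx_cmeas M -> cmeas (fun t => \tr (M t)).
Proof. by move=> hM; apply: cmeas_sum => i _; exact: hM. Qed.

Lemma cmeas_det p (M : T -> 'M[C]_p) : mx_cmeas M -> cmeas (fun t => \det (M t)).
Proof.
move=> hM; apply: cmeas_sum => s _; apply: cmeasM; first exact: cmeas_cst.
by apply: cmeas_prod => i _; exact: hM.
Qed.

(** Cramer: the entries of the inverse are rational functions of those of M. *)
Lemma mx_cmeas_inv p (M : T -> 'M[C]_p) : (forall t, M t \in unitmx) -> mx_cmeas M ->
  mx_cmeas (fun t => invmx (M t)).
Proof.
move=> uM hM i j.
have h : cmeas (fun t => (\det (M t))^-1 * ((-1) ^+ (j + i) * \det (row' j (col' i (M t))))).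
  apply: cmeasM; first by apply: cmeasV; exact: cmeas_det.
  apply: cmeasM; first exact: cmeas_cst.
  apply: cmeas_det => a b; apply: eq_cmeas (hM (lift j a) (lift i b)) => t.
  by rewrite !mxE.
by apply: eq_cmeas h => t; rewrite /invmx uM !mxE.
Qed.

End MatrixMeasurable.

Section Model.
Context d (T : measurableType d) (R : realType) (P : probability T R).
Variable X : nat * nat -> T -> R[i].
Variable mu : R.
Hypotheses (mX : forall i, complex_rv (X i)) (iX : independent P X).
Hypothesis sX : forall i, standardized P mu (X i).
Local Notation C := R[i].
Local Notation I := (nat * nat)%type.
Local Notation W := (famT I R).
Local Notation PP := (P \x P)%E.
Local Notation mean2 := (mean2 P X).

Lemma le_mean2 (f : W -> C) (h : W -> R) : measurable_fun setT h ->
  cmeas f -> (forall x, cabs (f x) ^+ 2 <= h x) ->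
  (mean2 f <= \int[P]_w (h (fam X w))%:E)%E.
Proof.
move=> mh mf hf; apply: ge0_le_integral => //.
- by move=> w _; rewrite lee_fin sqr_ge0.
- exact: mean2_measurable.
- apply/measurable_EFinP; exact: (measurableT_comp mh (fam_measurable_fun mX)).
- by move=> w _; rewrite lee_fin; exact: hf.
Qed.

Lemma mean2_scaled (a : R) (f : W -> C) : 0 <= a -> cmeas f ->
  (\int[P]_w (a * cabs (f (fam X w)) ^+ 2)%:E = a%:E * mean2 f)%E.
Proof.
move=> a0 mf; under eq_integral do rewrite EFinM.
rewrite ge0_integralZl //; first exact: mean2_measurable.
by move=> w _; rewrite lee_fin sqr_ge0.
Qed.

Lemma mean2_le2 (a b r s : R) (f g h : W -> C) : cmeas f -> cmeas g -> cmeas h ->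
  0 <= a -> 0 <= b -> (forall x, cabs (f x) <= a * cabs (g x) + b * cabs (h x)) ->
  (mean2 g <= r%:E)%E -> (mean2 h <= s%:E)%E ->
  (mean2 f <= (2 * (a ^+ 2 * r + b ^+ 2 * s))%:E)%E.
Proof.
move=> mf mg mh a0 b0 hf hr hs.
have A0 : 0 <= 2 * a ^+ 2 by rewrite mulr_ge0 // sqr_ge0.
have B0 : 0 <= 2 * b ^+ 2 by rewrite mulr_ge0 // sqr_ge0.
pose g2 x := 2 * a ^+ 2 * cabs (g x) ^+ 2; pose h2 x := 2 * b ^+ 2 * cabs (h x) ^+ 2.
have mg2 : measurable_fun (setT : set W) g2.
  by apply: measurable_funM => //; exact: measurable_cabs2.
have mh2 : measurable_fun (setT : set W) h2.
  by apply: measurable_funM => //; exact: measurable_cabs2.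
have mw (u : W -> R) : measurable_fun (setT : set W) u ->
    measurable_fun setT (fun w => (u (fam X w))%:E).
  move=> mu'; apply/measurable_EFinP.
  exact: (measurableT_comp mu' (fam_measurable_fun mX)).
apply: (le_trans (le_mean2 (h := fun x => g2 x + h2 x) _ mf _)).
- exact: measurable_funD.
- move=> x; apply: (@le_trans _ _ ((a * cabs (g x) + b * cabs (h x)) ^+ 2)).
    by rewrite lerXn2r ?nnegrE ?addr_ge0 ?mulr_ge0 ?cabs_ge0.
  apply: (le_trans (sqr_sum2_le _ _)); rewrite /g2 /h2 !exprMn mulrDr.
  by rewrite !mulrA.
under eq_integral do rewrite EFinD.
rewrite ge0_integralD //; last 4 first.
- by move=> w _; rewrite lee_fin mulr_ge0 // sqr_ge0.
- exact: mw.
- by move=> w _; rewrite lee_fin mulr_ge0 // sqr_ge0.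
- exact: mw.
rewrite /g2 /h2 !mean2_scaled // mulrDr EFinD; apply: leeD.
  by rewrite mulrA [X in (_ <= X)%E]EFinM; apply: lee_wpmul2l; rewrite ?lee_fin.
by rewrite mulrA [X in (_ <= X)%E]EFinM; apply: lee_wpmul2l; rewrite ?lee_fin.
Qed.

Variables (n p : nat) (m : nat -> nat) (B : forall k, 'M[C]_(p, m k)) (A : 'M[C]_p).
Variables (K c : R) (z : C).
Hypotheses (n0 : (0 < n)%N) (K0 : 0 <= K) (c0 : 0 <= c) (hpn : p%:R / n%:R <= c).
Hypotheses (hA : nonneg_def A) (hB : forall k, (k < n)%N -> gramb K (B k)).
Hypothesis z0 : 0 < cIm z.
Local Notation v := (cIm z).
Local Notation L := (cabs z / cIm z).

Definition sample_col k (x : W) : 'cV[C]_p := B k *m entries x (m k) k.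

Lemma sample_col_cmeas k : mx_cmeas (sample_col k).
Proof.
apply: mx_cmeasM; first exact: mx_cmeas_cst.
by move=> i j; apply: eq_cmeas (entry_cmeas R i k) => x; rewrite mxE.
Qed.

(** The columns outside S are left out: S is either everything or everything but
   one column. *)
Definition cov_mx (S : pred nat) (x : W) : 'M[C]_p :=
  n%:R^-1 *: (\sum_(k < n | S k) sample_col k x *m (sample_col k x) ^t*) + A.

Definition resolvent S x : 'M[C]_p := invmx (cov_mx S x - z%:M).

Lemma cov_mx_nonneg S x : nonneg_def (cov_mx S x).
Proof.
have hs : nonneg_def (\sum_(k < n | S k) sample_col k x *m (sample_col k x) ^t*).
  elim/big_rec: _ => [|k M _ hM]; last exact: nonneg_defD (nonneg_gram _) hM.
  by move=> u; rewrite mulmx0 mul0mx mxE.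
have i0 : 0 <= (n%:R^-1 : R) by rewrite invr_ge0.
by have := nonneg_defD (nonneg_defZ i0 hs) hA; rewrite -natVC.
Qed.

Lemma cov_mx_rank1 k x : (k < n)%N ->
  cov_mx predT x = cov_mx (predC1 k) x + n%:R^-1%:C *: (sample_col k x *m (sample_col k x) ^t*).
Proof.
move=> kn; rewrite /cov_mx addrAC -natVC -scalerDr; congr (_ *: _ + _).
by rewrite (bigD1 (Ordinal kn)) //= addrC.
Qed.

Lemma pencil_resolvent_like S x : resolvent_like z (cov_mx S x - z%:M).
Proof. exact: resolvent_like_pencil z0 (cov_mx_nonneg S x). Qed.

Lemma pencil_unit S x : cov_mx S x - z%:M \in unitmx.
Proof. exact: coercive_unit z0 (pencil_resolvent_like S x).1. Qed.

Lemma resolvent_opb S x : opb v^-1 (resolvent S x).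
Proof. exact: coercive_opb z0 (pencil_resolvent_like S x).1. Qed.

Lemma resolvent_cmeas S : mx_cmeas (resolvent S).
Proof.
apply: mx_cmeas_inv; first exact: pencil_unit.
apply: mx_cmeasD; last exact: mx_cmeas_cst.
apply: mx_cmeasD; last exact: mx_cmeas_cst.
apply: mx_cmeasZ; apply: mx_cmeas_sum => k _; have h := sample_col_cmeas k.
by apply: mx_cmeasM => //; exact: mx_cmeas_adj.
Qed.

Lemma resolvent_local S (x y : W) :
  (forall i, S i.2 && (i.2 < n)%N -> x i = y i) -> resolvent S x = resolvent S y.
Proof.
move=> xy.
have E k : S k && (k < n)%N -> sample_col k x = sample_col k y.
  move=> kn; rewrite /sample_col; suff -> : entries x (m k) k = entries y (m k) k by [].
  by apply/matrixP => i j; rewrite !mxE /entry xy.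
suff h : cov_mx S x = cov_mx S y by rewrite /resolvent h.
suff h : \sum_(k < n | S k) sample_col k x *m (sample_col k x) ^t* =
    \sum_(k < n | S k) sample_col k y *m (sample_col k y) ^t*.
  exact: (congr1 (fun M => n%:R^-1 *: M + A) h).
by apply: eq_bigr => k Sk; rewrite E // Sk ltn_ord.
Qed.

Local Notation Sig k := (B k *m (B k) ^t*).

Definition form k (M : W -> 'M[C]_p) x : C := n%:R^-1 * dot (sample_col k x) (M x *m sample_col k x).
Definition form_mean k (M : W -> 'M[C]_p) x : C := n%:R^-1 * \tr (M x *m Sig k).

Definition form_dev (s : R) : R := 9 * (mu + 1) * K ^+ 2 * c * s ^+ 2.

Lemma form_dev_ge0 s : 0 <= form_dev s.
Proof.
have := mu_ge0 sX => m0; have m1 : 0 <= mu + 1 by lra.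
by rewrite /form_dev; do 3![apply: mulr_ge0; rewrite ?sqr_ge0 //]; apply: mulr_ge0.
Qed.

(** Column by column: with b a column of B_k, the column of the compressed matrix
   is the image under B_k^* of M b. *)
Lemma frob_compress k (M : 'M[C]_p) s : (k < n)%N -> 0 <= s -> opb s M ->
  frob ((B k) ^t* *m M *m B k) <= K ^+ 2 * s ^+ 2 * p%:R.
Proof.
move=> kn s0 hM; set N := _ *m B k.
have -> : frob N = \sum_j l2norm (matrix.col j N) ^+ 2.
  rewrite /frob exchange_big /=; apply: eq_bigr => j _; rewrite nrm_sqr.
  by apply: eq_bigr => i _; rewrite !mxE.
apply: (@le_trans _ _ (\sum_j K * (s ^+ 2 * l2norm (matrix.col j (B k)) ^+ 2))).
  apply: ler_sum => j _.
  have -> : matrix.col j N = (B k) ^t* *m (M *m matrix.col j (B k)).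
    by rewrite /N !colE !mulmxA.
  apply: (le_trans (hB kn _)); apply: ler_wpM2l => //.
  rewrite -exprMn lerXn2r ?nnegrE ?mulr_ge0 ?nrm_ge0 //.
rewrite -!mulr_sumr -/(gram_tr (B k)).
have := gram_tr_le (hB kn) => h.
have -> : K ^+ 2 * s ^+ 2 * p%:R = K * (s ^+ 2 * (K * p%:R)) by ring.
by apply: ler_wpM2l => //; apply: ler_wpM2l => //; exact: sqr_ge0.
Qed.

(** The form in y_k is a form in the independent entries, with matrix B_k^* M B_k. *)
Lemma form_mean_deviation k (M : W -> 'M[C]_p) s : (k < n)%N -> 0 <= s ->
  mx_cmeas M -> (forall x y : W, (forall i, i.2 != k -> x i = y i) -> M x = M y) ->
  (forall x, opb s (M x)) ->
  (mean2 (fun x => form k M x - form_mean k M x)%R <= (form_dev s / n%:R)%:E)%E.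
Proof.
move=> kn s0 mM hM oM.
pose N x := (B k) ^t* *m M x *m B k.
have mN : mx_cmeas N.
  by apply: mx_cmeasM; [apply: mx_cmeasM|]; rewrite //; exact: mx_cmeas_cst.
have hN x y : (forall i, i.2 != k -> x i = y i) -> N x = N y by move=> /hM; rewrite /N => ->.
have H := mean2_quadratic_column mX iX sX mN hN (fun x => frob_compress kn s0 (oM x)).
pose g x : C := dot (entries x (m k) k) (N x *m entries x (m k) k) - \tr (N x).
have E : (fun x => form k M x - form_mean k M x) = (fun x => (n%:R^-1 : R)%:C * g x).
  apply/funext => x; rewrite /form /form_mean -natVC -mulrBr; congr (_ * (_ - _)).
    by rewrite /sample_col /N /dot adjM !mulmxA.
  by rewrite /N mulmxA [LHS]mxtrace_mulC mulmxA.
have mg : cmeas g.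
  apply: cmeasB; last exact: cmeas_trace.
  have me : mx_cmeas (fun x : W => entries x (m k) k).
    by move=> i j; apply: eq_cmeas (entry_cmeas R i k) => x; rewrite mxE.
  exact: (mx_cmeasM (mx_cmeas_adj me) (mx_cmeasM mN me) 0 0).
have n1 : 0 <= (n%:R^-1 : R) by rewrite invr_ge0.
rewrite E /mean2.
under eq_integral do rewrite cabsM cabsR (ger0_norm n1) exprMn.
rewrite mean2_scaled ?sqr_ge0 //.
apply: (le_trans (lee_wpmul2l _ H)); first by rewrite lee_fin sqr_ge0.
rewrite -EFinM lee_fin.
have -> : n%:R^-1 ^+ 2 * (9 * (mu + 1) * (K ^+ 2 * s ^+ 2 * p%:R)) =
   9 * (mu + 1) * K ^+ 2 * s ^+ 2 / n%:R * (p%:R / n%:R) by ring.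
have -> : form_dev s / n%:R = 9 * (mu + 1) * K ^+ 2 * s ^+ 2 / n%:R * c by rewrite /form_dev; ring.
apply: ler_wpM2l => //; apply: mulr_ge0 => //.
have := mu_ge0 sX => m0; have m1 : 0 <= mu + 1 by lra.
by do 2![apply: mulr_ge0; rewrite ?sqr_ge0 //]; apply: mulr_ge0.
Qed.

Local Notation Rk k := (resolvent (predC1 (k : nat))).

Lemma form_cmeas k M : mx_cmeas M -> cmeas (form k M).
Proof.
move=> mM; apply: cmeasM; first exact: cmeas_cst.
have h := sample_col_cmeas k.
exact: (mx_cmeasM (mx_cmeas_adj h) (mx_cmeasM mM h) 0 0).
Qed.

Lemma form_mean_cmeas k M : mx_cmeas M -> cmeas (form_mean k M).
Proof.
move=> mM; apply: cmeasM; first exact: cmeas_cst.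
apply: cmeas_trace; apply: mx_cmeasM => //; exact: mx_cmeas_cst.
Qed.

Lemma form_mean_le k M s x : (k < n)%N -> 0 <= s -> opb s (M x) ->
  cabs (form_mean k M x) <= s * K * c.
Proof.
move=> kn s0 hM; rewrite /form_mean natVC cabsM cabsR ger0_norm ?invr_ge0 //.
apply: (@le_trans _ _ (n%:R^-1 * (s * (K * p%:R)))).
  apply: ler_wpM2l; first by rewrite invr_ge0.
  apply: (le_trans (mxtrace_gram_le _ hM)).
  by apply: ler_wpM2l => //; exact: gram_tr_le (hB kn).
have -> : n%:R^-1 * (s * (K * p%:R)) = s * K * (p%:R / n%:R) by ring.
by apply: ler_wpM2l => //; exact: mulr_ge0.
Qed.

Lemma form_good k x : good z (form k (Rk k) x).
Proof.
have i0 : 0 <= (n%:R^-1 : R) by rewrite invr_ge0.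
rewrite /form natVC; apply: goodZ => //.
exact: good_dot z0 (pencil_resolvent_like (predC1 k) x).
Qed.

Lemma trace_good k S x : good z (n%:R^-1 * \tr (Sig k *m resolvent S x)).
Proof.
have i0 : 0 <= (n%:R^-1 : R) by rewrite invr_ge0.
rewrite natVC; apply: goodZ => //.
exact: good_gram z0 (pencil_resolvent_like S x).
Qed.

Lemma form_mean_good k x : good z (form_mean k (Rk k) x).
Proof. by rewrite /form_mean mxtrace_mulC; exact: trace_good. Qed.

(** The denominators cost a factor |z| / Im z each, as b and b0 are good. *)
Lemma ratio_diff (t t0 b b0 : C) (tau : R) : good z b -> good z b0 -> cabs t0 <= tau ->
  cabs (t / (1 + b) - t0 / (1 + b0)) <= L * cabs (t - t0) + L ^+ 2 * tau * cabs (b - b0).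
Proof.
move=> gb gb0 ht.
have h1 := good_neq0 z0 gb; have h2 := good_neq0 z0 gb0.
have i1 := good_inv z0 gb; have i2 := good_inv z0 gb0.
have L0 : 0 <= L by rewrite divr_ge0 ?cabs_ge0 // ltW.
have -> : t / (1 + b) - t0 / (1 + b0) = (1 + b)^-1 * (t - t0) -
    (1 + b)^-1 * (1 + b0)^-1 * t0 * (b - b0) by field; rewrite h1 h2.
apply: (le_trans (cabsB _ _)); rewrite !cabsM; apply: lerD.
  by rewrite ler_wpM2r ?cabs_ge0.
rewrite ler_wpM2r ?cabs_ge0 // expr2.
by apply: ler_pM; rewrite ?mulr_ge0 ?cabs_ge0 // ler_pM ?cabs_ge0.
Qed.

Lemma resolvent_k_indep k (x y : W) : (forall i, i.2 != k -> x i = y i) -> Rk k x = Rk k y.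
Proof. by move=> xy; apply: resolvent_local => i /andP[h _]; exact: xy. Qed.

Definition res_trace (Q : 'M[C]_p) x : C := n%:R^-1 * \tr (Q *m resolvent predT x).

Lemma res_trace_cmeas Q : cmeas (res_trace Q).
Proof.
apply: cmeasM; first exact: cmeas_cst.
apply: cmeas_trace; apply: mx_cmeasM; [exact: mx_cmeas_cst|exact: resolvent_cmeas].
Qed.

Lemma res_trace_local Q (x y : W) : (forall i, (i.2 < n)%N -> x i = y i) -> res_trace Q x = res_trace Q y.
Proof. by move=> xy; rewrite /res_trace (@resolvent_local predT x y). Qed.

Lemma res_trace_le Q q x : 0 <= q -> opb q Q -> cabs (res_trace Q x) <= q / v * c.
Proof.
move=> q0 hQ; rewrite /res_trace natVC cabsM cabsR ger0_norm ?invr_ge0 //.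
have g1 : gramb 1 (1%:M : 'M[C]_p) by move=> u; rewrite trmx1 map_mx1 mul1mx mul1r.
have hR : opb (q / v) (Q *m resolvent predT x) by apply: opbM => //; exact: resolvent_opb.
have := mxtrace_gram_le 1%:M hR; rewrite trmx1 map_mx1 !mulmx1 => h.
have qv : 0 <= q / v by rewrite divr_ge0 // ltW.
apply: (@le_trans _ _ (n%:R^-1 * (q / v * p%:R))).
  apply: ler_wpM2l; first by rewrite invr_ge0.
  apply: (le_trans h); apply: ler_wpM2l => //.
  by have := gram_tr_le g1; rewrite mul1r.
have -> : n%:R^-1 * (q / v * p%:R) = q / v * (p%:R / n%:R) by ring.
exact: ler_wpM2l.
Qed.

(** The effect of a column on the resolvent is a ratio of two quadratic forms in
   this column. *)
Lemma res_trace_rank1 k Q x : (k < n)%N ->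
  res_trace Q x = n%:R^-1 * \tr (Q *m Rk k x) -
    n%:R^-1 * (form k (fun x => Rk k x *m Q *m Rk k x) x / (1 + form k (Rk k) x)).
Proof.
move=> kn; have i0 : 0 <= (n%:R^-1 : R) by rewrite invr_ge0.
have gen (a b i w : C) : a - b = - w -> i * a = i * b - i * w.
  by move/eqP; rewrite subr_eq => /eqP ->; rewrite mulrDr mulrN addrC.
apply: gen; rewrite {1}/resolvent (cov_mx_rank1 x kn) /form natVC.
exact: rank1_trace (cov_mx_nonneg (predC1 k) x) i0 z0 Q.
Qed.

Definition tau (q : R) : R := q / v ^+ 2 * K * c.

Definition fluct (q : R) : R :=
  8 * (L ^+ 2 * form_dev (q / v ^+ 2) + (L ^+ 2 * tau q) ^+ 2 * form_dev v^-1).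

Lemma RQR_opb k Q q x : 0 <= q -> opb q Q -> opb (q / v ^+ 2) (Rk k x *m Q *m Rk k x).
Proof.
move=> q0 hQ; have -> : q / v ^+ 2 = v^-1 * q * v^-1 by field; rewrite gt_eqF.
have v0 : 0 <= v^-1 by rewrite invr_ge0 ltW.
apply: opbM; first exact: mulr_ge0.
  apply: opbM => //; exact: resolvent_opb.
exact: resolvent_opb.
Qed.

(** Replacing the two quadratic forms in y_k by their means gives an approximation
   that ignores column k, with an error of size n^-1 times a deviation of order
   n^-1/2; there are n columns. *)
Lemma res_trace_variance Q q : 0 <= q -> opb q Q ->
  (\int[PP]_w (cabs (res_trace Q (fam X w.1) - res_trace Q (fam X w.2)) ^+ 2)%:E
    <= (fluct q / n%:R ^+ 2)%:E)%E.
Proof.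
move=> q0 hQ; pose M k x := Rk k x *m Q *m Rk k x.
have v0 : 0 <= v^-1 by rewrite invr_ge0 ltW.
have i0 : 0 <= (n%:R^-1 : R) by rewrite invr_ge0.
have L0 : 0 <= L by rewrite divr_ge0 ?cabs_ge0 // ltW.
have s0 : 0 <= q / v ^+ 2 by rewrite divr_ge0 // sqr_ge0.
have t0 : 0 <= tau q by rewrite /tau; apply: mulr_ge0 => //; exact: mulr_ge0.
have mM k : mx_cmeas (M k).
  apply: mx_cmeasM; last exact: resolvent_cmeas.
  by apply: mx_cmeasM; [exact: resolvent_cmeas|exact: mx_cmeas_cst].
have iM k (x y : W) : (forall i, i.2 != k -> x i = y i) -> M k x = M k y.
  by move=> /resolvent_k_indep; rewrite /M => ->.
pose ck k x := n%:R^-1 * \tr (Q *m Rk k x) - n%:R^-1 * (form_mean k (M k) x / (1 + form_mean k (Rk k) x)).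
have mc k : cmeas (ck k).
  apply: cmeasB; apply: cmeasM; try exact: cmeas_cst.
    by apply: cmeas_trace; apply: mx_cmeasM; [exact: mx_cmeas_cst|exact: resolvent_cmeas].
  apply: cmeasM; first exact: form_mean_cmeas.
  apply: cmeasV; apply: cmeasD; first exact: cmeas_cst.
  by apply: form_mean_cmeas; exact: resolvent_cmeas.
have ic k (x y : W) : (forall i, i.2 != k -> x i = y i) -> ck k x = ck k y.
  by move=> /[dup] /iM h1 /resolvent_k_indep h2; rewrite /ck /form_mean h1 h2.
apply: (le_trans (efron_stein mX iX (res_trace_cmeas Q) (fun x => res_trace_le x q0 hQ)
  (@res_trace_local Q) mc ic)).
set D := 2 * ((n%:R^-1 * L) ^+ 2 * (form_dev (q / v ^+ 2) / n%:R) +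
  (n%:R^-1 * (L ^+ 2 * tau q)) ^+ 2 * (form_dev v^-1 / n%:R)).
have hk (k : 'I_n) : (mean2 (fun x => res_trace Q x - ck k x)%R <= D%:E)%E.
  have := @mean2_le2 (n%:R^-1 * L) (n%:R^-1 * (L ^+ 2 * tau q)) (form_dev (q / v ^+ 2) / n%:R)
    (form_dev v^-1 / n%:R) (fun x => res_trace Q x - ck k x)
    (fun x => form k (M k) x - form_mean k (M k) x)
    (fun x => form k (Rk k) x - form_mean k (Rk k) x).
  rewrite -/D; apply.
  - by apply: cmeasB => //; exact: res_trace_cmeas.
  - by apply: cmeasB; [exact: form_cmeas|exact: form_mean_cmeas].
  - have h := resolvent_cmeas (predC1 (k : nat)).
    by apply: cmeasB; [exact: form_cmeas|exact: form_mean_cmeas].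
  - exact: mulr_ge0.
  - by apply: mulr_ge0 => //; apply: mulr_ge0 => //; exact: sqr_ge0.
  - move=> x; rewrite (res_trace_rank1 Q x (ltn_ord k)) /ck.
    set a := n%:R^-1 * \tr _; set u := _ / (1 + form _ _ _); set w := _ / (1 + form_mean _ _ _).
    have -> : a - n%:R^-1 * u - (a - n%:R^-1 * w) = - (n%:R^-1 * (u - w)) by ring.
    rewrite cabsN natVC cabsM cabsR (ger0_norm i0).
    rewrite -[n%:R^-1 * L * _]mulrA -[n%:R^-1 * _ * cabs (_ - _)]mulrA -mulrDr.
    apply: ler_wpM2l => //; apply: ratio_diff; first exact: form_good.
      exact: form_mean_good.
    by apply: form_mean_le => //; exact: RQR_opb.
  - exact: (@form_mean_deviation k (M k) _ (ltn_ord k) s0 (mM k) (iM k) (fun x => RQR_opb k x q0 hQ)).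
  - exact: (@form_mean_deviation k (Rk k) _ (ltn_ord k) v0 (resolvent_cmeas _)
      (@resolvent_k_indep k) (resolvent_opb _)).
apply: (@le_trans _ _ (\sum_(k < n) (4 * D)%:E)%E).
  by apply: lee_sum => k _; rewrite EFinM; apply: lee_wpmul2l => //; exact: hk.
rewrite sumEFin sumr_const card_ord lee_fin -[leLHS]mulr_natl le_eqVlt.
apply/orP; left; apply/eqP; rewrite /D /fluct.
have n1 : n%:R != 0 :> R by rewrite pnatr_eq0 -lt0n.
move: (form_dev _) (form_dev _) (tau q) => d1 d2 t.
by field; rewrite n1 gt_eqF.
Qed.

Lemma mean2_cst (a : C) : mean2 (fun=> a) = (cabs a ^+ 2)%:E.
Proof.
have PT : P setT = 1%E by exact: probability_setT.
by rewrite /mean2 integral_cst //= [X in (_ * X)%E]PT mule1.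
Qed.

Lemma avg_sqr (a : 'I_n -> R) :
  (n%:R^-1 * \sum_(k < n) a k) ^+ 2 <= n%:R^-1 * \sum_(k < n) a k ^+ 2.
Proof.
have n1 : n%:R != 0 :> R by rewrite pnatr_eq0 -lt0n.
have i0 : 0 <= (n%:R^-1 : R) by rewrite invr_ge0.
set s := n%:R^-1 * _.
have : 0 <= n%:R^-1 * \sum_(k < n) (a k - s) ^+ 2.
  by apply: mulr_ge0 => //; apply: sumr_ge0 => k _; exact: sqr_ge0.
have -> : \sum_(k < n) (a k - s) ^+ 2 =
    \sum_(k < n) a k ^+ 2 - 2 * s * \sum_(k < n) a k + n%:R * s ^+ 2.
  have -> : n%:R * s ^+ 2 = \sum_(k < n) s ^+ 2 by rewrite sumr_const card_ord mulr_natl.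
  rewrite mulr_sumr -sumrB -big_split /=.
  by apply: eq_bigr => k _; ring.
have -> : \sum_(k < n) a k = n%:R * s by rewrite /s mulrA mulfV // mul1r.
have gen (t r : R) : n%:R^-1 * (t - 2 * r * (n%:R * r) + n%:R * r ^+ 2) = n%:R^-1 * t - r ^+ 2.
  by field.
by rewrite gen subr_ge0.
Qed.

Lemma cabs_avg_sqr (g : 'I_n -> C) :
  cabs (n%:R^-1 * \sum_(k < n) g k) ^+ 2 <= n%:R^-1 * \sum_(k < n) cabs (g k) ^+ 2.
Proof.
have i0 : 0 <= (n%:R^-1 : R) by rewrite invr_ge0.
apply: le_trans (avg_sqr (fun k => cabs (g k))).
rewrite natVC cabsM cabsR (ger0_norm i0) lerXn2r ?nnegrE ?mulr_ge0 ?cabs_ge0 //.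
  by apply: sumr_ge0 => k _; exact: cabs_ge0.
by apply: ler_wpM2l => //; exact: cabs_sum.
Qed.

(** Convexity of the square, coordinate by coordinate of the average. *)
Lemma mean2_avg (g : 'I_n -> W -> C) : (forall k, cmeas (g k)) ->
  (mean2 (fun x => n%:R^-1 * \sum_(k < n) g k x)%R <=
    (n%:R^-1)%:E * \sum_(k < n) mean2 (g k))%E.
Proof.
move=> mg; have i0 : 0 <= (n%:R^-1 : R) by rewrite invr_ge0.
pose h x := n%:R^-1 * \sum_(k < n) cabs (g k x) ^+ 2.
have mh : measurable_fun (setT : set W) h.
  apply: measurable_funM => //; apply: measurable_sum => k.
  exact: measurable_cabs2.
apply: (le_trans (le_mean2 mh _ (fun x => cabs_avg_sqr _))).
  by apply: cmeasM; [exact: cmeas_cst|exact: cmeas_sum].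
rewrite /h; under eq_integral do rewrite EFinM.
have m2 k : measurable_fun setT (fun w => (cabs (g k (fam X w)) ^+ 2)%:E).
  exact: mean2_measurable.
have p2 k w : (0 <= (cabs (g k (fam X w)) ^+ 2)%:E)%E by rewrite lee_fin sqr_ge0.
under eq_integral do rewrite -sumEFin.
rewrite ge0_integralZl //; last 2 first.
- exact: emeasurable_sum.
- by move=> w _; apply: sume_ge0.
by rewrite ge0_integral_sum.
Qed.

(** ** Comparison with the deterministic equivalent *)

Local Notation Bn := (fun k : 'I_n => B k).

Let v0 : 0 <= v^-1. Proof. by rewrite invr_ge0 ltW. Qed.
Let i0 : 0 <= (n%:R^-1 : R). Proof. by rewrite invr_ge0. Qed.
Let L0 : 0 <= L. Proof. by rewrite divr_ge0 ?cabs_ge0 // ltW. Qed.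

Lemma tau_ge0 q : 0 <= q -> 0 <= tau q.
Proof.
move=> q0; rewrite /tau; apply: mulr_ge0 => //; apply: mulr_ge0 => //.
by rewrite divr_ge0 // sqr_ge0.
Qed.

(** The two pencils differ by a matrix of rank one. *)
Lemma trace_column k M q x : (k < n)%N -> 0 <= q -> opb q M ->
  cabs (n%:R^-1 * \tr (M *m resolvent predT x) - n%:R^-1 * \tr (M *m Rk k x)) <=
  n%:R^-1 * (q / v).
Proof.
move=> kn q0 hM; rewrite -mulrBr natVC cabsM cabsR (ger0_norm i0).
apply: ler_wpM2l => //; rewrite {1}/resolvent (cov_mx_rank1 x kn).
exact: (rank1_trace_le (sample_col k x) (cov_mx_nonneg (predC1 k) x) i0 z0 q0 hM).
Qed.

Lemma trace_sample_col G x k : (k < n)%N ->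
  n%:R^-1 * \tr (G *m (sample_col k x *m (sample_col k x) ^t*) *m resolvent predT x) =
  form k (fun x => Rk k x *m G) x / (1 + form k (Rk k) x).
Proof.
move=> kn.
have h : (sample_col k x) ^t* *m resolvent predT x =
    (1 + form k (Rk k) x)^-1 *: ((sample_col k x) ^t* *m Rk k x).
  rewrite {1}/resolvent (cov_mx_rank1 x kn) /form natVC.
  exact: rank1_mull (cov_mx_nonneg (predC1 k) x) i0 z0.
have -> : G *m (sample_col k x *m (sample_col k x) ^t*) *m resolvent predT x =
    (G *m sample_col k x) *m ((sample_col k x) ^t* *m resolvent predT x) by rewrite !mulmxA.
rewrite h -scalemxAr mxtraceZ mxtrace_mulC trace_mx11.
move: (1 + _)^-1 => f; rewrite /form /dot.
have -> : (sample_col k x) ^t* *m Rk k x *m (G *m sample_col k x) =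
    (sample_col k x) ^t* *m (Rk k x *m G *m sample_col k x) by rewrite !mulmxA.
by rewrite mulrCA mulrC.
Qed.

(** The contribution of column k to the difference between the resolvent and the
   deterministic equivalent, with G the deterministic resolvent up to a factor. *)
Definition summand (G : 'M[C]_p) (e : 'I_n -> C) (k : 'I_n) x : C :=
  form_mean k (fun x => resolvent predT x *m G) x / (1 + e k) -
  form k (fun x => Rk k x *m G) x / (1 + form k (Rk k) x).

Lemma summand_cmeas G e k : cmeas (summand G e k).
Proof.
have mRk := resolvent_cmeas (predC1 (k : nat)).
apply: cmeasB; apply: cmeasM; try exact: cmeas_cst.
- by apply: form_mean_cmeas; apply: mx_cmeasM; [exact: resolvent_cmeas|exact: mx_cmeas_cst].
- by apply: form_cmeas; apply: mx_cmeasM => //; exact: mx_cmeas_cst.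
- apply: cmeasV; apply: cmeasD; first exact: cmeas_cst.
  exact: form_cmeas.
Qed.

(** The difference of the inverses of X and Y is X^-1 (Y - X) Y^-1, and the
   difference of the two matrices is a sum over the columns. *)
Lemma res_trace_det_map Q e x : (forall k, good z (e k)) ->
  res_trace Q x - det_map Bn A z Q e =
  n%:R^-1 * \sum_(k < n) summand (Q *m invmx (det_mx Bn A z e)) e k x.
Proof.
move=> ge; have ue := det_mx_unit Bn hA z0 ge; have ux := pencil_unit predT x.
set G := Q *m _.
have E : det_mx Bn A z e - (cov_mx predT x - z%:M) =
   n%:R^-1 *: \sum_(k < n) ((1 + e k)^-1 *: Sig k - sample_col k x *m (sample_col k x) ^t*).
  by rewrite /det_mx /cov_mx opprB addrA subrK opprD addrACA subrr addr0 -scalerBr -sumrB.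
rewrite /res_trace /det_map -mulrBr -raddfB /= -mulmxBr.
have -> : resolvent predT x - invmx (det_mx Bn A z e) =
    invmx (det_mx Bn A z e) *m (det_mx Bn A z e - (cov_mx predT x - z%:M)) *m
    resolvent predT x.
  by rewrite -[LHS]opprB (invmxB ue ux) -mulNmx -mulmxN opprB.
rewrite E !mulmxA -/G -scalemxAr -scalemxAl mxtraceZ mulmx_sumr mulmx_suml raddf_sum mulr_sumr /=.
congr (_ * _); apply: eq_bigr => k _.
rewrite mulmxBr mulmxBl raddfB /= mulrBr /summand -trace_sample_col //; congr (_ - _).
rewrite -scalemxAr -scalemxAl mxtraceZ mulrCA mulrC /form_mean; congr (_ * _ * _).
by rewrite [LHS]mxtrace_mulC !mulmxA.
Qed.

Definition removal_cost q : R := L * (q / v * K / v) + L ^+ 2 * tau q * (K / v).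

Lemma summand_split (s1 s t b b0 l ek : C) (a1 a2 M : R) : 0 <= M ->
  cabs (s1 - s) <= a1 -> cabs (l - b0) <= a2 -> cabs (1 + ek)^-1 <= L ->
  cabs (t / (1 + b) - s / (1 + ek)) <= L * cabs (t - s) + M * cabs (b - ek) ->
  cabs (s1 / (1 + ek) - t / (1 + b)) <=
    (L * a1 + M * a2) + L * cabs (t - s) + M * (cabs (b - b0) + cabs (l - ek)).
Proof.
move=> M0 h1 h2 h3 h4.
have -> : s1 / (1 + ek) - t / (1 + b) =
    (s1 - s) * (1 + ek)^-1 - (t / (1 + b) - s / (1 + ek)) by ring.
apply: (le_trans (cabsB _ _)); rewrite cabsM.
have k1 : cabs (s1 - s) * cabs (1 + ek)^-1 <= L * a1.
  by rewrite mulrC; apply: ler_pM; rewrite ?cabs_ge0.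
have k2 : cabs (b - ek) <= cabs (b - b0) + a2 + cabs (l - ek).
  have -> : b - ek = (b - b0) - (l - b0) + (l - ek) by ring.
  apply: (le_trans (cabsD _ _)); apply: lerD => //.
  by apply: (le_trans (cabsB _ _)); apply: lerD.
apply: (le_trans (lerD k1 h4)).
have := ler_wpM2l M0 k2; rewrite !mulrDr; lra.
Qed.

(** Both ratios are compared with the mean of the second quadratic form over
   1 + e_k: the errors are the effect of removing column k from a trace, which is
   O(1/n), the deviations of two quadratic forms from their means, and the
   distance of e_k to n^-1 tr Sigma_k R. *)
Lemma summand_le G q e (k : 'I_n) x : 0 <= q -> opb (q / v) G -> good z (e k) ->
  cabs (summand G e k x) <= n%:R^-1 * removal_cost q +
    L * cabs (form k (fun x => Rk k x *m G) x - form_mean k (fun x => Rk k x *m G) x) +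
    L ^+ 2 * tau q * (cabs (form k (Rk k) x - form_mean k (Rk k) x) +
                      cabs (res_trace (Sig k) x - e k)).
Proof.
move=> q0 hG ge; have qv : 0 <= q / v by rewrite divr_ge0 // ltW.
have hB' := gramb_opb K0 (hB (ltn_ord k)).
have hR : opb (q / v ^+ 2) (Rk k x *m G).
  have -> : q / v ^+ 2 = v^-1 * (q / v) by field; rewrite gt_eqF.
  by apply: opbM => //; exact: resolvent_opb.
have s0 : 0 <= q / v ^+ 2 by rewrite divr_ge0 // sqr_ge0.
have ts := @form_mean_le k (fun x => Rk k x *m G) _ x (ltn_ord k) s0 hR.
have h1 := @trace_column k (G *m Sig k) _ x (ltn_ord k) (mulr_ge0 qv K0) (opbM qv hG hB').
have h2 := @trace_column k (Sig k) _ x (ltn_ord k) K0 hB'.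
have h3 := ratio_diff (form k (fun x => Rk k x *m G) x) (form_good k x) ge ts.
have tE (S : pred nat) : n%:R^-1 * \tr (G *m Sig k *m resolvent S x) =
    form_mean k (fun x => resolvent S x *m G) x.
  rewrite /form_mean; congr (_ * _); rewrite [LHS]mxtrace_mulC.
  by congr (\tr _); rewrite !mulmxA.
have e3 : n%:R^-1 * \tr (Sig k *m Rk k x) = form_mean k (Rk k) x.
  by rewrite /form_mean; congr (_ * _); rewrite [LHS]mxtrace_mulC.
have h1' : cabs (form_mean k (fun x => resolvent predT x *m G) x -
    form_mean k (fun x => Rk k x *m G) x) <= n%:R^-1 * (q / v * K / v).
  rewrite -[X in cabs (X - _)](tE predT) -[X in cabs (_ - X)](tE (predC1 (k : nat))).
  exact: h1.
have h2' : cabs (res_trace (Sig k) x - form_mean k (Rk k) x) <= n%:R^-1 * (K / v).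
  by rewrite -[X in cabs (_ - X)]e3; exact: h2.
have M0 : 0 <= L ^+ 2 * tau q by apply: mulr_ge0; rewrite ?sqr_ge0 ?tau_ge0.
have H := summand_split M0 h1' h2' (good_inv z0 ge) h3.
apply: (le_trans H).
have gen (i l a b g u w : R) : l * (i * a) + g * (i * b) + u + w <=
    i * (l * a + g * b) + u + w.
  by rewrite le_eqVlt; apply/orP; left; apply/eqP; ring.
exact: gen.
Qed.

Lemma mean2_summand G q e (k : 'I_n) r : 0 <= q -> opb (q / v) G -> good z (e k) ->
  (mean2 (fun x => res_trace (Sig k) x - e k)%R <= r%:E)%E ->
  (mean2 (summand G e k) <= (4 * ((n%:R^-1 * removal_cost q) ^+ 2 + L ^+ 2 * (form_dev (q / v ^+ 2) / n%:R) +
     (L ^+ 2 * tau q) ^+ 2 * (form_dev v^-1 / n%:R + r)))%:E)%E.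
Proof.
move=> q0 hG ge hr.
have qv : 0 <= q / v by rewrite divr_ge0 // ltW.
have s0 : 0 <= q / v ^+ 2 by rewrite divr_ge0 // sqr_ge0.
pose M x := Rk k x *m G.
have mRk := resolvent_cmeas (predC1 (k : nat)).
have mM : mx_cmeas M by apply: mx_cmeasM => //; exact: mx_cmeas_cst.
have mU : cmeas (fun x => form k M x - form_mean k M x).
  by apply: cmeasB; [exact: form_cmeas|exact: form_mean_cmeas].
have mV : cmeas (fun x => form k (Rk k) x - form_mean k (Rk k) x).
  by apply: cmeasB; [exact: form_cmeas|exact: form_mean_cmeas].
have ml : cmeas (fun x => res_trace (Sig k) x - e k).
  by apply: cmeasB; [exact: res_trace_cmeas|exact: cmeas_cst].
have iM (x y : W) : (forall i, i.2 != (k : nat) -> x i = y i) -> M x = M y.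
  by move=> /resolvent_k_indep; rewrite /M => ->.
have oM x : opb (q / v ^+ 2) (M x).
  have -> : q / v ^+ 2 = v^-1 * (q / v) by field; rewrite gt_eqF.
  by apply: opbM => //; exact: resolvent_opb.
have dM := @form_mean_deviation k M _ (ltn_ord k) s0 mM iM oM.
have dR := @form_mean_deviation k (Rk k) _ (ltn_ord k) v0 mRk (@resolvent_k_indep k) (resolvent_opb _).
have M0 : 0 <= L ^+ 2 * tau q by apply: mulr_ge0; rewrite ?sqr_ge0 ?tau_ge0.
have k0 : 0 <= n%:R^-1 * removal_cost q.
  apply: mulr_ge0 => //; apply: addr_ge0; apply: mulr_ge0 => //.
    by rewrite divr_ge0 ?mulr_ge0 // ltW.
  by rewrite divr_ge0 // ltW.
pose g x := (n%:R^-1 * removal_cost q * 1 + L * cabs (form k M x - form_mean k M x))%:C : C.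
pose h x := (1 * cabs (form k (Rk k) x - form_mean k (Rk k) x) + 1 * cabs (res_trace (Sig k) x - e k))%:C : C.
have gE x : cabs (g x) = n%:R^-1 * removal_cost q * 1 + L * cabs (form k M x - form_mean k M x).
  by rewrite cabsR ger0_norm // mulr1 addr_ge0 // mulr_ge0 ?cabs_ge0.
have hE x : cabs (h x) = 1 * cabs (form k (Rk k) x - form_mean k (Rk k) x) +
    1 * cabs (res_trace (Sig k) x - e k).
  by rewrite cabsR ger0_norm // !mul1r addr_ge0 ?cabs_ge0.
have mg : cmeas g.
  apply: cmeas_real; apply: measurable_funD; first exact: measurable_cst.
  by apply: measurable_funM => //; exact: measurable_cabs.
have mh : cmeas h.
  apply: cmeas_real; apply: measurable_funD; apply: measurable_funM => //; exact: measurable_cabs.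
have c1 : (mean2 (fun=> (1 : C)%R) <= (1 : R)%:E)%E by rewrite mean2_cst cabs1 expr1n.
have gE' x : cabs (g x) <= n%:R^-1 * removal_cost q * cabs (1 : C) +
    L * cabs (form k M x - form_mean k M x) by rewrite gE cabs1.
have bg := mean2_le2 mg (@cmeas_cst _ W R 1) mU k0 L0 gE' c1 dM.
have hE' x : cabs (h x) <= 1 * cabs (form k (Rk k) x - form_mean k (Rk k) x) +
    1 * cabs (res_trace (Sig k) x - e k) by rewrite hE.
have bh := mean2_le2 mh mV ml ler01 ler01 hE' dR hr.
have ms := summand_cmeas G e k.
have sE x : cabs (summand G e k x) <= 1 * cabs (g x) + L ^+ 2 * tau q * cabs (h x).
  apply: (le_trans (summand_le x q0 hG ge)); rewrite gE hE !mul1r mulr1.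
  exact: lexx.
apply: (le_trans (mean2_le2 ms mg mh ler01 M0 sE bg bh)).
move: (form_dev _) (form_dev _) (tau _) => d1 d2 t; rewrite lee_fin.
by rewrite le_eqVlt; apply/orP; left; apply/eqP; ring.
Qed.

Definition equiv_bound (q E0 : R) : R :=
  4 * (removal_cost q ^+ 2 + L ^+ 2 * form_dev (q / v ^+ 2) + (L ^+ 2 * tau q) ^+ 2 * (form_dev v^-1 + E0)).

Let inv_sqr_le : n%:R^-1 ^+ 2 <= (n%:R^-1 : R).
Proof. by rewrite expr2 ler_piMl // invf_le1 ?ltr0n // ler1n. Qed.

Lemma mean2_fin f r : (mean2 f <= r%:E)%E -> mean2 f = (fine (mean2 f))%:E.
Proof.
move=> h; rewrite fineK // ge0_fin_numE ?mean2_ge0 //.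
exact: le_lt_trans h (ltry _).
Qed.

(** Averaging over the columns: the individual distances of e_k to
   n^-1 tr Sigma_k R enter through their mean only, which is how a bound on this
   mean is enough. *)
Lemma mean2_det_map Q q e E0 : 0 <= q -> opb q Q -> (forall k, good z (e k)) -> 0 <= E0 ->
  (\sum_(k < n) mean2 (fun x => res_trace (Sig k) x - e k)%R <= (E0 / n%:R)%:E)%E ->
  (mean2 (fun x => res_trace Q x - det_map Bn A z Q e)%R <= (equiv_bound q E0 / n%:R)%:E)%E.
Proof.
move=> q0 hQ ge E00 hE.
set G := Q *m invmx (det_mx Bn A z e).
have hG : opb (q / v) G.
  by apply: opbM => //; exact: coercive_opb z0 (det_mx_resolvent_like Bn hA z0 ge).1.
pose l (k : 'I_n) := (mean2 (fun x => res_trace (Sig k) x - e k)%R).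
have l0 k : (0 <= l k)%E by exact: mean2_ge0.
have lE k : l k = (fine (l k))%:E.
  apply: (@mean2_fin _ (E0 / n%:R)); apply: le_trans hE.
  rewrite (bigD1 k) //= -[X in (X <= _)%E]adde0; apply: leeD => //.
  by apply: sume_ge0 => j _; exact: l0.
have -> : (fun x => res_trace Q x - det_map Bn A z Q e) =
    (fun x => n%:R^-1 * \sum_(k < n) summand G e k x).
  by apply/funext => x; exact: res_trace_det_map.
apply: (le_trans (mean2_avg (summand_cmeas G e))).
have sl : \sum_(k < n) fine (l k) <= E0 / n%:R.
  by rewrite -lee_fin -sumEFin; apply: le_trans hE; apply: lee_sum => k _; rewrite -lE.
have lk k : (l k <= (fine (l k))%:E)%E by rewrite -lE.
pose b := (n%:R^-1 * removal_cost q) ^+ 2 + L ^+ 2 * (form_dev (q / v ^+ 2) / n%:R) +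
  (L ^+ 2 * tau q) ^+ 2 * (form_dev v^-1 / n%:R).
have hk (k : 'I_n) : (mean2 (summand G e k) <=
    (4 * (b + (L ^+ 2 * tau q) ^+ 2 * fine (l k)))%:E)%E.
  have h := mean2_summand q0 hG (ge k) (lk k); apply: (le_trans h).
  rewrite lee_fin /b; move: (form_dev _) (form_dev _) (removal_cost _) (tau _) (fine _) => d1 d2 kq t r.
  by rewrite le_eqVlt; apply/orP; left; apply/eqP; ring.
apply: (@le_trans _ _ ((n%:R^-1)%:E * \sum_(k < n)
    (4 * (b + (L ^+ 2 * tau q) ^+ 2 * fine (l k)))%:E)%E).
  by apply: lee_wpmul2l => //; apply: lee_sum => k _; exact: hk.
rewrite sumEFin -EFinM lee_fin -mulr_sumr big_split /= sumr_const card_ord -mulr_sumr.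
have n1 : n%:R != 0 :> R by rewrite pnatr_eq0 -lt0n.
rewrite -[b *+ n]mulr_natl mulrCA mulrDr [n%:R^-1 * (n%:R * b)]mulKf //.
have M0 : 0 <= (L ^+ 2 * tau q) ^+ 2 by exact: sqr_ge0.
have k1 : n%:R^-1 * ((L ^+ 2 * tau q) ^+ 2 * \sum_(k < n) fine (l k)) <=
    (L ^+ 2 * tau q) ^+ 2 * (E0 / n%:R).
  rewrite mulrCA; apply: ler_wpM2l => //.
  apply: (@le_trans _ _ (n%:R^-1 * (E0 / n%:R))); first exact: ler_wpM2l.
  by apply: ler_piMl; [exact: divr_ge0|rewrite invf_le1 ?ltr0n // ler1n].
have k2 : (n%:R^-1 * removal_cost q) ^+ 2 <= removal_cost q ^+ 2 / n%:R.
  by rewrite exprMn mulrC; apply: ler_wpM2l; rewrite ?sqr_ge0.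
rewrite /equiv_bound -[4 * _ / _]mulrA; apply: ler_wpM2l => //.
have gen (kq l2 d1 t d2 r i : R) : (kq + l2 * d1 + t * (d2 + r)) * i =
    kq * i + l2 * (d1 * i) + t * (d2 * i) + t * (r * i) by ring.
by rewrite gen; apply: lerD => //; rewrite /b; apply: lerD => //; apply: lerD.
Qed.

Lemma exists_below_mean (G : T -> \bar R) (a b : R) : measurable_fun setT G ->
  (forall w, 0 <= G w)%E -> (\int[P]_w G w <= a%:E)%E -> 0 <= b -> a < b ->
  exists w, (G w <= b%:E)%E.
Proof.
move=> mG G0 Ga b0 ab; apply: contrapT => h.
have hb w : (b%:E <= G w)%E.
  by rewrite leNgt; apply/negP => hw; apply: h; exists w; exact: ltW.
have PT : P setT = 1%E by exact: probability_setT.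
have : (\int[P]_w b%:E <= \int[P]_w G w)%E by apply: ge0_le_integral.
rewrite integral_cst //= [X in (_ * X)%E]PT mule1 => hb2.
by have := le_trans hb2 Ga; rewrite lee_fin leNgt ab.
Qed.

(** Otherwise the sum of G1 and of the average of the G k would exceed its mean
   everywhere. *)
Lemma exists_below_means (G1 : T -> \bar R) (G : 'I_n -> T -> \bar R) (r s e : R) :
  measurable_fun setT G1 -> (forall k, measurable_fun setT (G k)) ->
  (forall w, 0 <= G1 w)%E -> (forall k w, 0 <= G k w)%E ->
  (\int[P]_w G1 w <= r%:E)%E -> (forall k, \int[P]_w G k w <= s%:E)%E ->
  0 <= r -> 0 <= s -> 0 < e ->
  exists w, (G1 w <= (r + s + e)%:E)%E /\ (\sum_k G k w <= (n%:R * (r + s + e))%:E)%E.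
Proof.
move=> m1 mG p1 pG h1 hG r0 s0 e0.
have n1 : n%:R != 0 :> R by rewrite pnatr_eq0 -lt0n.
have i0' : (0 <= (n%:R^-1)%:E :> \bar R)%E by rewrite lee_fin.
pose S w := (\sum_k G k w)%E.
have S0 w : (0 <= S w)%E by apply: sume_ge0 => k _; exact: pG.
have mS : measurable_fun setT S by exact: emeasurable_sum.
have mS' : measurable_fun setT (fun w => (n%:R^-1)%:E * S w)%E by exact: emeasurable_funM.
have S0' w : (0 <= (n%:R^-1)%:E * S w)%E by exact: mule_ge0.
have [w hw] : exists w, (G1 w + (n%:R^-1)%:E * S w <= (r + s + e)%:E)%E.
  apply: (@exists_below_mean _ (r + s)).
  - exact: emeasurable_funD.
  - by move=> w; exact: adde_ge0.
  - rewrite ge0_integralD // EFinD; apply: leeD => //.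
    rewrite ge0_integralZl // ge0_integral_sum //.
    apply: (@le_trans _ _ ((n%:R^-1)%:E * \sum_(k < n) s%:E)%E).
      by apply: lee_wpmul2l => //; apply: lee_sum => k _; exact: hG.
    by rewrite sumEFin sumr_const card_ord -EFinM lee_fin -(mulr_natl s) mulKf.
  - by rewrite addr_ge0 ?addr_ge0 // ltW.
  - by rewrite ltrDl.
exists w; split.
  by apply: le_trans hw; rewrite -[X in (X <= _)%E]adde0; apply: leeD.
have h : ((n%:R^-1)%:E * S w <= (r + s + e)%:E)%E.
  by apply: le_trans hw; rewrite -[X in (X <= _)%E]add0e; apply: leeD.
have n0' : (0 <= n%:R%:E :> \bar R)%E by rewrite lee_fin.
by have := lee_wpmul2l n0' h; rewrite muleA -!EFinM mulfV // mul1e.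
Qed.

Definition total_fluct : R := fluct 1 + fluct K + 1.

Let center_dev (Q : 'M[C]_p) (w' : T) : \bar R :=
  mean2 (fun x => res_trace Q x - res_trace Q (fam X w'))%R.

Lemma fluct_ge0 q : 0 <= fluct q.
Proof.
by rewrite /fluct mulr_ge0 // addr_ge0 // mulr_ge0 ?sqr_ge0 // form_dev_ge0.
Qed.

Let center_dev_mean Q q : 0 <= q -> opb q Q ->
  measurable_fun setT (center_dev Q) /\
  (\int[P]_w' center_dev Q w' <= (fluct q / n%:R ^+ 2)%:E)%E.
Proof.
move=> q0 hQ; pose g (w : T * T) : \bar R :=
  (cabs (res_trace Q (fam X w.1) - res_trace Q (fam X w.2)) ^+ 2)%:E.
have [mr mi] := res_trace_cmeas Q.
have mf := fam_measurable_fun mX.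
have mg : measurable_fun setT g.
  apply/measurable_EFinP; apply: measurable_cabs2; apply: cmeasB; split.
  - exact: (measurableT_comp mr (measurableT_comp mf (@measurable_fst _ _ T T))).
  - exact: (measurableT_comp mi (measurableT_comp mf (@measurable_fst _ _ T T))).
  - exact: (measurableT_comp mr (measurableT_comp mf (@measurable_snd _ _ T T))).
  - exact: (measurableT_comp mi (measurableT_comp mf (@measurable_snd _ _ T T))).
have g0 w : (0 <= g w)%E by rewrite lee_fin sqr_ge0.
split; first exact: (@measurable_fun_fubini_tonelli_G _ _ _ _ _ P g mg g0).
have := res_trace_variance q0 hQ.
by rewrite (@fubini_tonelli2 _ _ _ _ _ P P g mg g0).
Qed.

(** The mean over two independent realizations is an iterated mean, so some
   realization, used as a centre, does at least as well as the average one. *)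
Lemma exists_center : exists x0 : W,
  (mean2 (fun x => res_trace 1%:M x - res_trace 1%:M x0)%R <= (total_fluct / n%:R ^+ 2)%:E)%E /\
  (\sum_(k < n) mean2 (fun x => res_trace (Sig k) x - res_trace (Sig k) x0)%R
    <= (total_fluct / n%:R)%:E)%E.
Proof.
have n1 : n%:R != 0 :> R by rewrite pnatr_eq0 -lt0n.
have [m1 h1] := center_dev_mean ler01 (@opb1 R p).
have hk (k : 'I_n) := center_dev_mean K0 (gramb_opb K0 (hB (ltn_ord k))).
have c0' Q w' : (0 <= center_dev Q w')%E by exact: mean2_ge0.
have f0 q : 0 <= fluct q / n%:R ^+ 2 by rewrite divr_ge0 ?sqr_ge0 // fluct_ge0.
have e0 : 0 < (n%:R ^+ 2)^-1 :> R by rewrite invr_gt0 exprn_gt0 // ltr0n.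
have [w' [h2 h3]] := exists_below_means m1 (fun k => (hk k).1) (c0' _) (fun k => c0' (Sig k))
  h1 (fun k => (hk k).2) (f0 1) (f0 K) e0.
have E : fluct 1 / n%:R ^+ 2 + fluct K / n%:R ^+ 2 + (n%:R ^+ 2)^-1 = total_fluct / n%:R ^+ 2.
  by rewrite /total_fluct !mulrDl mul1r.
exists (fam X w'); split; first by move: h2; rewrite E.
have E' : n%:R * (total_fluct / n%:R ^+ 2) = total_fluct / n%:R by field.
by move: h3; rewrite E E'.
Qed.

Definition equiv_rate : R := 4 * (total_fluct + equiv_bound 1 total_fluct) +
  16 * (L ^+ 2 * K * c / v ^+ 2) ^+ 2 * (total_fluct + equiv_bound K total_fluct).

Let total0 : 0 <= total_fluct.
Proof. by rewrite /total_fluct addr_ge0 // addr_ge0 // fluct_ge0. Qed.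

Let center_le Q q e x0 r : 0 <= q -> opb q Q -> (forall k, good z (e k)) ->
  (mean2 (fun x => res_trace Q x - res_trace Q x0)%R <= r%:E)%E ->
  (\sum_(k < n) mean2 (fun x => res_trace (Sig k) x - e k)%R <= (total_fluct / n%:R)%:E)%E ->
  cabs (res_trace Q x0 - det_map Bn A z Q e) ^+ 2 <= 2 * (r + equiv_bound q total_fluct / n%:R).
Proof.
move=> q0 hQ ge hr he; have h := mean2_det_map q0 hQ ge total0 he.
rewrite -lee_fin -mean2_cst; set b := equiv_bound _ _ / _ in h *.
have mQ := res_trace_cmeas Q.
have H (y u : C) : (mean2 (fun x => res_trace Q x - y)%R <= r%:E)%E ->
    (mean2 (fun x => res_trace Q x - u)%R <= b%:E)%E ->
    (mean2 (fun=> (y - u)%R) <= (2 * (1 ^+ 2 * r + 1 ^+ 2 * b))%:E)%E.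
  have my := cmeasB mQ (@cmeas_cst _ W R y); have mu' := cmeasB mQ (@cmeas_cst _ W R u).
  have hx (x : W) : cabs (y - u) <= 1 * cabs (res_trace Q x - y) + 1 * cabs (res_trace Q x - u).
    have -> : y - u = (res_trace Q x - u) - (res_trace Q x - y) by ring.
    by rewrite !mul1r [leRHS]addrC; exact: cabsB.
  by move=> h1 h2; exact: (mean2_le2 (@cmeas_cst _ W R (y - u)) my mu' ler01 ler01 hx h1 h2).
by have := H _ _ hr h; rewrite expr1n !mul1r.
Qed.

(** The traces of the representative realization solve the deterministic system
   approximately; as the system is a contraction, they are close to its exact
   solution. *)
Lemma det_equivalent (e : 'I_n -> C) :
  (forall (k : 'I_n) f g, (forall k, good z (f k)) -> (forall k, good z (g k)) ->
    cabs (det_map Bn A z (Sig k) f - det_map Bn A z (Sig k) g) <=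
      2^-1 * (n%:R^-1 * \sum_(j < n) cabs (f j - g j))) ->
  (forall k, good z (e k)) -> (forall k : 'I_n, e k = det_map Bn A z (Sig k) e) ->
  exists a : C,
    (mean2 (fun x => res_trace 1%:M x - a)%R <= (total_fluct / n%:R ^+ 2)%:E)%E /\
    cabs (a - det_map Bn A z 1%:M e) ^+ 2 <= equiv_rate / n%:R.
Proof.
move=> hT ge eE; have [x0 [h1 hS]] := exists_center.
have n1 : n%:R != 0 :> R by rewrite pnatr_eq0 -lt0n.
exists (res_trace 1%:M x0); split => //.
pose f (k : 'I_n) := res_trace (Sig k) x0.
have gf k : good z (f k) by exact: trace_good.
pose l (k : 'I_n) := mean2 (fun x => res_trace (Sig k) x - f k)%R.
have l0 k : (0 <= l k)%E by exact: mean2_ge0.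
have lE k : l k = (fine (l k))%:E.
  apply: (@mean2_fin _ (total_fluct / n%:R)); apply: le_trans hS.
  rewrite (bigD1 k) //= -[X in (X <= _)%E]adde0; apply: leeD => //.
  by apply: sume_ge0 => j _; exact: l0.
have sl : \sum_(k < n) fine (l k) <= total_fluct / n%:R.
  by rewrite -lee_fin -sumEFin; apply: le_trans hS; apply: lee_sum => k _; rewrite -lE.
have lk k : (l k <= (fine (l k))%:E)%E by rewrite -lE.
pose dl (k : 'I_n) := cabs (f k - det_map Bn A z (Sig k) f).
pose bK := equiv_bound K total_fluct; pose b1 := equiv_bound 1 total_fluct.
have hd (k : 'I_n) : dl k ^+ 2 <= 2 * (fine (l k) + bK / n%:R).
  exact: (center_le K0 (gramb_opb K0 (hB (ltn_ord k))) gf (lk k) hS).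
have hd1 := center_le ler01 (@opb1 R p) gf h1 hS.
pose eta := n%:R^-1 * \sum_(j < n) cabs (f j - e j).
have eta0 : 0 <= eta by apply: mulr_ge0 => //; apply: sumr_ge0 => j _; exact: cabs_ge0.
have in2 : total_fluct / n%:R ^+ 2 <= total_fluct / n%:R.
  by rewrite -[_ / n%:R ^+ 2]/(_ * _) -exprVn; apply: ler_wpM2l.
have eta_le : eta <= 2 * (n%:R^-1 * \sum_(j < n) dl j).
  have h (j : 'I_n) : cabs (f j - e j) <= dl j + 2^-1 * eta.
    have -> : f j - e j = (f j - det_map Bn A z (Sig j) f) +
        (det_map Bn A z (Sig j) f - det_map Bn A z (Sig j) e) by rewrite -eE addrA subrK.
    by apply: (le_trans (cabsD _ _)); apply: lerD => //; exact: hT.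
  have : eta <= n%:R^-1 * \sum_(j < n) (dl j + 2^-1 * eta).
    by apply: ler_wpM2l => //; apply: ler_sum => j _; exact: h.
  rewrite big_split /= sumr_const card_ord -(mulr_natl (2^-1 * eta)) mulrDr mulKf //.
  by move: (n%:R^-1 * _) (eta) => s t; lra.
have eta2 : eta ^+ 2 <= 8 * ((total_fluct + bK) / n%:R).
  have d0 : 0 <= n%:R^-1 * \sum_(j < n) dl j.
    by apply: mulr_ge0 => //; apply: sumr_ge0 => j _; exact: cabs_ge0.
  apply: (@le_trans _ _ ((2 * (n%:R^-1 * \sum_(j < n) dl j)) ^+ 2)).
    apply: lerXn2r; rewrite ?nnegrE //; exact: mulr_ge0.
  rewrite exprMn; have := avg_sqr dl.
  have : n%:R^-1 * \sum_(k < n) dl k ^+ 2 <= 2 * (total_fluct / n%:R + bK / n%:R).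
    apply: (@le_trans _ _ (n%:R^-1 * \sum_(k < n) 2 * (fine (l k) + bK / n%:R))).
      by apply: ler_wpM2l => //; apply: ler_sum => k _; exact: hd.
    rewrite -mulr_sumr big_split /= sumr_const card_ord -(mulr_natl (bK / n%:R)) mulrCA.
    apply: ler_wpM2l => //; rewrite mulrDr mulKf // lerD2r.
    apply: (@le_trans _ _ (n%:R^-1 * (total_fluct / n%:R))); first exact: ler_wpM2l.
    by rewrite mulrC -mulrA -expr2 exprVn.
  have gen (s t a b : R) : s <= 2 * (a + b) -> t <= s -> 2 ^+ 2 * t <= 8 * (a + b).
    by move=> g1 g2; lra.
  by rewrite [(total_fluct + bK) / n%:R]mulrDl => g1 g2; exact: gen g1 g2.
pose Lam := L ^+ 2 * K * c / v ^+ 2.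
have Lam0 : 0 <= Lam.
  by rewrite /Lam divr_ge0 ?sqr_ge0 //; apply: mulr_ge0 => //; apply: mulr_ge0 => //; exact: sqr_ge0.
have hl : cabs (det_map Bn A z 1%:M f - det_map Bn A z 1%:M e) <= Lam * eta.
  have hBn (k : 'I_n) : gramb K (Bn k) by exact: hB.
  apply: (le_trans (det_map_lip hA z0 ler01 (@opb1 R p) hBn gf ge)).
  apply: ler_wpM2r => //; rewrite /Lam mulr1; apply: ler_wpM2r.
    by rewrite invr_ge0 sqr_ge0.
  by apply: ler_wpM2l => //; apply: mulr_ge0 => //; exact: sqr_ge0.
have fin (y u w : C) : w = y + u -> cabs y ^+ 2 <= 2 * (total_fluct / n%:R ^+ 2 + b1 / n%:R) ->
    cabs u <= Lam * eta -> cabs w ^+ 2 <= equiv_rate / n%:R.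
  move=> -> hy hu; apply: (@le_trans _ _ (2 * (cabs y ^+ 2 + (Lam * eta) ^+ 2))).
    apply: le_trans (sqr_sum2_le _ _).
    have Le0 : 0 <= Lam * eta by exact: mulr_ge0.
    have b0 : 0 <= cabs y + Lam * eta by apply: addr_ge0 => //; exact: cabs_ge0.
    apply: lerXn2r; rewrite ?nnegrE ?cabs_ge0 //.
    by apply: (le_trans (cabsD _ _)); rewrite lerD2l.
  have hL : (Lam * eta) ^+ 2 <= Lam ^+ 2 * (8 * ((total_fluct + bK) / n%:R)).
    by rewrite exprMn; apply: ler_wpM2l; rewrite ?sqr_ge0.
  have gen (a b1' g bk i : R) : (4 * (a + b1') + 16 * g * (a + bk)) * i =
     2 * (2 * (a * i + b1' * i) + g * (8 * ((a + bk) * i))) by ring.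
  rewrite /equiv_rate gen; apply: ler_wpM2l => //; apply: lerD => //.
  apply: (le_trans hy); apply: ler_wpM2l => //.
  by rewrite lerD2r.
by apply: fin hd1 hl; rewrite addrA subrK.
Qed.

End Model.

(** * Almost sure convergence *)

Section Standardization.
Context d (T : measurableType d) (R : realType) (P : probability T R).
Variables (I : Type) (X : I -> T -> R[i]) (mu : R) (i0 : I).
Hypotheses (mX : forall i, complex_rv (X i)) (dX : identically_distributed P X).

(** The moments depend only on the law. *)
Lemma standardized_all : standardized P mu (X i0) -> forall i, standardized P mu (X i).
Proof.
move=> [_ E1 E2 E4] i; have hl D : measurable D -> _ := @dX i i0 D.
have mabs n : measurable_fun setT (fun y : R * R => (cabs (y.1 +i* y.2) ^+ n)%:E).
  apply/measurable_EFinP; apply: measurable_funX; apply: measurable_cabs; split.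
    exact: measurable_fst.
  exact: measurable_snd.
have mom n : (\int[P]_w (cabs (X i w) ^+ n)%:E = \int[P]_w (cabs (X i0 w) ^+ n)%:E)%E.
  have pos (y : R * R) : (0 <= (cabs (y.1 +i* y.2) ^+ n)%:E)%E.
    by rewrite lee_fin exprn_ge0 // cabs_ge0.
  have := same_law_ge0_integral (mX i) (mX i0) hl (mabs n) pos.
  have e j w : (@cpair R \o X j) w = cpair (X j w) by [].
  have e2 j w : (cpair (X j w)).1 +i* (cpair (X j w)).2 = X j w by case: (X j w).
  under eq_integral do rewrite e e2.
  by under [in RHS]eq_integral do rewrite e e2.
split; rewrite ?mom //; apply: eqC.
  have h := same_law_Rintegral (mX i) (mX i0) hl (@measurable_fst _ _ R R).
  exact: etrans h (congr1 (@cRe R) E1).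
have h := same_law_Rintegral (mX i) (mX i0) hl (@measurable_snd _ _ R R).
exact: etrans h (congr1 (@cIm R) E1).
Qed.

End Standardization.

Section SquareSummable.
Context d (T : measurableType d) (R : realType) (P : {measure set T -> \bar R}).
Local Notation C := R[i].

(** By comparison with the telescoping series of 1 / (k (k + 1)). *)
Lemma sum_inv_sqr (N : nat) : \sum_(k < N) ((k.+1)%:R ^+ 2)^-1 <= 2 :> R.
Proof.
suff h : forall M, \sum_(k < M.+1) ((k.+1)%:R ^+ 2)^-1 <= 2 - (M.+1%:R)^-1 :> R.
  case: N => [|N]; first by rewrite big_ord0.
  by apply: (le_trans (h N)); rewrite gerBl invr_ge0.
elim=> [|M IH]; first by rewrite big_ord1 expr1n invr1; lra.
rewrite big_ord_recr /=; apply: (le_trans (lerD IH (lexx _))).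
have -> : M.+2%:R = M.+1%:R + 1 :> R by rewrite -natr1.
have m0 : 0 < M.+1%:R :> R by rewrite ltr0n.
move: (M.+1%:R) m0 => m m0.
have m1 : 0 < m + 1 by lra.
rewrite -subr_ge0.
have -> : 2 - (m + 1)^-1 - (2 - m^-1 + ((m + 1) ^+ 2)^-1) = (m * (m + 1) ^+ 2)^-1.
  by field; rewrite !gt_eqF.
by rewrite invr_ge0 mulr_ge0 ?sqr_ge0 // ltW.
Qed.

Lemma vanish_square_summable (u : nat -> C) (M : R) :
  (forall N, \sum_(k < N) cabs (u k) ^+ 2 <= M) -> vanish \oo u.
Proof.
move=> hM e e0.
have h : (fun k => cabs (u k) ^+ 2) @ \oo --> (0 : R).
  apply: cvg_series_cvg_0; apply: nondecreasing_is_cvgn.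
    apply/nondecreasing_seqP => k; rewrite /series /= big_nat_recr //= lerDl.
    exact: sqr_ge0.
  exists M => _ [N _ <-]; rewrite /series /= big_mkord; exact: hM.
have e2 : 0 < e ^+ 2 by exact: exprn_gt0.
move/cvgrPdist_le: h => /(_ _ e2); apply: filterS => k /=.
rewrite sub0r normrN ger0_norm ?sqr_ge0 // => h.
by rewrite -(ler_pXn2r (n := 2)) ?nnegrE ?cabs_ge0 // ltW.
Qed.

(** Mean squares of order 1/n^2 are summable, so that almost surely the squares
   themselves are. *)
Lemma ae_vanish (f : nat -> T -> C) (F : R) : (forall k, cmeas (f k)) -> 0 <= F ->
  (forall k, \int[P]_w (cabs (f k w) ^+ 2)%:E <= (F / (k.+1)%:R ^+ 2)%:E)%E ->
  {ae P, forall w, vanish \oo (fun k => f k w)}.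
Proof.
move=> mf F0 hF; pose g k w : \bar R := (cabs (f k w) ^+ 2)%:E.
have mg k : measurable_fun setT (g k).
  by apply/measurable_EFinP; exact: measurable_cabs2.
have g0 k w : (0 <= g k w)%E by rewrite lee_fin sqr_ge0.
pose G w := (\sum_(k <oo) g k w)%E.
have G0 w : (0 <= G w)%E by apply: nneseries_ge0.
have mG : measurable_fun setT G.
  by apply: ge0_emeasurable_sum => [k w _ _|k _]; [exact: g0|exact: mg].
have IG : (\int[P]_w G w <= (2 * F)%:E)%E.
  rewrite (integral_nneseries P measurableT mg (fun k w _ => g0 k w)).
  apply: lime_le; first by apply: is_cvg_nneseries => k _ _; apply: integral_ge0.
  near=> N; rewrite big_mkord.
  apply: (@le_trans _ _ (\sum_(k < N) (F / (k.+1)%:R ^+ 2)%:E)%E).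
    by apply: lee_sum => k _; exact: hF.
  rewrite sumEFin lee_fin -mulr_sumr mulrC; apply: ler_wpM2r => //.
  exact: sum_inv_sqr.
have intG : P.-integrable setT G.
  apply/integrableP; split => //.
  under eq_integral do rewrite gee0_abs //.
  exact: le_lt_trans IG (ltry _).
have := integrable_ae measurableT intG; apply: filterS => w /(_ I) fG.
apply: (@vanish_square_summable _ (fine (G w))) => N.
rewrite -lee_fin fineK // -sumEFin /G.
have := @nneseries_lim_ge R (g ^~ w) xpredT 0%N N (fun k _ _ => g0 k w).
by rewrite big_mkord.
Unshelve. all: by end_near. Qed.

End SquareSummable.

(** * Convergence on the whole upper half-plane *)

Section Assembly.
Context d (T : measurableType d) (R : realType) (P : probability T R).
Local Notation C := R[i].
Local Notation nrm := (@l2norm R _).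
Local Notation mR := (measurableTypeR R).

Lemma spectral_norm_ub a b (M : 'M[C]_(a, b)) v : nrm (M *m v) <= spectral_norm M * nrm v.
Proof.
have [v0|v0] := eqVneq (nrm v) 0.
  by rewrite (nrm_eq0 v0) mulmx0 !nrm0 mulr0.
have vp : 0 < nrm v by rewrite lt_def v0 nrm_ge0.
have iv : 0 <= (nrm v)^-1 by rewrite invr_ge0 nrm_ge0.
have sE w : nrm (((nrm v)^-1)%:C *: w : 'cV[C]_a) = (nrm v)^-1 * nrm w.
  by rewrite nrmZ cabsR ger0_norm.
rewrite -ler_pdivrMr // mulrC -sE scalemxAr.
apply: ub_le_sup; last first.
  exists (((nrm v)^-1)%:C *: v) => //=.
  by rewrite nrmZ cabsR ger0_norm // mulVf.
have [c c0 hc] := opb_exists M; exists c => _ [w /= w1 <-].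
by apply: (le_trans (hc w)); rewrite -[leRHS]mulr1; apply: ler_wpM2l.
Qed.

Lemma gramb_spectral a b (B : 'M[C]_(a, b)) K : spectral_norm (pop_cov B) <= K -> gramb K B.
Proof.
move=> hK u; have h := dot_CS u (B *m B ^t* *m u).
rewrite dot_gram cabsR ger0_norm ?sqr_ge0 // in h.
apply: (le_trans h); have h2 := spectral_norm_ub (pop_cov B) u.
have -> : K * nrm u ^+ 2 = nrm u * (K * nrm u) by ring.
apply: ler_wpM2l; first exact: nrm_ge0.
by apply: (le_trans h2); apply: ler_wpM2r; first exact: nrm_ge0.
Qed.

Lemma gram_tr1 n : gram_tr (1%:M : 'M[C]_n) <= n%:R.
Proof.
have g1 : gramb 1 (1%:M : 'M[C]_n) by move=> u; rewrite trmx1 map_mx1 mul1mx mul1r.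
by have := gram_tr_le g1; rewrite mul1r.
Qed.

(** A trace is a sum of quadratic forms over the columns of B. *)
Lemma trace_is_discr n a b (H : 'M[C]_a) (B : 'M[C]_(a, b)) : nonneg_def H ->
  is_discr (n%:R^-1 * gram_tr B) (fun z => n%:R^-1 * \tr (B *m B ^t* *m invmx (H - z%:M))).
Proof.
move=> hH; have i0 : 0 <= (n%:R^-1 : R) by rewrite invr_ge0.
have h : is_discr (gram_tr B)
    (fun z => \sum_(j < b) dot (matrix.col j B) (invmx (H - z%:M) *m matrix.col j B)).
  by apply: is_discr_sum => j; exact: spectral_is_discr.
apply: is_discr_eq (is_discrZ i0 h) => z z0.
by rewrite -natVC mxtrace_mulC mxtrace_gram.
Qed.

(** The estimates are indexed by t with n = t + 1, which avoids the degenerate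
   case n = 0. *)
Lemma vanish_shift (u : nat -> C) : vanish \oo (fun t => u t.+1) -> vanish \oo u.
Proof.
move=> h e /h[N _ hN]; exists N.+1 => // -[//|n] /= Nn.
exact: hN.
Qed.

Lemma vanish_sqr_le (u : nat -> C) (M : R) :
  (forall t, cabs (u t) ^+ 2 <= M / t.+1%:R) -> vanish \oo u.
Proof.
move=> hM e e0; have e2 : 0 < e ^+ 2 by exact: exprn_gt0.
have h : (fun t => M * harmonic t) @ \oo --> (0 : R).
  by rewrite -(mulr0 M); apply: cvgMr; exact: cvg_harmonic.
move/cvgrPdist_le: h => /(_ _ e2); apply: filterS => t /=.
rewrite sub0r normrN => h.
rewrite -(ler_pXn2r (n := 2)) ?nnegrE ?cabs_ge0 ?(ltW e0) //.
by apply: (le_trans (hM t)); apply: le_trans h; exact: ler_norm.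
Qed.

Variable X : nat * nat -> T -> C.
Variable mu : R.
Hypotheses (mX : forall i, complex_rv (X i)) (iX : independent P X).
Hypothesis sX : forall i, standardized P mu (X i).
Variables (p : nat -> nat) (m : nat -> nat -> nat).
Variables (B : forall n k, 'M[C]_(p n, m n k)) (A : forall n, 'M[C]_(p n)).
Variables (K c : R).
Hypotheses (K0 : 0 <= K) (c0 : 0 <= c).
Hypothesis hpn : forall n, (p n)%:R / n%:R <= c.
Hypothesis hA : forall n, (0 < n)%N -> nonneg_def (A n).
Hypothesis hB : forall n k, (k < n)%N -> gramb K (B n k).
Variable e : forall n, 'I_n -> C -> C.
Arguments e : clear implicits.
Hypothesis he : forall n, (0 < n)%N ->
  det_solution (fun k : 'I_n => pop_cov (B n k)) (A n) (e n).

Local Notation Bn n := (fun k : 'I_n => B n k).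

Definition rand_tr n w z : C := res_trace n (B n) (A n) z 1%:M (fam X w).
Definition det_tr n z : C := det_map (Bn n) (A n) z 1%:M (fun k => e n k z).

Let hBn n (k : 'I_n) : gramb K (B n k). Proof. exact: hB. Qed.

(** The mean square of the fluctuation around the deterministic number a_n is
   summable, and a_n is within O(n^-1/2) of the deterministic equivalent. *)
Lemma ae_vanish_far x v : far K c x <= v ->
  {ae P, forall w, vanish \oo (fun t => rand_tr t.+1 w (x +i* v) - det_tr t.+1 (x +i* v))}.
Proof.
move=> hv; set z := x +i* v.
have z0 : 0 < cIm z by apply: lt_le_trans hv; exact: far_gt0.
have /choice[a ha] : forall t, exists a : C,
    (mean2 P X (fun y => res_trace t.+1 (B t.+1) (A t.+1) z 1%:M y - a)%R <=
      (total_fluct mu K c z / t.+1%:R ^+ 2)%:E)%E /\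
    cabs (a - det_tr t.+1 z) ^+ 2 <= equiv_rate mu K c z / t.+1%:R.
  move=> t; apply: (det_equivalent mX iX sX _ K0 c0 (hpn _) (hA _) (@hB t.+1) z0) => //.
  - by move=> k f g; exact: (det_map_contract (hA (ltn0Sn t)) K0 (@hBn t.+1) k (hpn _) hv).
  - move=> k; apply: is_stieltjes_good z0; exact: (he (ltn0Sn t)).1.
  - move=> k; exact: (det_solution_map (he (ltn0Sn t)) k z0).
have mf t : cmeas (fun w => rand_tr t.+1 w z - a t).
  have [h1 h2] : cmeas (fun y => res_trace t.+1 (B t.+1) (A t.+1) z 1%:M y - a t).
    by apply: cmeasB; [exact: res_trace_cmeas (hA (ltn0Sn t)) z0 _|exact: cmeas_cst].
  have mfam := fam_measurable_fun mX.
  by split; [exact: (measurableT_comp h1 mfam)|exact: (measurableT_comp h2 mfam)].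
have F0 : 0 <= total_fluct mu K c z.
  by rewrite /total_fluct addr_ge0 // addr_ge0 // (fluct_ge0 sX).
have := ae_vanish mf F0 (fun t => (ha t).1); apply: filterS => w hw.
have h2 := vanish_sqr_le (fun t => (ha t).2).
apply: (vanish_le (M := 1)) (vanishD hw h2) => t.
by rewrite mul1r addrA subrK.
Qed.

Let tr_mass n : n%:R^-1 * gram_tr (1%:M : 'M[C]_(p n)) <= c.
Proof.
apply: le_trans (hpn n); rewrite mulrC; apply: ler_wpM2r; last exact: gram_tr1.
by rewrite invr_ge0.
Qed.

Let tr_mass0 n : 0 <= n%:R^-1 * gram_tr (1%:M : 'M[C]_(p n)).
Proof. by rewrite mulr_ge0 ?invr_ge0 // gram_tr_ge0. Qed.

Lemma rand_tr_stieltjes n w : (0 < n)%N ->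
  exists nu : {finite_measure set mR -> \bar R}, (nu setT <= c%:E)%E /\
    forall z, 0 < cIm z -> rand_tr n w z = stieltjes nu z.
Proof.
move=> n0; have h := trace_is_discr n 1%:M (cov_mx_nonneg n (B n) (hA n0) predT (fam X w)).
have [nu [h1 h2]] := discr_stieltjes (tr_mass0 n) h.
exists nu; split; first by apply: (le_trans h1); rewrite lee_fin.
by move=> z z0; have := h2 z z0; rewrite trmx1 map_mx1 mulmx1.
Qed.

Lemma det_tr_stieltjes n : (0 < n)%N ->
  exists nu : {finite_measure set mR -> \bar R}, (nu setT <= c%:E)%E /\
    forall z, 0 < cIm z -> det_tr n z = stieltjes nu z.
Proof.
move=> n0; have [f [hf hnu]] := det_solution_exists (hA n0) n0 K0 (@hBn n).
have [nu [h1 h2]] := hnu _ (1%:M : 'M[C]_(p n)).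
exists nu; split; first by apply: (le_trans h1); rewrite lee_fin.
move=> z z0; have h3 := h2 z z0; rewrite trmx1 map_mx1 mulmx1 in h3.
have E : (fun k => e n k z) = (fun k => f k z).
  by apply/funext => k; exact: (det_solution_unique (hA n0) n0 K0 (@hBn n) hf (he n0) k z0).
by rewrite /det_tr E.
Qed.

(** The exceptional set is a countable union, over the points x + i(V + 1/(j+1));
   V is chosen large enough for these points to be far and for z to lie below
   x + 2iV. *)
Lemma ae_vanish_tr z : 0 < cIm z ->
  {ae P, forall w, vanish \oo (fun n => rand_tr n w z - det_tr n z)}.
Proof.
case: z => x y /= y0; pose V := far K c x + y.
have fp : 0 < far K c x by exact: far_gt0.
have V0 : 0 < V by rewrite addr_gt0.
pose v j := V + (j.+1%:R)^-1.
have hv j : far K c x <= v j.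
  by rewrite /v /V -addrA lerDl addr_ge0 ?invr_ge0 // ltW.
have hae : {ae P, forall w, forall j,
    vanish \oo (fun t => rand_tr t.+1 w (x +i* v j) - det_tr t.+1 (x +i* v j))}.
  by apply: ae_foralln => j; exact: ae_vanish_far.
apply: filterS hae => w hw; apply: vanish_shift.
have /choice[nu hnu] : forall t, exists nu : {finite_measure set mR -> \bar R},
    (nu setT <= c%:E)%E /\ forall z, 0 < cIm z -> rand_tr t.+1 w z = stieltjes nu z.
  by move=> t; exact: rand_tr_stieltjes.
have /choice[nu' hnu'] : forall t, exists nu : {finite_measure set mR -> \bar R},
    (nu setT <= c%:E)%E /\ forall z, 0 < cIm z -> det_tr t.+1 z = stieltjes nu z.
  by move=> t; exact: det_tr_stieltjes.
have E u : 0 < u -> (fun t => rand_tr t.+1 w (x +i* u) - det_tr t.+1 (x +i* u)) =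
    (fun t => stieltjes (nu t) (x +i* u) - stieltjes (nu' t) (x +i* u)).
  by move=> u0; apply/funext => t; rewrite (hnu t).2 // (hnu' t).2.
rewrite E //; apply: (stieltjes_vanish _ V0 (fun t => (hnu t).1) (fun t => (hnu' t).1)) => //.
  move=> h0 h0p; have [j hj] : exists j : nat, (j.+1%:R)^-1 <= h0.
    exists (Num.Def.archi_bound h0^-1); rewrite invf_ple ?posrE ?ltr0n //.
    have ih : 0 <= h0^-1 by rewrite invr_ge0 ltW.
    have /ltW h := archi_boundP ih.
    by apply: (le_trans h); rewrite ler_nat.
  exists (j.+1%:R)^-1; split; [by rewrite invr_gt0 ltr0n|exact: hj|].
  rewrite -E; last by rewrite addr_gt0 // invr_gt0 ltr0n.
  exact: hw.
by rewrite /V mulrDr; lra.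
Qed.

End Assembly.

(** * From normalized traces to the empirical spectral distribution *)

Lemma vanish_cvg (R : realType) (u : nat -> R[i]) : vanish \oo u ->
  (u n : R[i]^o) @[n --> \oo] --> (0 : R[i]^o).
Proof.
move=> hu; apply/cvgrPdist_le => -[r s]; rewrite ltcE /= => /andP[/eqP s0 r0].
apply: filterS (hu r r0) => n /= h.
by rewrite sub0r normrN lecE /= s0 eqxx.
Qed.

Lemma sample_mx_cov (R : realType) (T : Type) (n p : nat) (m : nat -> nat)
    (B : forall k, 'M[R[i]]_(p, m k)) (A : 'M[R[i]]_p) (x : nat -> nat -> T -> R[i]) w :
  sample_mx (data_matrix n B (fun j k => x j k w)) A =
  cov_mx n B A predT (fun i => cpair (x i.1 i.2 w)).
Proof.
rewrite /sample_mx /cov_mx; congr (_ + A); congr (_ *: _).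
apply/matrixP => i j; rewrite summxE mxE; apply: eq_bigr => k _.
have E i' : data_matrix n B (fun j k => x j k w) i' k =
    sample_col B k (fun i => cpair (x i.1 i.2 w)) i' 0.
  rewrite mxE /sample_col; congr ((_ *m _) _ _); apply/matrixP => a b; rewrite !mxE /entry /=.
  by case: (x a k w).
have adjE a b (Y : 'M[R[i]]_(a, b)) i' j' : (Y ^t*) i' j' = ((Y j' i')^*)%C by rewrite !mxE.
by rewrite [RHS]mxE big_ord1 !adjE !E.
Qed.

Lemma bounded_ratio (R : realType) (u : nat -> R) (l : R) : u @ \oo --> l ->
  exists2 c, 0 <= c & forall n, u n <= c.
Proof.
move=> hu; have hc : cvgn u by apply/cvg_ex; exists l.
have [M [_ hM]] := cvg_seq_bounded hc.
exists (Num.max (M + 1) 0); first by rewrite le_max lexx orbT.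
move=> n; apply: (le_trans (ler_norm _)); rewrite le_max (hM (M + 1)) //.
by rewrite ltrDl.
Qed.

Theorem theorem1p4 (R : realType) (d : measure_display) (T : measurableType d)
    (P : probability T R)
    (p : nat -> nat)
    (x : nat -> nat -> T -> R[i])
    (m : nat -> nat -> nat)
    (B : forall n k : nat, 'M[R[i]]_(p n, m n k))
    (A : forall n : nat, 'M[R[i]]_(p n))
    (mu c M : R) (ck : nat -> R) :
  (forall n k, (k < n)%N -> (0 < m n k)%N) ->
  (* (a) *)
  (forall j k, complex_rv (x j k)) ->
  independent P (fun jk : nat * nat => x jk.1 jk.2) ->
  identically_distributed P (fun jk : nat * nat => x jk.1 jk.2) ->
  cintegral P (x 0%N 0%N) = 0 ->
  ('E_P[(fun w => cabs (x 0%N 0%N w) ^+ 2)%R] = 1)%E ->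
  ('E_P[(fun w => cabs (x 0%N 0%N w) ^+ 4)%R] = mu%:E)%E ->
  (* (c) *)
  (exists K : R, forall n k, (k < n)%N ->
    spectral_norm (pop_cov (B n k)) <= K) ->
  (* (d) *)
  (forall n, (0 < n)%N -> A n \is hermsymmx /\ nonneg_def (A n)) ->
  (* (e) *)
  0 < c ->
  ((p n)%:R / n%:R : R) @[n --> \oo] --> c ->
  (forall k, 0 < ck k) ->
  (forall k, ((m n k)%:R / n%:R : R) @[n --> \oo] --> ck k) ->
  (limn_esup (fun n => ereal_sup [set (ck k)%:E | k in [set k | (k < n)%N]])
    <= M%:E)%E ->
  let Sigma n (k : 'I_n) := pop_cov (B n k) in
  let S n w := sample_mx (data_matrix n (B n) (fun j k => x j k w)) (A n) in
  (forall n, (0 < n)%N ->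
    exists e : 'I_n -> R[i] -> R[i],
      det_solution (Sigma n) (A n) e /\
      forall e', det_solution (Sigma n) (A n) e' ->
        forall k z, 0 < cIm z -> e' k z = e k z) /\
  (forall e : forall n, 'I_n -> R[i] -> R[i],
    (forall n, (0 < n)%N -> det_solution (Sigma n) (A n) (e n)) ->
    forall z : R[i], 0 < cIm z ->
      {ae P, forall w,
        (stieltjes_esd (S n w) z - det_stieltjes (Sigma n) (A n) (e n) z : R[i]^o)
          @[n --> \oo] --> (0 : R[i]^o)}).
Proof.
move=> _ hx iX dX E1 E2 E4 [K hK] hA c_gt0 hp _ _ _ Sigma S.
have [c' c'0 hpn] := bounded_ratio hp.
pose K' := Num.max K 0.
have K'0 : 0 <= K' by rewrite le_max lexx orbT.
have hB n k : (k < n)%N -> gramb K' (B n k).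
  move=> kn; apply: gramb_spectral; apply: (le_trans (hK n k kn)).
  by rewrite le_max lexx.
have hA' n : (0 < n)%N -> nonneg_def (A n) by move=> /hA[].
split=> [n n0|e he z z0].
  have hBn (k : 'I_n) : gramb K' (B n k) by exact: hB.
  have [e [he _]] := det_solution_exists (hA' n n0) n0 K'0 hBn.
  exists e; split=> // e' he' k z z0.
  exact: (det_solution_unique (hA' n n0) n0 K'0 hBn he he' k z0).
pose X (i : nat * nat) := x i.1 i.2.
have mX i : complex_rv (X i) by exact: hx.
have sX0 : standardized P mu (X (0, 0)%N).
  by split=> //; [move: E2|move: E4]; rewrite unlock.
have sX := standardized_all (i0 := (0, 0)%N) mX dX sX0.
have := ae_vanish_tr mX iX sX K'0 c'0 hpn hA' hB he z0.
apply: filterS => w hw; apply: vanish_cvg => r r0.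
have c2 : 0 < c / 2 by exact: divr_gt0.
have hc : \forall n \near \oo, c / 2 <= (p n)%:R / n%:R.
  move/cvgrPdist_le: hp => /(_ _ c2); apply: filterS => n /= h.
  have := le_trans (ler_norm _) h; lra.
have hn : \forall n \near \oo, (0 < n)%N by exists 1%N.
apply: filterS3 (hw _ (mulr_gt0 r0 c2)) hc hn => n /= h1 h2 n0.
have nR : 0 < n%:R :> R by rewrite ltr0n.
have pn : (0 : R) < (p n)%:R.
  have := lt_le_trans c2 h2; rewrite pmulr_lgt0 //; first by rewrite invr_gt0.
have -> : stieltjes_esd (S n w) z - det_stieltjes (Sigma n) (A n) (e n) z =
    ((p n)%:R / n%:R : R)^-1%:C * (rand_tr X B A n w z - det_tr B A e n z).
  have SE : S n w = cov_mx n (B n) (A n) predT (fam X w) by exact: sample_mx_cov.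
  have hS : nonneg_def (S n w) by rewrite SE; exact: cov_mx_nonneg (hA' n n0) _ _.
  rewrite stieltjes_esdE // SE /rand_tr /det_tr /res_trace /det_map !mul1mx -mulrBr /det_stieltjes -mulrBr.
  rewrite mulrA; congr (_ * _).
  have nC : n%:R != 0 :> R[i] by rewrite pnatr_eq0 -lt0n.
  have pC : (p n)%:R != 0 :> R[i] by rewrite pnatr_eq0 -lt0n -(ltr0n R).
  by rewrite fmorphV rmorphM /= fmorphV !rmorph_nat; field; rewrite nC pC.
rewrite cabsM cabsR ger0_norm ?invr_ge0 ?divr_ge0 //.
rewrite mulrC ler_pdivrMr ?divr_gt0 //; apply: (le_trans h1).
by apply: ler_wpM2l => //; exact: ltW.
Qed.
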